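(* (i) Assume that (UC) and (MM) hold. If every local quantum limit of $\triangle_\ell$ on $M_\ell$ has full support, for $\ell=1,2$, then every local quantum limit of $\triangle$ on $M=M_1\times M_2$ has full support. (ii) Assume that (B) and (MM) hold. If every local quantum limit of $\triangle_\ell$ on $M_\ell$ is absolutely continuous with respect to $\rho_\ell$, for $\ell=1,2$, then every local quantum limit of $\triangle$ on $M=M_1\times M_2$ is absolutely continuous with respect to $\rho=\rho_1\otimes\rho_2$.
   Context: Local quantum limits. Let $X$ be a smooth compact manifold endowed with a probability measure $\nu$, and let $D$ be a self-adjoint operator on $L^2(X,\nu)$ (complex-valued functions), bounded below and with compact resolvent, hence with discrete spectrum. A local quantum limit (local QL) of $D$ on $X$ is a probability Radon measure on $X$ that is a closure point (weak limit) of the family of probability measures $|\phi_\lambda|^2\,\nu$ as $\lambda\to+\infty$, where $\lambda\in\mathrm{Spec}(D)$, $D\phi_\lambda=\lambda\phi_\lambda$ and $\|\phi_\lambda\|_{L^2(X,\nu)}=1$. The set of local QLs is denoted $\mathcal{Q}(X)$. Product setting. For $\ell=1,2$, $M_\ell$ is a smooth compact manifold endowed with a Borel probability measure $\rho_\ell$, and $\triangle_\ell$ is a self-adjoint operator on $L^2(M_\ell,\rho_\ell)$, bounded below and with compact resolvent, with distinct eigenvalues $\lambda^\ell_1<\lambda^\ell_2<\cdots<\lambda^\ell_i<\cdots$, $\lambda^\ell_i\to+\infty$, where $\lambda^\ell_i$ has multiplicity $m^\ell_i\in\mathbb{N}^*=\{1,2,\dots\}$. On $M=M_1\times M_2$ with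 $\rho=\rho_1\otimes\rho_2$, consider the self-adjoint operator $\triangle=\triangle_1\otimes\mathrm{id}_{M_2}+\mathrm{id}_{M_1}\otimes\triangle_2$ on $L^2(M,\rho)$. Its eigenvalues are $\lambda_{i,j}=\lambda^1_i+\lambda^2_j$, $i,j\in\mathbb{N}^*$; $m_{i,j}$ denotes the multiplicity of the eigenvalue $\lambda_{i,j}$ of $\triangle$ (so $m_{i,j}\ge m^1_im^2_j$). Assumptions: (UC) For $\ell=1,2$, any eigenfunction of $\triangle_\ell$ vanishing on a measurable subset of $M_\ell$ of positive measure is identically zero. (B) For $\ell=1,2$, any eigenfunction of $\triangle_\ell$ is bounded (not necessarily uniformly with respect to the eigenfunction). (MM) $m_{i,j}=m^1_i m^2_j$ for all $i,j\in\mathbb{N}^*$. A measure has full support if it gives positive mass to every nonempty open set. *)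

(* Defs.v *)
From HB Require Import structures.
From mathcomp Require Import all_boot all_order all_algebra.
From mathcomp Require Import complex.
From mathcomp Require Import all_classical all_reals all_analysis.

Set Implicit Arguments.
Unset Strict Implicit.
Unset Printing Implicit Defensive.
Import Order.TTheory GRing.Theory Num.Theory.
Import numFieldNormedType.Exports.
Local Open Scope classical_set_scope.
Local Open Scope ring_scope.

(* A product of two such spaces carries the product topology and the product
   sigma-algebra; the latter is Borel when the factors are Borel and second
   countable. *)
#[short(type="measTopType")]
HB.structure Definition MeasTop d := {T of Measurable d T & Topological T}.

HB.saturate prod.

Definition is_borel d (X : measTopType d) : Prop :=
  forall A : set X, measurable A <-> <<s [set U : set X | open U] >> A.

(* f is of class C^k on the open set U: its iterated directional derivatives up
   to order k exist and are continuous on U. *)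
Fixpoint C_on (R : realType) (n m : nat) (k : nat) (U : set 'rV[R]_n)
    (f : 'rV[R]_n -> 'rV[R]_m) : Prop :=
  (forall x, U x -> {for x, continuous f}) /\
  if k is k'.+1 then
    (forall x v, U x -> derivable f x v) /\ (forall v, C_on k' U ('D_v f))
  else True.

Definition smooth_on (R : realType) (n m : nat) (U : set 'rV[R]_n)
    (f : 'rV[R]_n -> 'rV[R]_m) : Prop := forall k, C_on k U f.

(* Manifolds have no boundary, but need not be connected. *)
Record smooth_compact_manifold (R : realType) (M : topologicalType) := {
  manifold_hausdorff : hausdorff_space M;
  manifold_second_countable : @second_countable M;
  manifold_compact : compact [set: M];
  manifold_dim : nat;
  chart_index : Type;
  chart_dom : chart_index -> set M;
  chart : chart_index -> M -> 'rV[R]_manifold_dim;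
  chart_inv : chart_index -> 'rV[R]_manifold_dim -> M;
  chart_dom_open : forall i, open (chart_dom i);
  chart_im_open : forall i, open (chart i @` chart_dom i);
  chart_cover : forall x, exists i, chart_dom i x;
  chartK : forall i x, chart_dom i x -> chart_inv i (chart i x) = x;
  chart_continuous :
    forall i x, chart_dom i x -> {for x, continuous (chart i)};
  chart_inv_continuous :
    forall i y, (chart i @` chart_dom i) y ->
      {for y, continuous (chart_inv i)};
  chart_transition_smooth :
    forall i j, smooth_on (chart i @` (chart_dom i `&` chart_dom j))
                          (chart j \o chart_inv i) }.

Section L2.
Context d (T : measurableType d) (R : realType).
Variable mu : {measure set T -> \bar R}.
Implicit Types f g : T -> R[i].

Definition cmod (z : R[i]) : R := Num.sqrt (complex.Re z ^+ 2 + complex.Im z ^+ 2).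

Definition ae_eqc f g : Prop := {ae mu, forall x, f x = g x}.

(* the square of the L2 norm *)
Definition l2sq f : \bar R := (\int[mu]_x (cmod (f x) ^+ 2)%:E)%E.

Definition L2 f : Prop :=
  [/\ measurable_fun [set: T] (fun x => complex.Re (f x)),
      measurable_fun [set: T] (fun x => complex.Im (f x)) &
      (l2sq f < +oo)%E].

Definition inner f g : R[i] :=
  Complex (\int[mu]_x complex.Re (f x * conjc (g x)))
          (\int[mu]_x complex.Im (f x * conjc (g x))).

(* An unbounded operator on L2(mu) is given by its graph on representatives:
   [A u w] means that u is in the domain and A u = w in L2(mu). *)
Implicit Type A : (T -> R[i]) -> (T -> R[i]) -> Prop.

Definition in_domain A f : Prop := exists w, A f w.

Definition linear_operator A : Prop :=
  [/\ (forall u w, A u w -> L2 u /\ L2 w),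
      (forall u w u' w', A u w -> L2 u' -> L2 w' ->
         ae_eqc u u' -> ae_eqc w w' -> A u' w'),
      A (fun=> 0) (fun=> 0),
      (forall (a : R[i]) u w u' w', A u w -> A u' w' ->
         A (fun x => a * u x + u' x) (fun x => a * w x + w' x)) &
      (forall u w w', A u w -> A u w' -> ae_eqc w w')].

Definition densely_defined A : Prop :=
  forall f, L2 f -> forall e : R, 0 < e ->
    exists u, in_domain A u /\ (l2sq (fun x => (f x - u x)%R) < e%:E)%E.

Definition adjoint A (v z : T -> R[i]) : Prop :=
  [/\ L2 v, L2 z & forall u w, A u w -> inner w v = inner u z].

Definition self_adjoint A : Prop :=
  [/\ linear_operator A, densely_defined A &
      forall u w, A u w <-> adjoint A u w].

Definition bounded_below A : Prop :=
  exists c : R, forall u w, A u w ->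
    c * fine (l2sq u) <= complex.Re (inner w u).

Definition resolvent_point A (z : R[i]) : Prop :=
  (forall f, L2 f ->
     exists u w, A u w /\ ae_eqc (fun x => w x - z * u x) f) /\
  (exists K : R, forall u w, A u w ->
     (l2sq u <= K%:E * l2sq (fun x => (w x - z * u x)%R))%E).

(* (A - z)^-1 maps bounded sequences to sequences with a convergent
   subsequence. *)
Definition compact_resolvent_at A (z : R[i]) : Prop :=
  forall u w : nat -> T -> R[i], (forall n, A (u n) (w n)) ->
    (exists K : R, forall n,
       (l2sq (fun x => (w n x - z * u n x)%R) <= K%:E)%E) ->
    exists (s : nat -> nat) (v : T -> R[i]),
      [/\ {homo s : m n / (m < n)%N}, L2 v &
          (fun n => l2sq (fun x => u (s n) x - v x)) @ \oo --> 0%E].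

Definition compact_resolvent A : Prop :=
  exists2 z, resolvent_point A z & compact_resolvent_at A z.

(* The zero function is allowed. Only real lam occur, A being self-adjoint. *)
Definition in_eigenspace A (lam : R) (phi : T -> R[i]) : Prop :=
  A phi (fun x => (lam%:C)%C * phi x).

Definition eigenvalue A (lam : R) : Prop :=
  exists2 phi, in_eigenspace A lam phi & ~ ae_eqc phi (fun=> 0).

(* m is the dimension of the eigenspace of lam in L2(mu) *)
Definition multiplicity A (lam : R) (m : nat) : Prop :=
  exists e : 'I_m -> T -> R[i],
    [/\ (forall k, in_eigenspace A lam (e k)),
        (forall c : 'I_m -> R[i],
           ae_eqc (fun x => \sum_(k < m) c k * e k x) (fun=> 0) ->
           forall k, c k = 0) &
        (forall phi, in_eigenspace A lam phi -> exists c : 'I_m -> R[i],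
           ae_eqc phi (fun x => \sum_(k < m) c k * e k x))].

Definition eigenvalue_enumeration A (lam : nat -> R) (m : nat -> nat) : Prop :=
  [/\ (forall i j, (i < j)%N -> lam i < lam j),
      lam @ \oo --> +oo,
      (forall l, eigenvalue A l <-> exists i, l = lam i) &
      (forall i, (0 < m i)%N /\ multiplicity A (lam i) (m i))].

Definition unique_continuation A : Prop :=
  forall lam phi, in_eigenspace A lam phi ->
    forall B : set T, measurable B -> (0 < mu B)%E ->
      {ae mu, forall x, B x -> phi x = 0} -> ae_eqc phi (fun=> 0).

Definition bounded_eigenfunctions A : Prop :=
  forall lam phi, in_eigenspace A lam phi ->
    exists K : R, {ae mu, forall x, cmod (phi x) <= K}.

End L2.

Section TensorSum.
Context d1 d2 (T1 : measurableType d1) (T2 : measurableType d2) (R : realType).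
Variables (mu1 : probability T1 R) (mu2 : probability T2 R).
Variable A1 : (T1 -> R[i]) -> (T1 -> R[i]) -> Prop.
Variable A2 : (T2 -> R[i]) -> (T2 -> R[i]) -> Prop.

(* A1 (x) id + id (x) A2 on the algebraic tensor product of the domains *)
Definition alg_tensor_sum (f g : T1 * T2 -> R[i]) : Prop :=
  exists n (u w : 'I_n -> T1 -> R[i]) (v z : 'I_n -> T2 -> R[i]),
    [/\ (forall k, A1 (u k) (w k)), (forall k, A2 (v k) (z k)),
        (forall p, f p = \sum_(k < n) u k p.1 * v k p.2) &
        (forall p, g p =
           \sum_(k < n) (w k p.1 * v k p.2 + u k p.1 * z k p.2))].

(* Its closure in L2 x L2: when A1 and A2 are self-adjoint, the operator above
   is essentially self-adjoint and this is its self-adjoint extension. *)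
Definition tensor_sum (f g : T1 * T2 -> R[i]) : Prop :=
  [/\ L2 (mu1 \x mu2)%E f, L2 (mu1 \x mu2)%E g &
      forall e : R, 0 < e -> exists f' g',
        [/\ alg_tensor_sum f' g',
            (l2sq (mu1 \x mu2) (fun p => (f p - f' p)%R) < e%:E)%E &
            (l2sq (mu1 \x mu2) (fun p => (g p - g' p)%R) < e%:E)%E]].

End TensorSum.

(* q is a closure point, as lam -> +oo, of the probability measures
   |phi_lam|^2 nu: every weak neighbourhood of q (given by finitely many
   continuous test functions f k and a radius e) contains such a measure with
   lam arbitrarily large. *)
Definition local_QL d (X : measTopType d) (R : realType)
    (nu : probability X R) (A : (X -> R[i]) -> (X -> R[i]) -> Prop)
    (q : probability X R) : Prop :=
  forall (n : nat) (f : 'I_n -> X -> R) (e Lam : R),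
    (forall k, continuous (f k)) -> 0 < e ->
    exists (lam : R) (phi : X -> R[i]),
      [/\ Lam <= lam, in_eigenspace A lam phi, l2sq nu phi = 1%E &
          forall k, `| \int[nu]_x (f k x * cmod (phi x) ^+ 2)
                       - \int[q]_x f k x | < e].

Definition full_support d (X : measTopType d) (R : realType)
    (q : probability X R) : Prop :=
  forall U : set X, open U -> U !=set0 -> (0 < q U)%E.

(* Main.v *)
(* Because of the multiplicity hypothesis, the eigenspaces of the tensor sum are the
   products of an eigenspace of D1 and one of D2: a partial inner product with an
   eigenfunction of D1, in the first variable, is an eigenfunction of D2, and the
   eigenfunctions of D1 are complete, so every eigenvalue is a sum, and the
   dimensions then agree. Hence all the slices of an eigenfunction are
   eigenfunctions of the factors.

   (i) On a factor, a nonzero continuous f >= 0 satisfies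
   \int f |phi|^2 >= c |phi|^2 for all eigenfunctions phi, with c > 0. Otherwise
   some normalized phi_n have \int f |phi_n|^2 -> 0; along a subsequence either
   the eigenvalues tend to infinity, and a weak limit is a local QL without full
   support, or the eigenvalue is constant, and phi_n converges in L2 by compactness
   to an eigenfunction vanishing where f > 0. Applied to slices, the two bounds
   multiply: \int f1 f2 |phi|^2 >= c1 c2 |phi|^2.

   (ii) By the same dichotomy, a closed null set of a factor has, for every e > 0,
   an open neighbourhood carrying at most the fraction e of the mass of every
   eigenfunction. Fubini and compactness carry this property over to the product,
   and inner regularity concludes. *)
Require Import Defs.
From HB Require Import structures.
From mathcomp Require Import all_boot all_order all_algebra.
From mathcomp Require Import complex ring lra.
From mathcomp Require Import all_classical all_reals all_analysis.
From mathcomp Require Import measurable_realfun.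

Set Implicit Arguments.
Unset Strict Implicit.
Unset Printing Implicit Defensive.
Import Order.TTheory GRing.Theory Num.Theory.
Import numFieldNormedType.Exports.
Local Open Scope classical_set_scope.
Local Open Scope ring_scope.

(** * Square-integrable functions *)

(** The obstacle is that a slice of an eigenfunction of the tensor sum, though an eigenfunction of a
    factor, escapes all control: it is not normalized, may vanish, and need not belong to a large
    eigenvalue, so no weak limit can be taken slice by slice. This is why the hypotheses on the
    factors are first converted into inequalities that are homogeneous in the eigenfunction and
    uniform over all eigenvalues ([eigen_lower_bound], [eigen_upper_bound]); such inequalities
    integrate over slices.

    Weak limits are not extracted as functionals: an ultrafilter limit of the measures is taken on
    closed sets, regularized into a Borel probability, and compared with continuous functions
    through their closed superlevel sets.

    The tensor sum being a closure, an eigenfunction satisfies its equation only through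
    approximations. The equation is therefore tested against products of an eigenfunction of the
    first factor and a domain vector of the second, which moves the operators onto the test function
    and survives L2 limits. *)

Lemma ReM (R : realType) (a b : R[i]) :
  complex.Re (a * b) = complex.Re a * complex.Re b - complex.Im a * complex.Im b.
Proof. by case: a => ? ?; case: b. Qed.

Lemma ImM (R : realType) (a b : R[i]) :
  complex.Im (a * b) = complex.Re a * complex.Im b + complex.Im a * complex.Re b.
Proof. by case: a => ? ?; case: b => ? ? /=; rewrite addrC. Qed.

Lemma ReD (R : realType) (a b : R[i]) :
  complex.Re (a + b) = complex.Re a + complex.Re b.
Proof. by case: a => ? ?; case: b. Qed.

Lemma ImD (R : realType) (a b : R[i]) :
  complex.Im (a + b) = complex.Im a + complex.Im b.
Proof. by case: a => ? ?; case: b. Qed.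

Lemma cmod_sqr (R : realType) (z : R[i]) :
  cmod z ^+ 2 = complex.Re z ^+ 2 + complex.Im z ^+ 2.
Proof. by rewrite /cmod sqr_sqrtr// addr_ge0// sqr_ge0. Qed.

Lemma cmod_sqrM (R : realType) (a b : R[i]) :
  cmod (a * b) ^+ 2 = cmod a ^+ 2 * cmod b ^+ 2.
Proof. by rewrite !cmod_sqr ReM ImM; ring. Qed.

Lemma cmod_sqrD (R : realType) (a b : R[i]) :
  cmod (a + b) ^+ 2 <= 2 * (cmod a ^+ 2 + cmod b ^+ 2).
Proof.
rewrite !cmod_sqr ReD ImD.
move: (complex.Re a) (complex.Re b) (complex.Im a) (complex.Im b) => x y z t.
have := sqr_ge0 (x - y); have := sqr_ge0 (z - t); lra.
Qed.

Lemma cmod_sqr_ge0 (R : realType) (z : R[i]) : 0 <= cmod z ^+ 2.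
Proof. exact: sqr_ge0. Qed.

Lemma cmod_sqr0 (R : realType) : cmod (0 : R[i]) ^+ 2 = 0.
Proof. by rewrite cmod_sqr /= expr0n addr0. Qed.

Lemma cmod_sqr_eq0 (R : realType) (z : R[i]) : cmod z ^+ 2 = 0 -> z = 0.
Proof.
rewrite cmod_sqr; case: z => x y /= /eqP.
by rewrite paddr_eq0 ?sqr_ge0// !sqrf_eq0 => /andP[/eqP -> /eqP ->].
Qed.

Section L2_space.
Context d (T : measurableType d) (R : realType).
Variable mu : {measure set T -> \bar R}.
Implicit Types f g h : T -> R[i].

Lemma integrable_EFinD (u v : T -> R) :
  mu.-integrable setT (EFin \o u) -> mu.-integrable setT (EFin \o v) ->
  mu.-integrable setT (EFin \o (fun x => u x + v x)).
Proof. by move=> iu iv; exact: (integrableD measurableT iu iv). Qed.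

Lemma integrable_EFinZ (k : R) (u : T -> R) :
  mu.-integrable setT (EFin \o u) ->
  mu.-integrable setT (EFin \o (fun x => k * u x)).
Proof. by move=> iu; exact: (integrableZl measurableT k iu). Qed.

Definition cmeas f := measurable_fun [set: T] (fun x => complex.Re (f x)) /\
  measurable_fun [set: T] (fun x => complex.Im (f x)).

Lemma cmeas_cmod_sqr f : cmeas f -> measurable_fun [set: T] (fun x => cmod (f x) ^+ 2).
Proof.
move=> [m1 m2]; under eq_fun do rewrite cmod_sqr.
by apply: measurable_funD; exact: measurable_funX.
Qed.

Lemma cmeasM f g : cmeas f -> cmeas g -> cmeas (fun x => f x * g x).
Proof.
move=> [f1 f2] [g1 g2]; split.
- by under eq_fun do rewrite ReM; apply: measurable_funB; exact: measurable_funM.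
- by under eq_fun do rewrite ImM; apply: measurable_funD; exact: measurable_funM.
Qed.

Lemma cmeasD f g : cmeas f -> cmeas g -> cmeas (fun x => f x + g x).
Proof.
move=> [f1 f2] [g1 g2]; split.
- by under eq_fun do rewrite ReD; exact: measurable_funD.
- by under eq_fun do rewrite ImD; exact: measurable_funD.
Qed.

Lemma cmeas_cst (a : R[i]) : cmeas (fun=> a).
Proof. by split; exact: measurable_cst. Qed.

Lemma L2_cmeas f : L2 mu f -> cmeas f.
Proof. by case. Qed.

Lemma L2P f : L2 mu f <-> cmeas f /\
  mu.-integrable setT (EFin \o (fun x => cmod (f x) ^+ 2)).
Proof.
split=> [[m1 m2 foo]|[[m1 m2] /integrableP[_ foo]]].
  split=> //; apply/integrableP; split.
    by apply/measurable_EFinP; exact: cmeas_cmod_sqr.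
  by under eq_integral do rewrite /= ger0_norm ?cmod_sqr_ge0//.
split=> //; apply: le_lt_trans foo.
by under [leRHS]eq_integral do rewrite /= ger0_norm ?cmod_sqr_ge0//.
Qed.

Lemma L2_dom f (h : T -> R) : cmeas f ->
  mu.-integrable setT (EFin \o h) -> (forall x, cmod (f x) ^+ 2 <= h x) ->
  L2 mu f.
Proof.
move=> mf ih fh; apply/L2P; split=> //.
apply: le_integrable ih => //; first exact/measurable_EFinP/cmeas_cmod_sqr.
by move=> x _ /=; rewrite lee_fin ger0_norm ?cmod_sqr_ge0// (le_trans (fh x))// ler_norm.
Qed.

Lemma L2_0 : L2 mu (fun=> 0).
Proof.
apply: (@L2_dom _ (cst 0)); [exact: cmeas_cst|exact: integrable0|].
by move=> x; rewrite cmod_sqr0.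
Qed.

Lemma L2_comb (a : R[i]) f g : L2 mu f -> L2 mu g ->
  L2 mu (fun x => a * f x + g x).
Proof.
move=> /L2P[mf if_] /L2P[mg ig].
apply: (@L2_dom _ (fun x => 2 * (cmod a ^+ 2 * cmod (f x) ^+ 2 + cmod (g x) ^+ 2))).
- by apply: cmeasD => //; apply: cmeasM => //; exact: cmeas_cst.
- by apply: integrable_EFinZ; apply: integrable_EFinD => //; exact: integrable_EFinZ.
- by move=> x; rewrite -cmod_sqrM cmod_sqrD.
Qed.

Lemma L2Z (a : R[i]) f : L2 mu f -> L2 mu (fun x => a * f x).
Proof.
by move=> /(L2_comb a)/(_ L2_0); under [X in L2 _ X -> _]eq_fun do rewrite addr0.
Qed.

Lemma L2D f g : L2 mu f -> L2 mu g -> L2 mu (fun x => f x + g x).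
Proof.
by move=> /(L2_comb 1) h /h; under [X in L2 _ X -> _]eq_fun do rewrite mul1r.
Qed.

Lemma L2B f g : L2 mu f -> L2 mu g -> L2 mu (fun x => f x - g x).
Proof.
move=> fL gL; have := L2_comb (-1) gL fL.
by under [X in L2 _ X -> _]eq_fun do rewrite mulN1r addrC.
Qed.

Lemma L2_sum (I : Type) (s : seq I) (F : I -> T -> R[i]) :
  (forall i, L2 mu (F i)) -> L2 mu (fun x => \sum_(i <- s) F i x).
Proof.
move=> mF; elim: s => [|i s IH].
  by under eq_fun do rewrite big_nil; exact: L2_0.
by under eq_fun do rewrite big_cons; exact: L2D.
Qed.

Definition rip_fun f g x :=
  complex.Re (f x) * complex.Re (g x) + complex.Im (f x) * complex.Im (g x).

(* The real part of [inner]; its imaginary part is [rip f (i g)] (see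
   [inner_rip]), so the Hilbert space arguments only use this real form. *)
Definition rip f g : R := \int[mu]_x rip_fun f g x.

Definition n2 f : R := rip f f.

Lemma rip_funxx f x : rip_fun f f x = cmod (f x) ^+ 2.
Proof. by rewrite cmod_sqr /rip_fun !expr2. Qed.

Lemma cmeas_rip_fun f g : cmeas f -> cmeas g -> measurable_fun setT (rip_fun f g).
Proof.
by move=> [f1 f2] [g1 g2]; apply: measurable_funD; exact: measurable_funM.
Qed.

Lemma norm_rip_fun f g x : `|rip_fun f g x| <= cmod (f x) ^+ 2 + cmod (g x) ^+ 2.
Proof.
rewrite /rip_fun !cmod_sqr.
move: (complex.Re (f x)) (complex.Re (g x)) (complex.Im (f x)) (complex.Im (g x)).
move=> a b c e; have := sqr_ge0 (a - b); have := sqr_ge0 (a + b).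
have := sqr_ge0 (c - e); have := sqr_ge0 (c + e); have := sqr_ge0 a.
have := sqr_ge0 b; have := sqr_ge0 c; have := sqr_ge0 e => *.
rewrite ler_norml; apply/andP; split; lra.
Qed.

Lemma integrable_rip f g : L2 mu f -> L2 mu g ->
  mu.-integrable setT (EFin \o rip_fun f g).
Proof.
move=> /L2P[mf if_] /L2P[mg ig].
apply: (le_integrable _ _ _ (integrableD measurableT if_ ig)) => //.
  by apply/measurable_EFinP; exact: cmeas_rip_fun.
move=> x _ /=; rewrite lee_fin.
by rewrite (le_trans (norm_rip_fun _ _ _))// ler_norm.
Qed.

Lemma ripC f g : rip f g = rip g f.
Proof.
by apply: eq_Rintegral => x _; rewrite /rip_fun [LHS]addrC addrC mulrC; congr (_ + _); rewrite mulrC.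
Qed.

(** [rip] is only real-linear: the imaginary part of a complex scalar acts through multiplication by
    ['i]. *)
Lemma rip_comb (a : R[i]) f g h : L2 mu f -> L2 mu g -> L2 mu h ->
  rip (fun x => a * f x + g x) h =
  complex.Re a * rip f h + complex.Im a * rip (fun x => 'i%C * f x) h + rip g h.
Proof.
move=> fL gL hL; have iL := L2Z 'i%C fL.
have i1 := integrable_rip fL hL; have i2 := integrable_rip iL hL.
have i3 := integrable_rip gL hL.
rewrite /rip -!RintegralZl// -!RintegralD//.
- apply: eq_Rintegral => x _; rewrite /rip_fun !(ReD, ImD, ReM, ImM)/=; ring.
- by apply: integrable_EFinD; exact: integrable_EFinZ.
- exact: integrable_EFinZ.
- exact: integrable_EFinZ.
Qed.

Lemma rip0l h : rip (fun=> 0) h = 0.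
Proof.
rewrite /rip (@eq_Rintegral _ _ _ _ _ (cst 0)) ?Rintegral_cst ?mul0r//.
by move=> x _; rewrite /rip_fun !mul0r addr0.
Qed.

Lemma rip0r h : rip h (fun=> 0) = 0.
Proof. by rewrite ripC rip0l. Qed.

Lemma rip_conj (a : R[i]) f g : rip (fun x => a * f x) g = rip f (fun x => conjc a * g x).
Proof.
apply: eq_Rintegral => x _; rewrite /rip_fun !(ReD, ImD, ReM, ImM).
case: a => a b /=; ring.
Qed.

Lemma rip_il f g : L2 mu f -> L2 mu g ->
  rip (fun x => 'i%C * f x) g = - rip f (fun x => 'i%C * g x).
Proof.
move=> fL gL; rewrite rip_conj ripC.
under [X in rip X _]eq_fun do rewrite -[conjc _ * _]addr0.
by rewrite rip_comb//= ?rip0l; [rewrite mul0r add0r addr0 mulN1r ripC|exact: L2_0].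
Qed.

Lemma l2sqE f : L2 mu f -> l2sq mu f = (n2 f)%:E.
Proof.
move=> /L2P[mf if_]; rewrite /l2sq /n2 /rip /Rintegral fineK.
  by apply: eq_integral => x _; rewrite rip_funxx.
apply: integrable_fin_num => //.
by under eq_fun do rewrite rip_funxx.
Qed.

Lemma n2_ge0 f : 0 <= n2 f.
Proof. by apply: Rintegral_ge0 => x _; rewrite rip_funxx cmod_sqr_ge0. Qed.

Lemma ae_eqc_refl f : ae_eqc mu f f.
Proof. exact: aeW. Qed.

Lemma rip_ae f f' g : L2 mu f -> L2 mu f' -> L2 mu g -> ae_eqc mu f f' ->
  rip f g = rip f' g.
Proof.
move=> fL f'L gL ff'; congr fine; apply: ae_eq_integral => //=.
- by apply/measurable_EFinP/cmeas_rip_fun; exact: L2_cmeas.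
- by apply/measurable_EFinP/cmeas_rip_fun; exact: L2_cmeas.
- by apply: filterS ff' => x ffx _; rewrite /rip_fun ffx.
Qed.

Lemma n2_ae f f' : L2 mu f -> L2 mu f' -> ae_eqc mu f f' -> n2 f = n2 f'.
Proof.
by move=> fL f'L ff'; rewrite /n2 (rip_ae _ f'L _ ff')// ripC (rip_ae _ f'L _ ff').
Qed.

Lemma n2_eq0 f : L2 mu f -> n2 f = 0 -> ae_eqc mu f (fun=> 0).
Proof.
move=> fL f0; have /L2P[mf _] := fL.
have : (\int[mu]_x `| (cmod (f x) ^+ 2)%:E | = 0)%E.
  by rewrite -[RHS]/(0%:E) -f0 -l2sqE//; apply: eq_integral => x _; rewrite abse_EFin ger0_norm ?cmod_sqr_ge0.
have mf2 : measurable_fun setT (fun x => (cmod (f x) ^+ 2)%:E).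
  exact/measurable_EFinP/cmeas_cmod_sqr.
move/(ae_eq_integral_abs mu measurableT mf2).
by apply: filterS => x /(_ I)[/cmod_sqr_eq0].
Qed.

Lemma n2_comb (a : R) f g : L2 mu f -> L2 mu g ->
  n2 (fun x => a%:C%C * f x + g x) = a ^+ 2 * n2 f + 2 * a * rip f g + n2 g.
Proof.
move=> fL gL; have fgL := L2_comb a%:C%C fL gL.
rewrite /n2 rip_comb//= mul0r addr0 (ripC f) (ripC g) !rip_comb//=.
by rewrite !mul0r (ripC g f); ring.
Qed.

Lemma cauchy_schwarz f g : L2 mu f -> L2 mu g -> rip f g ^+ 2 <= n2 f * n2 g.
Proof.
move=> fL gL.
have [f0|f0] := eqVneq (n2 f) 0.
  by rewrite (rip_ae fL L2_0 gL (n2_eq0 fL f0)) rip0l expr0n f0 mul0r.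
have {}f0 : 0 < n2 f by rewrite lt0r f0 n2_ge0.
(* This coefficient minimizes the squared norm of [a f + g] over real [a]. *)
have := n2_ge0 (fun x => (- (rip f g / n2 f))%:C%C * f x + g x).
rewrite n2_comb// => h.
rewrite -subr_ge0 (_ : _ - _ = n2 f * ((- (rip f g / n2 f)) ^+ 2 * n2 f +
    2 * - (rip f g / n2 f) * rip f g + n2 g)).
  by rewrite mulr_ge0// ltW.
by field; rewrite gt_eqF.
Qed.

Lemma inner_rip f g : inner mu f g = (rip f g +i* rip f (fun x => 'i%C * g x))%C.
Proof.
congr Complex; apply: eq_Rintegral => x _;
  rewrite /rip_fun; case: (f x) (g x) => a b [c e] /=; ring.
Qed.

Lemma ripBl f g h : L2 mu f -> L2 mu g -> L2 mu h ->
  rip (fun x => f x - g x) h = rip f h - rip g h.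
Proof.
move=> fL gL hL.
under [X in rip X _]eq_fun do rewrite addrC -mulN1r.
by rewrite rip_comb//= oppr0 mul0r addr0 mulN1r addrC.
Qed.

Lemma ripDl f g h : L2 mu f -> L2 mu g -> L2 mu h ->
  rip (fun x => f x + g x) h = rip f h + rip g h.
Proof.
move=> fL gL hL.
under [X in rip X _]eq_fun do rewrite -[f _]mul1r.
by rewrite rip_comb//= mul0r addr0 mul1r.
Qed.

Lemma ripZl (a : R[i]) f h : L2 mu f -> L2 mu h ->
  rip (fun x => a * f x) h =
  complex.Re a * rip f h + complex.Im a * rip (fun x => 'i%C * f x) h.
Proof.
move=> fL hL.
under [X in rip X _]eq_fun do rewrite -[_ * _]addr0.
by rewrite rip_comb//= ?rip0l ?addr0//; exact: L2_0.
Qed.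

Lemma n2Z (a : R[i]) f : L2 mu f -> n2 (fun x => a * f x) = cmod a ^+ 2 * n2 f.
Proof.
move=> /L2P[mf if_]; rewrite /n2 /rip -RintegralZl//.
  by apply: eq_Rintegral => x _; rewrite !rip_funxx cmod_sqrM.
by rewrite (_ : rip_fun f f = fun x => cmod (f x) ^+ 2)//; apply/funext => x; exact: rip_funxx.
Qed.

Lemma n2D_le f g : L2 mu f -> L2 mu g ->
  n2 (fun x => f x + g x) <= 2 * n2 f + 2 * n2 g.
Proof.
move=> fL gL.
have := n2_ge0 (fun x => (-1)%:C%C * f x + g x); rewrite n2_comb// => h.
suff -> : (fun x => f x + g x) = (fun x => 1%:C%C * f x + g x).
  by rewrite n2_comb//; lra.
by apply/funext => x; rewrite mul1r.
Qed.

Lemma n2BC f g : n2 (fun x => f x - g x) = n2 (fun x => g x - f x).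
Proof.
apply: eq_Rintegral => x _; rewrite !rip_funxx -opprB.
by rewrite !cmod_sqr; case: (g x - f x) => a b /=; rewrite !sqrrN.
Qed.
End L2_space.

Lemma cvg0_sqr_le (R : realType) (x y : nat -> R) (c : R) :
  (forall n, x n ^+ 2 <= y n * c) -> y @ \oo --> 0 -> x @ \oo --> 0.
Proof.
move=> xy y0; apply/cvgr0Pnorm_lt => e e0.
have yc : (fun n => y n * c) @ \oo --> 0.
  by rewrite -(mul0r c); apply: cvgM => //; exact: cvg_cst.
near=> n; rewrite -(ltr_pXn2r (n := 2))// ?nnegrE ?(ltW e0)// real_normK ?num_real//.
apply: (le_lt_trans (xy n)); apply: (le_lt_trans (ler_norm _)).
by near: n; apply: cvgr0_norm_lt => //; exact: exprn_gt0.
Unshelve. all: by end_near. Qed.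

Lemma cvg0_lin (R : realType) (x y : nat -> R) (a b : R) :
  x @ \oo --> 0 -> y @ \oo --> 0 -> (fun n => a * x n + b * y n) @ \oo --> 0.
Proof.
move=> x0 y0; have e0 : a * 0 + b * 0 = 0 by rewrite !mulr0 addr0.
rewrite -[X in _ --> X]e0; apply: cvgD.
  by apply: cvgM => //; exact: cvg_cst.
by apply: cvgM => //; exact: cvg_cst.
Qed.

Section L2_limits.
Context d (T : measurableType d) (R : realType).
Variable mu : {measure set T -> \bar R}.
Implicit Types f g : T -> R[i].

Definition L2_cvg (u : nat -> T -> R[i]) (v : T -> R[i]) :=
  (fun n => n2 mu (fun x => u n x - v x)) @ \oo --> 0.

Lemma L2_cvg_rip u v f : (forall n, L2 mu (u n)) -> L2 mu v -> L2 mu f ->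
  L2_cvg u v -> (fun n => rip mu (u n) f) @ \oo --> rip mu v f.
Proof.
move=> uL vL fL uv.
suff : (fun n => rip mu (u n) f - rip mu v f) @ \oo --> 0 by move/subr_cvg0.
apply: (@cvg0_sqr_le _ _ _ (n2 mu f)) uv => n.
by rewrite -ripBl//; apply: cauchy_schwarz => //; exact: L2B.
Qed.

Lemma L2_cvg_n2 u v : (forall n, L2 mu (u n)) -> L2 mu v ->
  L2_cvg u v -> (fun n => n2 mu (u n)) @ \oo --> n2 mu v.
Proof.
move=> uL vL uv.
have -> : (fun n => n2 mu (u n)) =
    (fun n => n2 mu (fun x => u n x - v x) + 2 * rip mu (u n) v - n2 mu v).
  apply/funext => n.
  have -> : (fun x => u n x - v x) = (fun x => (-1)%:C%C * v x + u n x).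
    by apply/funext => x; rewrite addrC rmorphN rmorph1 mulN1r.
  by rewrite n2_comb// (ripC _ v); ring.
have e : 0 + 2 * rip mu v v - n2 mu v = n2 mu v by rewrite /n2; ring.
rewrite -[X in _ --> X]e.
have h := cvgM (cvg_cst (2 : R) (F := \oo)) (L2_cvg_rip uL vL vL uv).
exact: (cvgB (cvgD uv (h _ _)) (cvg_cst (n2 mu v))).
Qed.

End L2_limits.

(** * Self-adjoint operators with compact resolvent *)

Section self_adjoint_operator.
Context d (T : measurableType d) (R : realType).
Variable mu : {measure set T -> \bar R}.
Variable A : (T -> R[i]) -> (T -> R[i]) -> Prop.
Hypothesis sa : self_adjoint mu A.
Implicit Types u v w z f e : T -> R[i].

Lemma dom_L2 u w : A u w -> L2 mu u.
Proof. by move: sa => [[h _ _ _ _] _ _] /h[]. Qed.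

Lemma im_L2 u w : A u w -> L2 mu w.
Proof. by move: sa => [[h _ _ _ _] _ _] /h[]. Qed.

Lemma op_ae u w u' w' : A u w -> L2 mu u' -> L2 mu w' ->
  ae_eqc mu u u' -> ae_eqc mu w w' -> A u' w'.
Proof. by move: sa => [[_ h _ _ _] _ _]; exact: h. Qed.

Lemma op0 : A (fun=> 0) (fun=> 0).
Proof. by move: sa => [[_ _ h _ _] _ _]. Qed.

Lemma op_comb (a : R[i]) u w u' w' : A u w -> A u' w' ->
  A (fun x => a * u x + u' x) (fun x => a * w x + w' x).
Proof. by move: sa => [[_ _ _ h _] _ _]; exact: h. Qed.

Lemma op_uniq u w w' : A u w -> A u w' -> ae_eqc mu w w'.
Proof. by move: sa => [[_ _ _ _ h] _ _]; exact: h. Qed.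

Lemma op_ext u w u' w' : A u w -> u =1 u' -> w =1 w' -> A u' w'.
Proof. by move=> h /funext <- /funext <-. Qed.

Lemma opZ (a : R[i]) u w : A u w -> A (fun x => a * u x) (fun x => a * w x).
Proof. by move=> /(op_comb a)/(_ op0) /op_ext; apply => x; rewrite addr0. Qed.

Lemma op_sym u w v z : A u w -> A v z -> rip mu w v = rip mu u z.
Proof.
move=> uw; case: sa => _ _ adj /adj[_ _ /(_ _ _ uw)].
by rewrite !inner_rip => -[].
Qed.

(** Testing the real part is enough: the imaginary part of the adjoint relation at [u] is its real
    part at ['i u], which is again in the domain. *)
Lemma op_closed v z : L2 mu v -> L2 mu z ->
  (forall u w, A u w -> rip mu w v = rip mu u z) -> A v z.
Proof.
move=> vL zL h; case: sa => _ _ adj; apply/adj; split=> // u w uw.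
rewrite !inner_rip (h _ _ uw); congr (_ +i* _)%C; apply: oppr_inj.
rewrite -!rip_il//; first exact/h/opZ.
  exact: dom_L2 uw.
exact: im_L2 uw.
Qed.

(** The graph is that of an adjoint, hence is cut out by scalar product identities, which pass to L2
    limits. *)
Lemma op_seq_closed (u w : nat -> T -> R[i]) v z : (forall n, A (u n) (w n)) ->
  L2 mu v -> L2 mu z -> L2_cvg mu u v -> L2_cvg mu w z -> A v z.
Proof.
move=> uw vL zL uv wz; apply: op_closed => // x y xy.
have uL n := dom_L2 (uw n); have wL n := im_L2 (uw n).
have h1 := L2_cvg_rip uL vL (im_L2 xy) uv.
have h2 := L2_cvg_rip wL zL (dom_L2 xy) wz.
rewrite ripC (ripC _ x) -(cvg_lim _ h1)// -(cvg_lim _ h2)//.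
by congr (lim (_ @ \oo)); apply/funext => n; rewrite ripC (op_sym xy (uw n)) ripC.
Qed.

Lemma eigen_comb (a : R[i]) lam e e' : in_eigenspace A lam e ->
  in_eigenspace A lam e' -> in_eigenspace A lam (fun x => a * e x + e' x).
Proof.
by move=> he he'; apply: (op_ext (op_comb a he he')) => x //; rewrite mulrDr mulrCA.
Qed.

Lemma eigenZ (a : R[i]) lam e : in_eigenspace A lam e ->
  in_eigenspace A lam (fun x => a * e x).
Proof. by move=> he; apply: (op_ext (opZ a he)) => x //; rewrite mulrCA. Qed.

Lemma eigen_L2 lam e : in_eigenspace A lam e -> L2 mu e.
Proof. exact: dom_L2. Qed.

Lemma eigen0 lam : in_eigenspace A lam (fun=> 0).
Proof. by apply: (op_ext op0) => x //; rewrite mulr0. Qed.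

Lemma eigen_sum lam (I : Type) (s : seq I) (c : I -> R[i]) (e : I -> T -> R[i]) :
  (forall i, in_eigenspace A lam (e i)) ->
  in_eigenspace A lam (fun x => \sum_(i <- s) c i * e i x).
Proof.
move=> he; elim: s => [|i s IH].
  by under eq_fun do rewrite big_nil; exact: eigen0.
by under eq_fun do rewrite big_cons; exact: eigen_comb.
Qed.

(** Orthogonality for the real form gives the complex one, since an eigenspace contains ['i e] along
    with [e]. *)
Definition eigen_orth f := L2 mu f /\
  forall lam e, in_eigenspace A lam e -> rip mu f e = 0.

Lemma eigen_orth_comb (a : R[i]) f g : eigen_orth f -> eigen_orth g ->
  eigen_orth (fun x => a * f x + g x).
Proof.
move=> [fL fo] [gL go]; split=> [|lam e he]; first exact: L2_comb.
have eL := eigen_L2 he.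
rewrite rip_comb// (fo _ _ he) (go _ _ he) rip_conj.
by rewrite (fo _ _ (eigenZ _ he)) !mulr0 !addr0.
Qed.

Lemma eigen_orth_cvg (u : nat -> T -> R[i]) v : (forall n, eigen_orth (u n)) ->
  L2 mu v -> L2_cvg mu u v -> eigen_orth v.
Proof.
move=> uo vL uv; split=> // lam e he.
have uL n : L2 mu (u n) by case: (uo n).
have := L2_cvg_rip uL vL (eigen_L2 he) uv.
rewrite (_ : (fun n => _) = cst 0) => [/(cvg_lim (@norm_hausdorff _ _))|].
  by rewrite lim_cst.
by apply/funext => n; case: (uo n) => _ /(_ _ _ he).
Qed.

Lemma eigen_orth_eigen lam f : eigen_orth f -> in_eigenspace A lam f -> n2 mu f = 0.
Proof. by move=> [_ h] /h. Qed.

End self_adjoint_operator.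

Section compact_resolvent_operator.
Context d (T : measurableType d) (R : realType).
Variable mu : {measure set T -> \bar R}.
Variable A : (T -> R[i]) -> (T -> R[i]) -> Prop.
Hypothesis sa : self_adjoint mu A.
Implicit Types u v w z f e : T -> R[i].

Lemma L2_cvg_l2sq (u : nat -> T -> R[i]) v : (forall n, L2 mu (u n)) -> L2 mu v ->
  (fun n => l2sq mu (fun x => u n x - v x)) @ \oo --> 0%E -> L2_cvg mu u v.
Proof.
move=> uL vL.
have -> : (fun n => l2sq mu (fun x => u n x - v x)) =
    (fun n => (n2 mu (fun x => u n x - v x))%:E).
  by apply/funext => n; rewrite l2sqE//; exact: L2B.
by move/fine_cvg.
Qed.

Lemma rip_ix f : rip mu (fun x => 'i%C * f x) f = 0.
Proof.
rewrite /rip (@eq_Rintegral _ _ _ _ _ (cst 0)) ?Rintegral_cst ?mul0r//.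
by move=> x _; rewrite /rip_fun; case: (f x) => a b /=; ring.
Qed.

(* The Cayley transform (A - z) u |-> (A - conj z) u is isometric. *)
Lemma cayley_isometry (z : R[i]) f u : L2 mu f ->
  A u (fun x => f x + z * u x) ->
  n2 mu (fun x => (z - conjc z) * u x + f x) = n2 mu f.
Proof.
move=> fL uw; have uL := dom_L2 sa uw; have wL := im_L2 sa uw.
have iuL := L2Z 'i%C uL.
(* By symmetry the inner product of [A u] with [u] is real, that is, [A u] is orthogonal to ['i u]
   for the real form. *)
have h : rip mu (fun x => f x + z * u x) (fun x => 'i%C * u x) = 0.
  have := op_sym sa uw (opZ sa 'i%C uw).
  rewrite ripC rip_il//.
  by rewrite ripC => h; lra.
have : rip mu (fun x => z * u x + f x) (fun x => 'i%C * u x) = 0.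
  by apply: etrans h; congr (rip _ _ _); apply/funext => x; rewrite addrC.
rewrite rip_comb// (ripC _ u) rip_ix mulr0 add0r -[rip _ _ (fun x => 'i%C * _)]/(n2 _ _).
rewrite n2Z// (ripC _ f).
case: z uw wL {h} => a b uw _ /= h.
have -> : (fun x => ((a +i* b)%C - (a +i* - b)%C) * u x + f x) =
    (fun x => (2 * b)%:C%C * ('i%C * u x) + f x).
  apply/funext => x; congr (_ + _); rewrite mulrA; congr (_ * _).
  by apply/eqP; rewrite eq_complex /=; apply/andP; split; apply/eqP; ring.
rewrite n2_comb// n2Z//; move: h; rewrite cmod_sqr /=.
move: (rip _ _ _) (n2 mu u) => p q h.
have {}h : p = - (b * q) by lra.
by rewrite h; ring.
Qed.

Variable z : R[i].
Hypothesis resz : resolvent_point mu A z.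
Hypothesis cptz : compact_resolvent_at mu A z.

Lemma resolvent_bound : exists K : R, forall f u, L2 mu f ->
  A u (fun x => f x + z * u x) -> n2 mu u <= K * n2 mu f.
Proof.
case: resz => _ [K h]; exists K => f u fL uw.
have := h _ _ uw.
rewrite (_ : (fun x => _) = f); last by apply/funext => x; rewrite addrK.
by rewrite !l2sqE//; exact: (dom_L2 sa uw).
Qed.

Lemma resolvent_ex f : L2 mu f -> exists u, A u (fun x => f x + z * u x).
Proof.
move=> fL; case: resz => [/(_ f fL)[u [w [uw wf]]] _]; exists u.
have uL := dom_L2 sa uw; have wL := im_L2 sa uw.
apply: (op_ae sa uw uL (L2D fL (L2Z z uL))).
  exact: ae_eqc_refl.
by apply: filterS wf => x <-; rewrite subrK.
Qed.

Lemma resolvent_compact (f u : nat -> T -> R[i]) (K : R) :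
  (forall n, L2 mu (f n)) -> (forall n, n2 mu (f n) <= K) ->
  (forall n, A (u n) (fun x => f n x + z * u n x)) ->
  exists (s : nat -> nat) v, [/\ {homo s : m n / (m < n)%N}, L2 mu v &
    L2_cvg mu (u \o s) v].
Proof.
move=> fL fK uf.
have [|s [v [sh vL sv]]] := cptz uf.
  exists K => n; rewrite (_ : (fun x => _) = f n).
    by rewrite l2sqE// lee_fin.
  by apply/funext => x; rewrite addrK.
exists s, v; split=> //; apply: L2_cvg_l2sq => // n.
exact: (dom_L2 sa (uf _)).
Qed.

(** Symmetry against an eigenvector [e'] orthogonal to [f] gives [rip (c u) e' = 0] with
    [c = z - lam]. Dividing [e] by the conjugate of [c] beforehand makes this the orthogonality of
    [u] to [e]. *)
Lemma eigen_orth_resolvent f u : eigen_orth mu A f ->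
  A u (fun x => f x + z * u x) -> eigen_orth mu A u.
Proof.
move=> [fL fo] uw; have uL := dom_L2 sa uw; split=> // lam e he.
have eL := eigen_L2 sa he.
have zuL := L2Z z uL.
(* If [z = lam], the resolvent bound applied to the right-hand side [0] forces [e = 0]. *)
have [zl|zl] := eqVneq (z - lam%:C%C) 0.
  have [K hK] := resolvent_bound.
  have := hK (fun=> 0) e (L2_0 mu).
  rewrite [n2 _ (fun=> 0)]rip0l mulr0 => h.
  have e0 : n2 mu e = 0.
    apply/eqP; rewrite eq_le n2_ge0 andbT; apply: h.
    by apply: (op_ext he) => // x; rewrite add0r; congr (_ * _); apply/esym/subr0_eq.
  by rewrite ripC (rip_ae eL (L2_0 mu) uL (n2_eq0 eL e0)) rip0l.
set c := z - lam%:C%C in zl.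
pose e' := fun x => (conjc c)^-1 * e x.
have e'E : in_eigenspace A lam e' by exact: (eigenZ sa (conjc c)^-1 he).
have e'L := eigen_L2 sa e'E.
have -> : e = fun x => conjc c * e' x.
  by apply/funext => x; rewrite /e' mulrA divff ?mul1r// fmorph_eq0.
rewrite -rip_conj.
have := op_sym sa uw e'E.
have lc : lam%:C%C = conjc lam%:C%C by rewrite /= oppr0.
rewrite [in RHS]lc -rip_conj ripDl// (fo _ _ e'E) add0r => h.
rewrite (_ : (fun x => c * u x) = fun x => z * u x - lam%:C%C * u x).
  by rewrite (ripBl zuL (L2Z _ uL) e'L) h subrr.
by apply/funext => x; rewrite /c mulrBl.
Qed.

(* Let s be the supremum of |u|^2 over f in eigen_orth with |f| <= 1 and
   (A - z) u = f. Along a maximizing sequence u_n -> v by compactness; with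
   p = (A - z)^-1 v, the identity <p, (A - conj z) u_n> = <v, u_n> and the isometry
   above give |p - s (A - conj z) u_n| -> 0, so that (A - conj z) v = p / s without
   appealing to the adjoint of the resolvent or to the completeness of L2. Hence
   (A - Re z)^2 p = c p with c >= 0, and (A - Re z) p +- sqrt c p are eigenvectors
   orthogonal to all eigenvectors. *)
Lemma eigen_complete f : eigen_orth mu A f -> ae_eqc mu f (fun=> 0).
Proof.
move=> fV; apply: contrapT => f0.
have [K hK] := resolvent_bound.
pose S := [set r | exists g u, [/\ eigen_orth mu A g, n2 mu g <= 1,
  A u (fun x => g x + z * u x) & r = n2 mu u]].
have opL g u : A u (fun x => g x + z * u x) -> L2 mu u by exact: dom_L2.
have opL' g u : A u g -> L2 mu u by exact: dom_L2.
have K0 : 0 <= Num.max K 0 by rewrite le_max lexx orbT.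
have V0 : eigen_orth mu A (fun=> 0).
  by split=> [|? ? _]; [exact: L2_0|exact: rip0l].
have supS : has_sup S.
  split.
    exists (n2 mu (fun=> 0)), (fun=> 0), (fun=> 0); split=> //.
    - by rewrite [n2 _ _]rip0l.
    - by apply: (op_ext (op0 sa)) => // x; rewrite mulr0 addr0.
  exists (Num.max K 0) => _ [g [u [[gL _] g1 gu ->]]].
  apply: (le_trans (hK _ _ gL gu)).
  have g0 := n2_ge0 mu g.
  apply: (@le_trans _ _ (Num.max K 0 * n2 mu g)).
    by rewrite ler_wpM2r// le_max lexx.
  by rewrite ler_piMr.
set s := sup S.
have sP g u : eigen_orth mu A g -> A u (fun x => g x + z * u x) ->
    n2 mu u <= s * n2 mu g.
  move=> gV gu; have gL := proj1 gV; have uL := opL _ _ gu.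
  have [g0|g0] := eqVneq (n2 mu g) 0.
    by rewrite (le_trans (hK _ _ gL gu))// g0 !mulr0.
  have {}g0 : 0 < n2 mu g by rewrite lt0r g0 n2_ge0.
  set r := (Num.sqrt (n2 mu g))^-1.
  have rr : cmod r%:C%C ^+ 2 = (n2 mu g)^-1.
    by rewrite cmod_sqr /= expr0n addr0 exprVn sqr_sqrtr// ltW.
  suff : (n2 mu g)^-1 * n2 mu u <= s by rewrite mulrC ler_pdivrMr.
  rewrite -rr -n2Z//; apply: sup_upper_bound => //.
  exists (fun x => r%:C%C * g x), (fun x => r%:C%C * u x); split=> //.
  - have := eigen_orth_comb sa r%:C%C gV V0; congr eigen_orth.
    by apply/funext => x; rewrite addr0.
  - by rewrite n2Z// rr mulVf// gt_eqF.
  - by apply: (op_ext (opZ sa r%:C%C gu)) => // x; rewrite mulrDr mulrCA.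
(* Were [s] not positive, the resolvent would send [f] to [0], and [f] would be the image of [0]
   under [A - z]. *)
have s0 : 0 < s.
  have [u fu] := resolvent_ex (proj1 fV); have uL := opL _ _ fu.
  rewrite ltNge; apply/negP => sle0; apply: f0.
  have u0 : n2 mu u = 0.
    apply/eqP; rewrite eq_le n2_ge0 andbT (le_trans (sP _ _ fV fu))//.
    by rewrite mulr_le0_ge0// n2_ge0.
  have {}u0 := n2_eq0 uL u0.
  have := op_uniq sa (op_ae sa fu (L2_0 mu) (im_L2 sa fu) u0 (ae_eqc_refl mu _)) (op0 sa).
  by apply: filterS2 u0 => x ->; rewrite mulr0 addr0.
have /choice[gu guP] : forall n, exists gu : (T -> R[i]) * (T -> R[i]),
    [/\ eigen_orth mu A gu.1, n2 mu gu.1 <= 1,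
      A gu.2 (fun x => gu.1 x + z * gu.2 x) & s - n.+1%:R^-1 < n2 mu gu.2].
  move=> n.
  have n0 : 0 < n.+1%:R^-1 :> R by rewrite invr_gt0.
  by have [_ [g [u [? ? ? ->]]] ?] := sup_adherent n0 supS; exists (g, u).
have [|||sg [v [sgh vL uv]]] := @resolvent_compact (fun n => (gu n).1) (fun n => (gu n).2) 1.
- by move=> n; case: (guP n) => -[].
- by move=> n; case: (guP n).
- by move=> n; case: (guP n).
pose g n := (gu (sg n)).1; pose u n := (gu (sg n)).2.
have {}uv : L2_cvg mu u v by [].
have gV n : eigen_orth mu A (g n) by case: (guP (sg n)).
have gL n := proj1 (gV n).
have g1 n : n2 mu (g n) <= 1 by case: (guP (sg n)).
have gun n : A (u n) (fun x => g n x + z * u n x) by case: (guP (sg n)).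
have uL n := opL _ _ (gun n).
have uV n := eigen_orth_resolvent (gV n) (gun n).
have vV := eigen_orth_cvg sa uV vL uv.
have nv : n2 mu v = s.
  have h := L2_cvg_n2 uL vL uv.
  apply: (cvg_unique (@norm_hausdorff _ _) h).
  have hs : (fun n : nat => s - n.+1%:R^-1) @ \oo --> s.
    rewrite -[X in _ --> X]subr0; apply: cvgB; first exact: cvg_cst.
    exact: cvg_harmonic.
  apply: (squeeze_cvgr _ hs (cvg_cst s)); apply: nearW => n; apply/andP; split.
    have [_ _ _ /ltW] := guP (sg n); apply: le_trans; rewrite lerB// lef_pV2 ?posrE//.
    by rewrite ler_nat ltnS; elim: n => // n /leq_ltn_trans; apply; exact: sgh.
  apply: (le_trans (sP _ _ (gV n) (gun n))).
  by rewrite ler_piMr// ltW.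
have [p pv] := resolvent_ex vL; have pL := opL _ _ pv.
have pV := eigen_orth_resolvent vV pv.
have np : n2 mu p <= s * s by rewrite -{2}nv; exact: sP.
pose h n := fun x => (z - conjc z) * u n x + g n x.
have hL n : L2 mu (h n) by exact: L2_comb.
have nh n : n2 mu (h n) <= 1 by rewrite cayley_isometry.
have hu n : A (u n) (fun x => h n x + conjc z * u n x).
  by apply: (op_ext (gun n)) => // x; rewrite /h; ring.
have hp n : rip mu p (h n) = rip mu v (u n).
  have := op_sym sa pv (hu n).
  rewrite ripDl//; last exact: L2Z.
  rewrite (ripC _ p) (ripDl (hL n) (L2Z _ (uL n)) pL).
  by rewrite rip_conj (ripC _ (h n)) (ripC _ _ p) => hh; lra.
(* In the expanded square, the norm of [h n] contributes at most [1], that of [p] at most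
   [s^-2 s^2 = 1], and the cross term is [-2 s^-1 rip (u n) v] by [hp]. As [rip (u n) v] tends to
   [n2 v = s], the bound tends to [0]. *)
have hpcvg : L2_cvg mu h (fun x => s^-1%:C%C * p x).
  apply: (@squeeze_cvgr _ _ _ _ (cst 0)
    (fun n => 2 * (1 - s^-1 * rip mu (u n) v))); last 2 first.
  - exact: cvg_cst.
  - have -> : 0 = 2 * (1 - s^-1 * n2 mu v) by rewrite nv mulVf ?gt_eqF// subrr mulr0.
    have e1 := L2_cvg_rip uL vL vL uv.
    have e2 := cvgM (cvg_cst s^-1 (F := \oo)) e1.
    have e3 := cvgB (cvg_cst (1 : R) (F := \oo)) (e2 _ _).
    have e4 := cvgM (cvg_cst (2 : R) (F := \oo)) (e3 _ _ _ _).
    exact: e4.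
  apply: nearW => n /=; rewrite n2_ge0/=.
  rewrite (_ : (fun x => _) = fun x => (- s^-1)%:C%C * p x + h n x); last first.
    by apply/funext => x; rewrite rmorphN mulNr addrC.
  rewrite n2_comb// hp sqrrN (ripC _ v).
  have : s^-1 ^+ 2 * n2 mu p <= 1.
    apply: (@le_trans _ _ (s^-1 ^+ 2 * (s * s))).
      by rewrite ler_wpM2l// sqr_ge0.
    by rewrite expr2 mulrACA mulVf ?gt_eqF// mulr1.
  by have := nh n; lra.
have vp : A v (fun x => s^-1%:C%C * p x + conjc z * v x).
  have spL : L2 mu (fun x => s^-1%:C%C * p x) by exact: L2Z.
  have zvL : L2 mu (fun x => conjc z * v x) by exact: L2Z.
  apply: (op_seq_closed sa hu vL (L2D spL zvL) uv).
  apply: (@squeeze_cvgr _ _ _ _ (cst 0)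
    (fun n => 2 * n2 mu (fun x => h n x - s^-1%:C%C * p x) +
              2 * cmod (conjc z) ^+ 2 * n2 mu (fun x => u n x - v x))).
  - apply: nearW => n /=; rewrite n2_ge0/= -mulrA -n2Z; last exact: L2B.
    rewrite (_ : (fun x => _ + _ - _) = fun x => (h n x - s^-1%:C%C * p x) + conjc z * (u n x - v x)).
      exact: (n2D_le (L2B (hL n) spL) (L2Z _ (L2B (uL n) vL))).
    by apply/funext => x; ring.
  - exact: cvg_cst.
  - exact: (cvg0_lin 2 (2 * cmod (conjc z) ^+ 2) hpcvg uv).
(* From [(A - z) p = v] and [(A - conj z) v = p / s], the product [(A - a)^2 + b^2] of the two
   factors sends [p] to [p / s]; this is the origin of [c]. The function [P] below is
   [(A - a) p]. *)
set a := complex.Re z; set b := complex.Im z; set c := s^-1 - b ^+ 2.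
have zE : z = a%:C%C + 'i%C * b%:C%C by rewrite /a /b -complexE; case: (z).
have zcE : conjc z = a%:C%C - 'i%C * b%:C%C.
  by rewrite zE rmorphD rmorphM /= !oppr0; apply/eqP; rewrite eq_complex /=; apply/andP; split;
    apply/eqP; ring.
have ii : 'i%C * 'i%C = -1 :> R[i] by rewrite -expr2 sqr_i.
pose P := fun x => 'i%C * b%:C%C * p x + v x.
have Ap : A p (fun x => P x + a%:C%C * p x).
  by apply: (op_ext pv) => // x; rewrite /P zE; ring.
have AP : A P (fun x => c%:C%C * p x + a%:C%C * P x).
  apply: (op_ext (op_comb sa ('i%C * b%:C%C) pv vp)) => // x.
  rewrite zcE zE /P /c rmorphB rmorphXn /=.
  by have -> : b%:C%C ^+ 2 = - ('i%C * 'i%C * b%:C%C ^+ 2) :> R[i]; [rewrite ii; ring|ring].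
have PL := opL' _ _ AP.
have np0 : n2 mu p <> 0.
  move=> p0; have {}p0 := n2_eq0 pL p0.
  have v0 : ae_eqc mu v (fun=> 0).
    have := op_uniq sa (op_ae sa pv (L2_0 mu) (im_L2 sa pv) p0 (ae_eqc_refl mu _)) (op0 sa).
    by apply: filterS2 p0 => x ->; rewrite mulr0 addr0.
  by move: s0; rewrite -nv (n2_ae vL (L2_0 mu) v0) [n2 _ _]rip0l ltxx.
have p0 : 0 < n2 mu p by rewrite lt0r n2_ge0 andbT; exact/eqP.
have cP : c * n2 mu p = n2 mu P.
  have := op_sym sa AP Ap.
  have apL : L2 mu (fun x => a%:C%C * p x) by exact: L2Z.
  have aPL : L2 mu (fun x => a%:C%C * P x) by exact: L2Z.
  rewrite (rip_comb c%:C%C pL aPL pL) (ripZl a%:C%C PL pL) /=.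
  rewrite [in RHS]ripC (ripDl PL apL PL) (ripZl a%:C%C pL PL) /= (ripC _ p P).
  by rewrite !mul0r !addr0 => /addIr.
have c0 : 0 <= c by rewrite -(pmulr_lge0 _ p0) cP n2_ge0.
have PV : eigen_orth mu A P by exact: eigen_orth_comb.
have eigP (r : R) : r ^+ 2 = c ->
    ae_eqc mu (fun x => r%:C%C * p x + P x) (fun=> 0).
  move=> rc; apply: n2_eq0; first exact: L2_comb.
  apply: (@eigen_orth_eigen _ _ _ mu A (a + r)); first exact: eigen_orth_comb.
  apply: (op_ext (op_comb sa r%:C%C Ap AP)) => // x.
  by rewrite -rc rmorphD rmorphXn /=; ring.
have e1 := eigP _ (sqr_sqrtr c0).
have e2 : ae_eqc mu (fun x => (- Num.sqrt c)%:C%C * p x + P x) (fun=> 0).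
  by apply: eigP; rewrite sqrrN sqr_sqrtr.
have P0 : ae_eqc mu P (fun=> 0).
  apply: filterS2 e1 e2 => x; rewrite rmorphN mulNr => h1 h2.
  have : P x + P x = 0 by rewrite -[RHS](addr0 0) -{1}h1 -h2; ring.
  by move/eqP; rewrite -mulr2n mulrn_eq0 => /eqP.
(* The two candidate eigenvectors vanish, and their sum gives [P = 0], so [p] itself is an
   eigenvector for [a]. Using the sum rather than the difference covers the case [c = 0]. *)
apply: np0; apply: (@eigen_orth_eigen _ _ _ mu A a) => //.
apply: (op_ae sa Ap) => //; first exact: L2Z.
  exact: ae_eqc_refl.
by apply: filterS P0 => x ->; rewrite add0r.
Qed.

End compact_resolvent_operator.

(** * Weak limits of probability measures *)

(* What remains, on closed sets, of the finitely additive probability obtained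
   as an ultrafilter limit of probability measures. *)
Definition closed_content (T : topologicalType) (R : realType) (nu : set T -> R) :=
  [/\ forall K, closed K -> 0 <= nu K,
      forall K L, closed K -> closed L -> K `<=` L -> nu K <= nu L,
      forall K L, closed K -> closed L -> nu (K `|` L) <= nu K + nu L &
      forall K L, closed K -> closed L -> K `&` L = set0 ->
        nu K + nu L <= nu (K `|` L)].

(** Normality puts the part of [K] outside [U] in the interior of some [W] with closure in [V];
    cutting [K] along [W] gives the pieces. This transfers subadditivity from closed sets to open
    covers. *)
Lemma closed_split (T : topologicalType) (K U V : set T) : normal_space T ->
  closed K -> open U -> open V -> K `<=` U `|` V ->
  exists K1 K2, [/\ closed K1, closed K2, K1 `<=` U, K2 `<=` V & K = K1 `|` K2].
Proof.
move=> nT cK oU oV KUV.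
have cKU : closed (K `&` ~` U) by apply: closedI => //; exact: open_closedC.
have [|W KW cWV] := nT _ cKU V.
  by move=> x [/KUV[//|Vx] _]; exact: open_nbhs_nbhs.
have oW' : open W° by exact: open_interior.
exists (K `&` ~` W°), (K `&` closure W); split.
- by apply: closedI => //; exact: open_closedC.
- by apply: closedI => //; exact: closed_closure.
- by move=> x [Kx nW'x]; apply: contrapT => nUx; apply: nW'x; exact: KW.
- by move=> x [_ /cWV].
- apply/seteqP; split=> x; last by move=> [] [].
  move=> Kx; have [W'x|] := pselect (W° x); last by left.
  by right; split=> //; apply: subset_closure; exact: interior_subset.
Qed.

(** * From a content on closed sets to a Borel probability *)

Section content_outer_measure.
Context (T : ptopologicalType) (R : realType).
Hypothesis hT : hausdorff_space T.
Hypothesis cT : compact [set: T].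
Variable nu : set T -> R.
Hypothesis cnu : closed_content nu.
Hypothesis nuT : nu setT = 1.
Local Open Scope ereal_scope.

Let nT : normal_space T. Proof. exact: compact_normal. Qed.

(** The classical construction of a Radon measure from a content: open sets are measured from
    inside, and arbitrary sets by [outer_content] from outside through open sets. *)
Definition inner_content (U : set T) : \bar R :=
  ereal_sup [set (nu K)%:E | K in [set K | closed K /\ K `<=` U]].

Definition outer_content (A : set T) : \bar R :=
  ereal_inf [set inner_content U | U in [set U | open U /\ A `<=` U]].

Let nu0 : (nu set0 = 0)%R.
Proof.
have [n0 _ _ nd] := cnu; have c0 := @closed0 T.
have := nd _ _ c0 c0 (set0I _); rewrite setU0.
by have := n0 _ c0; lra.
Qed.

Lemma inner_content_ge K U : closed K -> K `<=` U -> (nu K)%:E <= inner_content U.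
Proof. by move=> cK KU; apply: ereal_sup_ubound; exists K. Qed.

Lemma inner_content_le U x : (forall K, closed K -> K `<=` U -> (nu K)%:E <= x) ->
  inner_content U <= x.
Proof. by move=> h; apply: ub_ereal_sup => _ [K [cK KU] <-]; exact: h. Qed.

Lemma inner_content_ge0 U : 0 <= inner_content U.
Proof. by rewrite -[0]/(0%R%:E) -nu0; apply: inner_content_ge => //; exact: closed0. Qed.

Lemma inner_content_le1 U : inner_content U <= 1.
Proof.
apply: inner_content_le => K cK _; rewrite lee_fin -nuT.
by have [_ h _ _] := cnu; apply: h => //; exact: closedT.
Qed.

Lemma inner_content_fin U : inner_content U \is a fin_num.
Proof.
rewrite ge0_fin_numE ?inner_content_ge0//.
by rewrite (le_lt_trans (inner_content_le1 _))// ltey.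
Qed.

Lemma le_inner_content : {homo inner_content : A B / A `<=` B >-> A <= B}.
Proof.
move=> A B AB; apply: inner_content_le => K cK KA.
by apply: inner_content_ge => //; exact: subset_trans AB.
Qed.

Lemma inner_content_adherent U (e : R) : (0 < e)%R ->
  exists K, [/\ closed K, K `<=` U & inner_content U <= (nu K)%:E + e%:E].
Proof.
move=> e0.
have [_ [K [cK KU] <-] h] := @ub_ereal_sup_adherent _ _ e e0 (inner_content_fin U).
by exists K; split=> //; rewrite -leeBlDr// ltW.
Qed.

Lemma inner_content_bigcup_lt (U : nat -> set T) n K : (forall i, open (U i)) ->
  closed K -> K `<=` \bigcup_(i in `I_n) U i ->
  (nu K)%:E <= \sum_(i < n) inner_content (U i).
Proof.
move=> oU; elim: n K => [|n IH] K cK KU.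
  rewrite big_ord0 (_ : K = set0) ?nu0//.
  by rewrite -subset0 => x /KU[].
have [||K1 [K2 [cK1 cK2 K1U K2U ->]]] :=
    @closed_split _ K (\bigcup_(i in `I_n) U i) (U n) nT cK _ (oU n).
- exact: bigcup_open.
- move=> x /KU[i /=]; rewrite ltnS leq_eqVlt => /predU1P[->|]; first by right.
  by left; exists i.
have [_ _ h _] := cnu.
rewrite big_ord_recr/= (@le_trans _ _ ((nu K1)%:E + (nu K2)%:E))//.
  by rewrite -EFinD lee_fin h.
by rewrite leeD ?IH// inner_content_ge.
Qed.

(** A closed subset of the union is compact, so finitely many of the [U i] already cover it. *)
Lemma inner_content_bigcup (U : nat -> set T) : (forall i, open (U i)) ->
  inner_content (\bigcup_n U n) <= \sum_(i <oo) inner_content (U i).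
Proof.
move=> oU; apply: inner_content_le => K cK KU.
have : compact K by exact: (subclosed_compact cK cT).
rewrite compact_cover => /(_ _ setT U (fun i _ => oU i) KU)[D _ KD].
pose n := (\max_(i <- finmap.enum_fset D) i).+1.
apply: (@le_trans _ _ (\sum_(i < n) inner_content (U i))).
  apply: inner_content_bigcup_lt => // x /KD[i iD Uix]; exists i => //=.
  by rewrite /n ltnS; exact: (@leq_bigmax_seq _ _ xpredT (fun i => i)).
rewrite -(big_mkord xpredT (fun i => inner_content (U i))).
by apply: nneseries_lim_ge => i _ _; exact: inner_content_ge0.
Qed.

Lemma outer_contentE U : open U -> outer_content U = inner_content U.
Proof.
move=> oU; apply/eqP; rewrite eq_le; apply/andP; split.
  by apply: ereal_inf_lbound; exists U => //; split => //; exact: subset_refl.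
by apply: le_ereal_inf_tmp => _ [V [oV UV] <-]; exact: le_inner_content.
Qed.

Lemma outer_content_le A U : open U -> A `<=` U -> outer_content A <= inner_content U.
Proof. by move=> oU AU; apply: ereal_inf_lbound; exists U. Qed.

Lemma outer_content_ge0 A : 0 <= outer_content A.
Proof. by apply: le_ereal_inf_tmp => _ [U _ <-]; exact: inner_content_ge0. Qed.

Lemma le_outer_content : {homo outer_content : A B / A `<=` B >-> A <= B}.
Proof.
move=> A B AB; apply: le_ereal_inf_tmp => _ [U [oU BU] <-].
by apply: outer_content_le => //; exact: subset_trans BU.
Qed.

Lemma outer_content0 : outer_content set0 = 0.
Proof.
rewrite outer_contentE; last exact: open0.
apply/eqP; rewrite eq_le inner_content_ge0 andbT.
by apply: inner_content_le => K _; rewrite subset0 => ->; rewrite nu0.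
Qed.

Lemma outer_content_fin A : outer_content A \is a fin_num.
Proof.
rewrite ge0_fin_numE ?outer_content_ge0//.
apply: (@le_lt_trans _ _ 1); last by rewrite ltey.
by rewrite (le_trans (outer_content_le openT (@subsetT _ _)))// inner_content_le1.
Qed.

Lemma outer_content_adherent A (e : R) : (0 < e)%R ->
  exists U, [/\ open U, A `<=` U & inner_content U <= outer_content A + e%:E].
Proof.
move=> e0.
have [_ [U [oU AU] <-] h] := @lb_ereal_inf_adherent _ _ e e0 (outer_content_fin A).
by exists U; split=> //; exact: ltW.
Qed.

Lemma outer_content_sigma_subadditive : sigma_subadditive outer_content.
Proof.
move=> F; apply/lee_addgt0Pr => e e0.
have h n : exists U, [/\ open U, F n `<=` U &
    inner_content U <= outer_content (F n) + (e / (2 ^ n.+1)%:R)%:E].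
  by apply: outer_content_adherent; rewrite divr_gt0// ltr0n expn_gt0.
have [U /all_and3[oU FU Uh]] := choice h.
apply: (@le_trans _ _ (inner_content (\bigcup_n U n))).
  apply: outer_content_le; first exact: bigcup_open.
  exact: subset_bigcup.
apply: (le_trans (inner_content_bigcup oU)).
apply: le_trans (epsilon_trick xpredT (fun n => outer_content_ge0 (F n)) (ltW e0)).
by apply: lee_nneseries => n *; [exact: inner_content_ge0|exact: Uh].
Qed.

HB.instance Definition _ := isOuterMeasure.Build R T outer_content
  outer_content0 outer_content_ge0 le_outer_content outer_content_sigma_subadditive.

(** Choose [V] open around [A], then [K] nearly optimal in the part of [V] inside [U], then [L]
    nearly optimal in [V] minus [K]. The sets [K] and [L] are disjoint, so superadditivity applies,
    and [V] minus [K] contains the part of [A] outside [U]. The three approximations cost [e / 3]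
    each. *)
Lemma open_caratheodory U : open U -> outer_content.-caratheodory U.
Proof.
move=> oU.
suff le_outer A : outer_content (A `&` U) + outer_content (A `&` ~` U) <= outer_content A.
  exact: le_caratheodory_measurable.
apply/lee_addgt0Pr => e e0.
have aux (a k l : R) : (k + l <= a + e / 3 -> (k + e / 3) + (l + e / 3) <= a + e)%R.
  by lra.
have e20 : (0 < e / 3)%R by rewrite divr_gt0.
have [V [oV AV Vh]] := outer_content_adherent A e20.
have [K [cK KVU Kh]] := inner_content_adherent (V `&` U) e20.
have oVK : open (V `&` ~` K) by apply: openI => //; exact: closed_openC.
have [L [cL LVK Lh]] := inner_content_adherent (V `&` ~` K) e20.
have [_ _ _ h] := cnu.
have KL : (nu K)%:E + (nu L)%:E <= inner_content V.
  rewrite -EFinD; apply: (@le_trans _ _ (nu (K `|` L))%:E).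
    rewrite lee_fin h//; rewrite -subset0 => x [Kx].
    by move=> /LVK[_].
  apply: inner_content_ge; first exact: closedU.
  by rewrite subUset; split=> x; [move=> /KVU[]|move=> /LVK[]].
have AU : outer_content (A `&` U) <= (nu K)%:E + (e / 3)%:E.
  apply: le_trans Kh; apply: outer_content_le; first exact: openI.
  exact: setSI.
have AUC : outer_content (A `&` ~` U) <= (nu L)%:E + (e / 3)%:E.
  apply: le_trans Lh; apply: outer_content_le => // x [/AV Vx nUx]; split=> //.
  by move=> /KVU[].
apply: (le_trans (leeD AU AUC)).
have := le_trans KL Vh.
rewrite -(fineK (outer_content_fin A)) -!EFinD !lee_fin; exact: aux.
Qed.

Lemma closed_le_outer_content F : closed F -> (nu F)%:E <= outer_content F.
Proof.
by move=> cF; apply: le_ereal_inf_tmp => _ [U [oU FU] <-]; exact: inner_content_ge.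
Qed.

End content_outer_measure.

(** The measure may exceed the content on closed sets, since mass can accumulate on a closed set
    from outside. With equal total masses, the inequality is the portmanteau criterion for weak
    convergence. *)
Lemma closed_content_measure d (T : measTopType d) (R : realType) (nu : set T -> R) :
  hausdorff_space T -> compact [set: T] -> is_borel T ->
  closed_content nu -> nu setT = 1 ->
  exists q : probability T R, forall F, closed F -> ((nu F)%:E <= q F)%E.
Proof.
move=> hT cT bT cnu nuT.
have [mu0 [[m0 mge mle msub] [oC cle muT]]] : exists mu0 : set T -> \bar R,
    [/\ mu0 set0 = 0%E, forall A, (0 <= mu0 A)%E,
        {homo mu0 : A B / A `<=` B >-> (A <= B)%E} & sigma_subadditive mu0] /\
    [/\ forall U, open U -> mu0.-caratheodory U,
        forall F, closed F -> ((nu F)%:E <= mu0 F)%E & mu0 setT = 1%E].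
  exists (outer_content nu); split; split.
  - exact: outer_content0.
  - exact: outer_content_ge0.
  - exact: le_outer_content.
  - exact: outer_content_sigma_subadditive.
  - exact: open_caratheodory.
  - exact: closed_le_outer_content.
  - apply/eqP; rewrite eq_le; apply/andP; split.
      rewrite outer_contentE; last exact: openT.
      exact: inner_content_le1.
    by rewrite -nuT; exact: closed_le_outer_content closedT.
pose mu : {outer_measure set T -> \bar R} :=
  HB.pack mu0 (isOuterMeasure.Build R T mu0 m0 mge mle msub).
have cara (A : set T) : measurable A -> mu.-cara.-measurable A.
  move=> /bT; apply; split.
    split.
    - exact: measurable0.
    - by move=> B mB; rewrite setTD; exact: measurableC.
    - by move=> F mF; exact: bigcup_measurable.
  by move=> U oU; exact: oC.
have sadd : semi_sigma_additive mu0.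
  move=> F mF tF mU.
  apply: (caratheodory_measure_sigma_additive (mu := mu)) => //.
    by move=> i; exact: cara.
  exact: cara.
pose M := isMeasure.Build d T R mu0 m0 mge sadd.
pose mm : measure T R := HB.pack mu0 M.
pose Q := Measure_isProbability.Build d T R mm muT.
pose q : probability T R := HB.pack (Measure.sort mm) Q.
by exists q.
Qed.

Section borel.
Context d (T : measTopType d) (R : realType).
Hypothesis bT : is_borel T.

Lemma borel_open (U : set T) : open U -> measurable U.
Proof. by move=> oU; apply/bT; exact: sub_sigma_algebra. Qed.

Lemma borel_closed (K : set T) : closed K -> measurable K.
Proof.
move=> cK; rewrite -(setCK K); apply: measurableC; apply: borel_open.
exact: closed_openC.
Qed.

Lemma borel_continuous (f : T -> R) : continuous f -> measurable_fun setT f.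
Proof.
move=> cf; apply: (measurability _ (RGenOInfty.measurableE R)).
move=> _ [_ [x ->] <-]; rewrite setTI; apply: borel_open.
apply: open_comp; first by move=> y _; exact: cf.
by rewrite set_itvE; exact: open_gt.
Qed.

End borel.

(** * Weak limits along an ultrafilter *)

Lemma ultra_cvg_bounded (R : realType) (I : Type) (F : set_system I) (x : I -> R)
    (a b : R) : UltraFilter F -> (forall n, a <= x n <= b) ->
  cvg (x n @[n --> F]).
Proof.
move=> uF xab.
have [|p [_ pc]] := @segment_compact R a b (x n @[n --> F]) _.
  by rewrite nbhs_filterE; apply: (@filterE _ F) => n /=; have := xab n; rewrite in_itv.
apply/cvg_ex; exists p => B pB; have [//|nB] := in_ultra_setVsetC (x @^-1` B) uF.
by have [y [/= nBy By]] := pc (~` B) B nB pB.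
Qed.

(** For [s] at most [N] the sum is the floor of [s]. The first clause is the saturated case, on
    which the induction falls back once [s] exceeds [N]. *)
Lemma count_floor (R : realType) (s : R) (N : nat) : 0 <= s ->
  (N%:R <= s -> \sum_(k < N) (k.+1%:R <= s)%R%:R = N%:R :> R) /\
  (s <= N%:R -> \sum_(k < N) (k.+1%:R <= s)%R%:R <= s <= \sum_(k < N) (k.+1%:R <= s)%R%:R + 1).
Proof.
move=> s0; elim: N => [|N [IH1 IH2]].
  by rewrite big_ord0; split=> // sle; apply/andP; split; lra.
have IH1' : N.+1%:R <= s -> \sum_(k < N.+1) (k.+1%:R <= s)%R%:R = N.+1%:R :> R.
  move=> Ns; rewrite big_ord_recr/= Ns IH1 ?natr1//.
  by apply: le_trans Ns; rewrite ler_nat.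
split=> // sN.
have [Ns|sN'] := leP N.+1%:R s.
  by rewrite IH1'//; apply/andP; split; [|lra].
rewrite big_ord_recr/= (leNgt N.+1%:R s) sN'/= addr0.
have [sN1|Ns] := leP s N%:R; first exact: IH2.
rewrite IH1; last exact: ltW.
by rewrite natr1 sN ltW.
Qed.

(** With [t = f x], this approximates [f], up to [1 / (N + 1)], by an average of indicators of the
    closed sets where [f] is at least [k / (N + 1)], that is, by sets on which a content is under
    control. *)
Lemma layer_cake (R : realType) (t : R) (N : nat) : 0 <= t <= 1 ->
  N.+1%:R^-1 * \sum_(k < N.+1) (k.+1%:R / N.+1%:R <= t)%R%:R <= t <=
  N.+1%:R^-1 * \sum_(k < N.+1) (k.+1%:R / N.+1%:R <= t)%R%:R + N.+1%:R^-1.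
Proof.
move=> /andP[t0 t1].
have N0 : 0 < N.+1%:R :> R by [].
have [_] := @count_floor R (t * N.+1%:R) N.+1 (mulr_ge0 t0 (ltW N0)).
have -> : t * N.+1%:R <= N.+1%:R by rewrite ler_piMl// ltW.
move=> /(_ isT).
under eq_bigr do rewrite -ler_pdivrMr//.
move=> /andP[h1 h2]; apply/andP; split.
  by rewrite mulrC ler_pdivrMr.
by rewrite -[X in _ + X]mulr1 -mulrDr mulrC ler_pdivlMr.
Qed.

Section Rintegral_extra.
Context d (T : measurableType d) (R : realType).
Variable mu : {measure set T -> \bar R}.

Lemma integrable_EFin_sum n (h : nat -> T -> R) :
  (forall k, mu.-integrable setT (EFin \o h k)) ->
  mu.-integrable setT (EFin \o (fun x => \sum_(k < n) h k x)).
Proof.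
move=> ih; elim: n => [|n IH].
  by under eq_fun do rewrite big_ord0; exact: integrable0.
by under eq_fun do rewrite big_ord_recr; exact: integrable_EFinD.
Qed.

Lemma Rintegral_sum n (h : nat -> T -> R) :
  (forall k, mu.-integrable setT (EFin \o h k)) ->
  \int[mu]_x (\sum_(k < n) h k x) = \sum_(k < n) \int[mu]_x h k x.
Proof.
move=> ih; elim: n => [|n IH].
  under eq_Rintegral do rewrite big_ord0.
  by rewrite Rintegral_cst// mul0r big_ord0.
under eq_Rintegral do rewrite big_ord_recr.
by rewrite RintegralD//= ?big_ord_recr ?IH//; exact: integrable_EFin_sum.
Qed.

Lemma integrable_bdd_mul (f h : T -> R) (M : R) :
  measurable_fun setT f -> (forall x, `|f x| <= M) ->
  mu.-integrable setT (EFin \o h) ->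
  mu.-integrable setT (EFin \o (fun x => f x * h x)).
Proof.
move=> mf fM ih; have /measurable_EFinP mh := measurable_int _ ih.
apply: (le_integrable _ _ _ (integrableZl measurableT M ih)) => //.
  by apply/measurable_EFinP; exact: measurable_funM.
move=> x _ /=; rewrite lee_fin !normrM ler_wpM2r//.
by rewrite (le_trans (fM x))// ler_norm.
Qed.

End Rintegral_extra.

Section weak_limit.
Context d (T : measTopType d) (R : realType).
Hypothesis bT : is_borel T.
Hypothesis hT : hausdorff_space T.
Hypothesis cT : compact [set: T].
Variables (rho : {measure set T -> \bar R}) (g : nat -> T -> R).
Hypothesis g0 : forall n x, 0 <= g n x.
Hypothesis ig : forall n, rho.-integrable setT (EFin \o g n).
Hypothesis g1 : forall n, \int[rho]_x g n x = 1.
Variable F : set_system nat.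
Hypothesis uF : UltraFilter F.

Let pF : ProperFilter F. Proof. exact: ultra_proper. Qed.

Let m n (A : set T) : R := \int[rho]_x (\1_A x * g n x).

Lemma integrable_indic_mul n A : measurable A ->
  rho.-integrable setT (EFin \o (fun x => \1_A x * g n x)).
Proof.
move=> mA; apply: (@integrable_bdd_mul _ _ _ _ _ _ 1) => //.
by move=> x; rewrite ger0_norm// indicE lern1 leq_b1.
Qed.

Let m_bound n A : measurable A -> 0 <= m n A <= 1.
Proof.
move=> mA; apply/andP; split.
  by apply: Rintegral_ge0 => x _; rewrite mulr_ge0.
rewrite -(g1 n); apply: le_Rintegral => //; first exact: integrable_indic_mul.
by move=> x _; rewrite ler_piMl// indicE lern1 leq_b1.
Qed.

(** The ultrafilter makes all these limits exist at once, without a diagonal extraction. *)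
Let nu (A : set T) : R := lim (m n A @[n --> F]).

Let nuP A : closed A -> m n A @[n --> F] --> nu A.
Proof.
move=> cA; apply: (@ultra_cvg_bounded _ _ _ _ 0 1) => // n.
by apply: m_bound; exact: borel_closed.
Qed.

Let cnu : closed_content nu.
Proof.
have mc := borel_closed bT.
split=> [K cK|K L cK cL KL|K L cK cL|K L cK cL KL].
- apply: (cvgr_to_ge (nuP cK)); apply: nearW => n.
  by have /andP[] := m_bound n (mc _ cK).
- apply: (ler_cvg_to (nuP cK) (nuP cL)); apply: nearW => n.
  apply: le_Rintegral => //; [exact/integrable_indic_mul/mc|exact/integrable_indic_mul/mc|].
  move=> x _; rewrite ler_wpM2r// !indicE ler_nat.
  by have [/set_mem/KL/mem_set ->|] := boolP (x \in K).
- have cKL : closed (K `|` L) by exact: closedU.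
  apply: (ler_cvg_to (nuP cKL) (cvgD (nuP cK) (nuP cL))); apply: nearW => n.
  suff : m n (K `|` L) <= m n K + m n L by [].
  rewrite /m -RintegralD//; [|exact/integrable_indic_mul/mc|exact/integrable_indic_mul/mc].
  apply: le_Rintegral => //; first exact/integrable_indic_mul/mc.
    by apply: integrable_EFinD; exact/integrable_indic_mul/mc.
  move=> x _; rewrite -mulrDl ler_wpM2r// !indicE in_setU -natrD ler_nat.
  by case: (_ \in _); case: (_ \in _).
- have cKL : closed (K `|` L) by exact: closedU.
  apply: (ler_cvg_to (cvgD (nuP cK) (nuP cL)) (nuP cKL)); apply: nearW => n.
  suff : m n K + m n L <= m n (K `|` L) by [].
  rewrite /m -RintegralD//; [|exact/integrable_indic_mul/mc|exact/integrable_indic_mul/mc].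
  apply: le_Rintegral => //.
  + by apply: integrable_EFinD; exact/integrable_indic_mul/mc.
  + exact/integrable_indic_mul/mc.
  move=> x _; rewrite -mulrDl ler_wpM2r// !indicE in_setU -natrD ler_nat.
  have [/set_mem Kx|] := boolP (x \in K); have [/set_mem Lx|] := boolP (x \in L) => //.
  by have : (K `&` L) x by []; rewrite KL.
Qed.

Let nuT : nu setT = 1.
Proof.
apply: (cvg_unique (@norm_hausdorff _ _) (nuP closedT)).
rewrite (_ : (fun n => m n setT) = cst 1); first exact: cvg_cst.
apply/funext => n; rewrite /m -(g1 n); apply: eq_Rintegral => x _.
by rewrite indicT mul1r.
Qed.

(** One half of the portmanteau theorem: [layer_cake] bounds the integrals against [g n] from above
    and the integral against [q] from below by masses of the same closed superlevel sets, where [nu]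
    is at most [q]. The remaining error [1 / (N + 1)] tends to [0]. *)
Let weak_limit_le (q : probability T R) (f : T -> R) :
  (forall K, closed K -> ((nu K)%:E <= q K)%E) ->
  continuous f -> (forall x, 0 <= f x <= 1) ->
  lim (\int[rho]_x (f x * g n x) @[n --> F]) <= \int[q]_x f x.
Proof.
move=> nuq cf f01.
have mf := borel_continuous bT cf.
have fn x : `|f x| <= 1 by have /andP[h1 h2] := f01 x; rewrite ger0_norm.
have ifg n : rho.-integrable setT (EFin \o (fun x => f x * g n x)).
  exact: (@integrable_bdd_mul _ _ _ _ _ _ 1).
have iq (h : T -> R) M : measurable_fun setT h -> (forall x, `|h x| <= M) ->
    q.-integrable setT (EFin \o h).
  move=> mh hM; have i1 : q.-integrable setT (EFin \o cst 1%R).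
    exact: finite_measure_integrable_cst.
  have := integrable_bdd_mul mh hM i1.
  by under eq_fun do rewrite mulr1.
pose K N k := f @^-1` [set t | k.+1%:R / N.+1%:R <= t].
have cK N k : closed (K N k).
  by apply: closed_comp; [move=> x _; exact: cf|exact: closed_ge].
have mK N k : measurable (K N k) by exact: borel_closed.
have K1 N k x : `|\1_(K N k) x| <= 1 :> R by rewrite ger0_norm// indicE lern1 leq_b1.
have KE N k x : \1_(K N k) x = (k.+1%:R / N.+1%:R <= f x)%R%:R :> R.
  by rewrite indicE; congr ((nat_of_bool _)%:R); apply/idP/idP => [/set_mem//|/mem_set].
have upper N n : \int[rho]_x (f x * g n x) <=
    N.+1%:R^-1 * \sum_(k < N.+1) m n (K N k) + N.+1%:R^-1.
  have iS0 := integrable_EFin_sum N.+1 (fun k => integrable_indic_mul n (mK N k)).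
  have iS : rho.-integrable setT
      (EFin \o (fun x => N.+1%:R^-1 * \sum_(k < N.+1) (\1_(K N k) x * g n x))).
    exact: integrable_EFinZ.
  have iN : rho.-integrable setT (EFin \o (fun x => N.+1%:R^-1 * g n x)).
    exact: integrable_EFinZ.
  apply: (@le_trans _ _ (\int[rho]_x (N.+1%:R^-1 * \sum_(k < N.+1) (\1_(K N k) x * g n x) +
    N.+1%:R^-1 * g n x))).
    apply: le_Rintegral => //; first exact: integrable_EFinD.
    move=> x _; rewrite -mulr_suml mulrA -mulrDl ler_wpM2r//.
    under eq_bigr do rewrite KE.
    by have /andP[] := layer_cake N (f01 x).
  rewrite RintegralD// !RintegralZl// g1 mulr1.
  by rewrite (Rintegral_sum N.+1 (fun k => integrable_indic_mul n (mK N k))).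
have lower N : N.+1%:R^-1 * \sum_(k < N.+1) \int[q]_x \1_(K N k) x <= \int[q]_x f x.
  have iK k : q.-integrable setT (EFin \o \1_(K N k) : T -> \bar R) by exact: (iq _ 1).
  have iS0 := integrable_EFin_sum N.+1 iK.
  rewrite -(Rintegral_sum N.+1 iK) -RintegralZl//.
  apply: le_Rintegral => //.
  - exact: integrable_EFinZ.
  - exact: (iq _ 1).
  move=> x _; under eq_bigr do rewrite KE.
  by have /andP[] := layer_cake N (f01 x).
have cL : \int[rho]_x (f x * g n x) @[n --> F] -->
    lim (\int[rho]_x (f x * g n x) @[n --> F]).
  apply: (@ultra_cvg_bounded _ _ _ _ 0 1) => // n; apply/andP; split.
    by apply: Rintegral_ge0 => x _; rewrite mulr_ge0//; have /andP[] := f01 x.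
  rewrite -(g1 n); apply: le_Rintegral => // x _.
  by rewrite ler_piMl//; have /andP[] := f01 x.
set L := lim _ in cL *.
have LN N : L <= \int[q]_x f x + N.+1%:R^-1.
  apply: (@le_trans _ _ (N.+1%:R^-1 * \sum_(k < N.+1) nu (K N k) + N.+1%:R^-1)).
    have h1 : \sum_(k < N.+1) m n (K N k) @[n --> F] --> \sum_(k < N.+1) nu (K N k).
      elim: N.+1 => [|j IH].
        under eq_fun do rewrite big_ord0; rewrite big_ord0; exact: cvg_cst.
      under eq_fun do rewrite big_ord_recr; rewrite big_ord_recr.
      exact: (cvgD IH (nuP (cK _ _))).
    have h2 := cvgM (cvg_cst (N.+1%:R^-1 : R) (F := F)) h1.
    have h3 := cvgD (h2 _ _) (cvg_cst (N.+1%:R^-1 : R) (F := F)).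
    by apply: (ler_cvg_to cL (h3 _ _ _ _)); apply: nearW => n; exact: upper.
  rewrite lerD2r; apply: le_trans (lower N); rewrite ler_wpM2l//.
  apply: ler_sum => k _; have := nuq _ (cK N k).
  rewrite /Rintegral integral_indic// setIT => h; rewrite -lee_fin fineK//.
  exact: fin_num_measure.
have h : \int[q]_x f x + n.+1%:R^-1 @[n --> \oo] --> \int[q]_x f x.
  rewrite -[X in _ --> X]addr0; apply: cvgD; first exact: cvg_cst.
  exact: cvg_harmonic.
by apply: (ler_cvg_to (cvg_cst L) h); apply: nearW => n; exact: LN.
Qed.

Lemma weak_limit_ultra : exists q : probability T R, forall f : T -> R,
  continuous f -> \int[rho]_x (f x * g n x) @[n --> F] --> \int[q]_x f x.
Proof.
have [q nuq] := closed_content_measure hT cT bT cnu nuT.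
exists q => f cf.
have mf := borel_continuous bT cf.
have [M fM] : exists M, forall x, `|f x| <= M.
  have : compact (f @` setT) by apply: continuous_compact => //; exact: continuous_subspaceT.
  move/compact_bounded => -[M [_ hM]]; exists (M + 1) => x.
  by apply: (hM (M + 1)); [rewrite ltrDl|exists x].
have ifg n : rho.-integrable setT (EFin \o (fun x => f x * g n x)).
  exact: (@integrable_bdd_mul _ _ _ _ _ _ M).
have iqf : q.-integrable setT (EFin \o f).
  have i1 : q.-integrable setT (EFin \o cst 1%R) by exact: finite_measure_integrable_cst.
  have := integrable_bdd_mul mf fM i1.
  by under eq_fun do rewrite mulr1.
have iqc (c : R) : q.-integrable setT (EFin \o cst c) by exact: finite_measure_integrable_cst.
pose B := M + 1.
have B0 : 0 < B.
  by rewrite /B ltr_pwDr// (le_trans _ (fM point)).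
have fB x : `|f x| <= B by rewrite (le_trans (fM x))// lerDl.
have cL : \int[rho]_x (f x * g n x) @[n --> F] -->
    lim (\int[rho]_x (f x * g n x) @[n --> F]).
  apply: (@ultra_cvg_bounded _ _ _ _ (- B) B) => // n.
  rewrite -ler_norml (le_trans (le_normr_Rintegral _ _))//.
  apply: (@le_trans _ _ (\int[rho]_x (B * g n x))).
    apply: le_Rintegral => //; [exact: integrable_norm|exact: integrable_EFinZ|].
    by move=> x _; rewrite normrM (ger0_norm (g0 n x)) ler_wpM2r.
  by rewrite RintegralZl// g1 mulr1.
(* The one-sided inequality for [f] and for [- f] gives equality. *)
suff le_f e : e = 1 \/ e = -1 -> e * lim (\int[rho]_x (f x * g n x) @[n --> F]) <= e * \int[q]_x f x.
  have -> : \int[q]_x f x = lim (\int[rho]_x (f x * g n x) @[n --> F]) => //.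
  have := le_f 1 (or_introl erefl); have := le_f (-1) (or_intror erefl).
  by rewrite !mul1r !mulN1r lerN2 => h1 h2; apply/eqP; rewrite eq_le h1.
move=> eE.
(* An affine map of [[-B, B]] into [[0, 1]]; it commutes with both integrals because all total
   masses are [1]. *)
pose f' x := (2 * B)^-1 * (e * f x + B).
have B20 : 0 < 2 * B by rewrite mulr_gt0.
have cf' : continuous f'.
  move=> x; apply: cvgM; first exact: cvg_cst.
  apply: cvgD; last exact: cvg_cst.
  by apply: cvgM; [exact: cvg_cst|exact: cf].
have f'01 x : 0 <= f' x <= 1.
  have := fB x; rewrite ler_norml => /andP[h1 h2].
  rewrite /f' mulrC divr_ge0 ?(ltW B20)//=; last by case: eE => ->; lra.
  by rewrite ler_pdivrMr// mul1r; case: eE => ->; lra.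
have := weak_limit_le nuq cf' f'01.
have -> : \int[q]_x f' x = (2 * B)^-1 * (e * \int[q]_x f x + B).
  rewrite /f' RintegralZl//; last first.
    by apply: integrable_EFinD; [exact: integrable_EFinZ|exact: iqc].
  rewrite RintegralD//; [|exact: integrable_EFinZ|exact: iqc].
  rewrite RintegralZl// Rintegral_cst//.
  by rewrite [X in fine X](_ : _ = 1%E) ?mulr1//; exact: probability_setT.
have -> : lim (\int[rho]_x (f' x * g n x) @[n --> F]) =
    (2 * B)^-1 * (e * lim (\int[rho]_x (f x * g n x) @[n --> F]) + B).
  have h1 := cvgM (cvg_cst (e : R) (F := F)) cL.
  have h2 := cvgD (h1 _ _) (cvg_cst (B : R) (F := F)).
  have h3 := cvgM (cvg_cst ((2 * B)^-1 : R) (F := F)) (h2 _ _ _ _).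
  rewrite (_ : (fun n => \int[rho]_x (f' x * g n x)) =
    (fun n => (2 * B)^-1 * (e * (\int[rho]_x (f x * g n x)) + B))).
    by apply: cvg_lim => //; exact: h3.
  apply/funext => n; rewrite [X in _ + X](_ : B = B * \int[rho]_x g n x); last by rewrite g1 mulr1.
  have i1 : rho.-integrable setT (EFin \o (fun x => e * (f x * g n x))).
    exact: integrable_EFinZ.
  have i2 : rho.-integrable setT (EFin \o (fun x => B * g n x)).
    exact: integrable_EFinZ.
  rewrite -!RintegralZl// -RintegralD// -RintegralZl//; last exact: integrable_EFinD.
  by apply: eq_Rintegral => x _; rewrite /f'; ring.
by rewrite ler_pM2l ?invr_gt0// lerD2r.
Qed.
End weak_limit.

Fixpoint bigcapn (T : Type) (V : nat -> set T) n : set T :=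
  if n is n'.+1 then bigcapn V n' `&` V n else V 0%N.

Lemma bigcapnP (T : Type) (V : nat -> set T) n x :
  bigcapn V n x <-> forall k, (k <= n)%N -> V k x.
Proof.
elim: n => [|n IH] /=; first by split=> [V0 [|//]|]; [|exact].
split=> [[/IH h Vx] k|h].
  by rewrite leq_eqVlt ltnS => /predU1P[->//|/h].
by split; [apply/IH => k kn; apply: h; exact: leqW|exact: h].
Qed.

Lemma open_bigcapn (T : topologicalType) (V : nat -> set T) n :
  (forall k, open (V k)) -> open (bigcapn V n).
Proof. by move=> oV; elim: n => //= n IH; exact: openI. Qed.

(** * Separation in compact second countable spaces *)

Section compact_separation.
Context (T : ptopologicalType) (R : realType).
Hypothesis hT : hausdorff_space T.
Hypothesis cT : compact [set: T].

Lemma urysohn_closed_open (K U : set T) : closed K -> open U -> K `<=` U ->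
  exists f : T -> R, [/\ continuous f, forall x, 0 <= f x <= 1,
    forall x, K x -> f x = 1 & forall x, ~ U x -> f x = 0].
Proof.
move=> cK oU KU.
have sep : uniform_separator (~` U) K.
  apply: normal_uniform_separator => //; first exact: compact_normal.
    exact: open_closedC.
  by rewrite -subset0 => x [nUx /KU].
exists (Urysohn (~` U) K); split.
- exact: Urysohn_continuous.
- move=> x; have /= := @Urysohn_range _ R (~` U) K (Urysohn (~` U) K x).
  by rewrite in_itv/=; apply; exists x.
- by move=> x Kx; apply: (@Urysohn_sub1 _ R _ _ sep); exists x.
- by move=> x Ux; apply: (@Urysohn_sub0 _ R _ _ sep); exists x.
Qed.

Lemma urysohn_point (x0 : T) (N : set T) : nbhs x0 N ->
  exists f : T -> R, [/\ continuous f, forall x, 0 <= f x <= 1,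
    f x0 = 1 & forall x, ~ N x -> f x = 0].
Proof.
move=> Nx.
have cx : closed [set x0] by apply: compact_closed => //; exact: compact_set1.
have [|f [cf f01 f1 f0]] := urysohn_closed_open cx (@open_interior _ N).
  by move=> _ ->.
exists f; split=> //; first exact: f1.
by move=> x nNx; apply: f0 => /interior_subset.
Qed.

Hypothesis sT : @second_countable T.

(** By regularity, a point outside [K] has a basic neighbourhood whose closure misses [K]. There are
    countably many such closures; intersecting the complements of the first ones makes the sequence
    decrease, so a point once excluded stays excluded. *)
Lemma closed_Gdelta (K : set T) : closed K ->
  exists V : nat -> set T, [/\ forall n, open (V n), forall n, K `<=` V n &
    forall x, ~ K x -> exists N, forall n, (N <= n)%N -> ~ V n x].
Proof.
move=> cK; have [B cB [oB bB]] := sT.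
have /countable_injP[code codeI] := cB.
pose e n := xget set0 [set D | B D /\ code D = n].
have eE D : B D -> e (code D) = D.
  move=> BD; have [BD' h] : [set D' | B D' /\ code D' = code D] (e (code D)).
    by apply: xgetPex; exists D.
  by apply: codeI; rewrite ?inE.
pose W k := if `[< closure (e k) `&` K = set0 >] then ~` closure (e k) else setT.
exists (bigcapn W); split.
- move=> n; apply: open_bigcapn => k; rewrite /W; case: asboolP => [_|_].
    exact/closed_openC/closed_closure.
  exact: openT.
- move=> n x Kx; apply/bigcapnP => k _; rewrite /W; case: asboolP => [ek0 cx|//].
  by have : (closure (e k) `&` K) x by []; rewrite ek0.
- move=> x nKx; have oKC : open (~` K) by exact: closed_openC.
  have [C xC CK] : filter_from (nbhs x) closure (~` K).
    by apply: (@compact_regular _ x setT hT cT) => //; [exact: filterT|exact: open_nbhs_nbhs].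
  have [D [BD Dx] DC] := bB x C xC.
  exists (code D) => n Dn /bigcapnP/(_ _ Dn); rewrite /W eE//; case: asboolP.
    by move=> _; apply; exact: subset_closure.
  by case; rewrite -subset0 => y [/(closureS DC)/CK].
Qed.

(** A continuous approximation of the indicator of [K], in the form that dominated convergence
    needs: off [K] the values eventually vanish. *)
Lemma urysohn_seq (K : set T) : closed K ->
  exists f : nat -> T -> R, [/\ forall n, continuous (f n),
    forall n x, 0 <= f n x <= 1, forall n x, K x -> f n x = 1 &
    forall x, ~ K x -> exists N, forall n, (N <= n)%N -> f n x = 0].
Proof.
move=> cK; have [V [oV KV Vx]] := closed_Gdelta cK.
have [f fP] := choice (fun n => urysohn_closed_open cK (oV n) (KV n)).
exists f; split.
- by move=> n; case: (fP n).
- by move=> n; case: (fP n).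
- by move=> n; case: (fP n).
- move=> x /Vx[N VN]; exists N => n /VN nVx; by have [_ _ _] := fP n; apply.
Qed.
End compact_separation.

(** * Eigenfunctions of a factor *)

Section weights.
Context d (T : measurableType d) (R : realType).
Variable mu : {measure set T -> \bar R}.
Implicit Types f : T -> R[i].

Definition wmass (h : T -> R) f : R := \int[mu]_x (h x * cmod (f x) ^+ 2).

Lemma integrable_wmass (h : T -> R) (M : R) f : measurable_fun setT h ->
  (forall x, `|h x| <= M) -> L2 mu f ->
  mu.-integrable setT (EFin \o (fun x => h x * cmod (f x) ^+ 2)).
Proof. by move=> mh hM /L2P[mf if_]; exact: integrable_bdd_mul hM if_. Qed.

Lemma wmass_ge0 (h : T -> R) f : (forall x, 0 <= h x) -> 0 <= wmass h f.
Proof. by move=> h0; apply: Rintegral_ge0 => x _; rewrite mulr_ge0// cmod_sqr_ge0. Qed.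

Lemma wmassZ (h : T -> R) (M : R) (a : R[i]) f : measurable_fun setT h ->
  (forall x, `|h x| <= M) -> L2 mu f ->
  wmass h (fun x => a * f x) = cmod a ^+ 2 * wmass h f.
Proof.
move=> mh hM fL; rewrite /wmass -RintegralZl//; last exact: integrable_wmass hM fL.
by apply: eq_Rintegral => x _; rewrite cmod_sqrM mulrCA.
Qed.

Lemma n2E f : n2 mu f = \int[mu]_x cmod (f x) ^+ 2.
Proof. by apply: eq_Rintegral => x _; rewrite rip_funxx. Qed.

(** [wmass h f] is the squared norm of [sqrt h] times [f], and multiplication by [sqrt h] is bounded
    on L2. *)
Lemma wmass_cvg (h : T -> R) (M : R) (u : nat -> T -> R[i]) v :
  measurable_fun setT h -> (forall x, 0 <= h x <= M) ->
  (forall n, L2 mu (u n)) -> L2 mu v -> L2_cvg mu u v ->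
  (fun n => wmass h (u n)) @ \oo --> wmass h v.
Proof.
move=> mh h0M uL vL uv.
have hn x : `|h x| <= M by have /andP[h0 hM] := h0M x; rewrite ger0_norm.
pose r x : R[i] := (Num.sqrt (h x))%:C%C.
have rE x : cmod (r x) ^+ 2 = h x.
  by rewrite cmod_sqr /= expr0n addr0 sqr_sqrtr//; have /andP[] := h0M x.
have mr : cmeas r.
  split; last exact: measurable_cst.
  exact: (measurableT_comp (continuous_measurable_fun (@sqrt_continuous R)) mh).
have rL f : L2 mu f -> L2 mu (fun x => r x * f x).
  move=> fL; have /L2P[mf if_] := fL.
  apply: (L2_dom _ (integrable_EFinZ M if_)); first exact: cmeasM.
  by move=> x; rewrite cmod_sqrM rE ler_wpM2r ?cmod_sqr_ge0//; have /andP[] := h0M x.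
have wE f : wmass h f = n2 mu (fun x => r x * f x).
  by rewrite n2E; apply: eq_Rintegral => x _; rewrite cmod_sqrM rE.
rewrite wE (_ : (fun n => _) = (fun n => n2 mu (fun x => r x * u n x))); last first.
  by apply/funext => n; rewrite wE.
apply: L2_cvg_n2 => //; try by move=> n; exact: rL.
  exact: rL.
apply: (@squeeze_cvgr _ _ _ _ (cst 0) (fun n => M * n2 mu (fun x => u n x - v x))).
- apply: nearW => n; rewrite n2_ge0/= !n2E.
  have /L2P[_ i1] := L2B (uL n) vL.
  rewrite -RintegralZl//; apply: le_Rintegral => //.
  + have /L2P[_ i2] := L2B (rL _ (uL n)) (rL _ vL); exact: i2.
  + exact: integrable_EFinZ.
  + move=> x _; rewrite -mulrBr cmod_sqrM rE ler_wpM2r ?cmod_sqr_ge0//.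
    by have /andP[] := h0M x.
- exact: cvg_cst.
- have h1 := cvgM (cvg_cst (M : R) (F := \oo)) uv.
  by rewrite -(mulr0 M); exact: h1.
Qed.

Lemma wmass_cvg0 (f : nat -> T -> R) (K : set T) (g : T -> R) :
  measurable K -> mu K = 0%E ->
  (forall n, measurable_fun setT (f n)) -> (forall n x, 0 <= f n x <= 1) ->
  (forall x, ~ K x -> exists N, forall n, (N <= n)%N -> f n x = 0) ->
  mu.-integrable setT (EFin \o g) ->
  (fun n => \int[mu]_x (f n x * g x)) @ \oo --> 0.
Proof.
move=> mK K0 mf f01 fK ig.
have fn n x : `|f n x| <= 1 by have /andP[h0 hM] := f01 n x; rewrite ger0_norm.
have ifg n := integrable_bdd_mul (mf n) (fn n) ig.
have /measurable_EFinP mg := measurable_int _ ig.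
have [] := @dominated_convergence _ _ _ mu setT measurableT
  (fun n x => (f n x * g x)%:E) (cst 0%E) (fun x => `|(g x)%:E|%E).
- by move=> n; exact: measurable_int (ifg n).
- exact: measurable_cst.
- exists K; split=> // x /= nK; apply: contrapT => Kx; apply: nK => _.
  have [N hN] := fK x Kx; apply: cvg_near_cst; exists N => // n /= /hN ->.
  by rewrite mul0r.
- exact: (integrable_norm ig).
- apply: aeW => x n _ /=; rewrite lee_fin normrM ler_piMl//.
move=> _ _; rewrite integral0 => h.
exact: (fine_cvg h).
Qed.

End weights.

Section eigenfunction_limits.
Context d (T : measTopType d) (R : realType).
Hypothesis bT : is_borel T.
Hypothesis hT : hausdorff_space T.
Hypothesis cT : compact [set: T].
Hypothesis sT : @second_countable T.
Variable rho : probability T R.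
Variable A : (T -> R[i]) -> (T -> R[i]) -> Prop.
Hypothesis sa : self_adjoint rho A.
Hypothesis cr : compact_resolvent rho A.

(** An eigenfunction is the image under the resolvent at [z] of its own multiple by [lam - z], and
    these multiples are bounded. *)
Lemma eigen_compact lam (phi : nat -> T -> R[i]) :
  (forall n, in_eigenspace A lam (phi n)) -> (forall n, n2 rho (phi n) = 1) ->
  exists (s : nat -> nat) v, [/\ {homo s : m n / (m < n)%N},
    in_eigenspace A lam v, n2 rho v = 1 & L2_cvg rho (phi \o s) v].
Proof.
move=> phiE phi1; case: cr => z resz cptz.
have pL n := eigen_L2 sa (phiE n).
pose a := lam%:C%C - z.
have [|||s [v [sh vL sv]]] := @resolvent_compact _ _ _ rho A sa z cptz
  (fun n x => a * phi n x) phi (cmod a ^+ 2).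
- by move=> n; exact: L2Z.
- by move=> n; rewrite n2Z// phi1 mulr1.
- by move=> n; apply: (op_ext (phiE n)) => // x; rewrite /a; ring.
exists s, v; split=> //.
- apply: (op_seq_closed sa (fun n => phiE (s n)) vL (L2Z _ vL) sv).
  have h1 := cvgM (cvg_cst (cmod lam%:C%C ^+ 2 : R) (F := \oo)) sv.
  rewrite /L2_cvg -(mulr0 (cmod lam%:C%C ^+ 2)).
  rewrite (_ : (fun n => _) = (fun n => cmod lam%:C%C ^+ 2 * n2 rho (fun x => phi (s n) x - v x))).
    exact: h1.
  apply/funext => n; rewrite -n2Z; last exact: L2B.
  by congr (n2 _ _); apply/funext => x; rewrite mulrBr.
- have := L2_cvg_n2 (fun n => pL (s n)) vL sv.
  under eq_fun do rewrite phi1.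
  by move/(cvg_unique (@norm_hausdorff _ _) (cvg_cst (1:R))).
Qed.

(** Since [F] refines [\oo], the eigenvalues still tend to infinity along it, so the limit is a
    local quantum limit. The inclusion is part of the conclusion so that bounds valid for large [n]
    can be passed to the integrals against [q]. *)
Lemma eigen_weak_limit (lam : nat -> R) (phi : nat -> T -> R[i]) :
  (forall n, in_eigenspace A (lam n) (phi n)) -> (forall n, n2 rho (phi n) = 1) ->
  lam @ \oo --> +oo ->
  exists (q : probability T R) (F : set_system nat), [/\ local_QL rho A q,
    ProperFilter F, \oo `<=` F & forall f : T -> R, continuous f ->
    wmass rho f (phi n) @[n --> F] --> \int[q]_x f x].
Proof.
move=> phiE phi1 lamoo.
have pL n := eigen_L2 sa (phiE n).
have [F [uF ooF]] := ultraFilterLemma (eventually_filter : ProperFilter \oo).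
have pF : ProperFilter F by exact: ultra_proper.
have [q qP] := @weak_limit_ultra _ _ _ bT hT cT rho (fun n x => cmod (phi n x) ^+ 2)
  (fun n x => cmod_sqr_ge0 _) (fun n => proj2 (proj1 (L2P _ _) (pL n)))
  (fun n => etrans (esym (n2E _ _)) (phi1 n)) F uF.
exists q, F; split=> // n f e Lam cf e0.
have near1 : \forall k \near F, Lam <= lam k.
  exact: (ooF _ (cvgry_ge lamoo Lam)).
have near2 : \forall k \near F, forall j : 'I_n,
    `| \int[rho]_x (f j x * cmod (phi k x) ^+ 2) - \int[q]_x f j x | < e.
  apply: filter_forall => j.
  have /cvgrPdist_lt/(_ e e0) := qP _ (cf j).
  by apply: filterS => k; rewrite distrC.
have [k [hk1 hk2]] := filter_ex (filterI near1 near2).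
exists (lam k), (phi k); split=> //.
by rewrite l2sqE// phi1.
Qed.
End eigenfunction_limits.

Lemma ge0_Rintegral_eq0 d (T : measurableType d) (R : realType)
    (mu : {measure set T -> \bar R}) (h : T -> R) :
  (forall x, 0 <= h x) -> mu.-integrable setT (EFin \o h) ->
  \int[mu]_x h x = 0 -> {ae mu, forall x, h x = 0}.
Proof.
move=> h0 ih ih0; have mh := measurable_int _ ih.
have : (\int[mu]_x `| (h x)%:E | = 0)%E.
  rewrite -[RHS]/(0%:E) -ih0 fineK; last exact: integrable_fin_num.
  by apply: eq_integral => x _; rewrite abse_EFin ger0_norm.
by move/(ae_eq_integral_abs mu measurableT mh); apply: filterS => x /(_ I)[].
Qed.

Section one_factor.
Context d (T : measTopType d) (R : realType).
Hypothesis bT : is_borel T.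
Hypothesis hT : hausdorff_space T.
Hypothesis cT : compact [set: T].
Hypothesis sT : @second_countable T.
Variable rho : probability T R.
Variable A : (T -> R[i]) -> (T -> R[i]) -> Prop.
Hypothesis sa : self_adjoint rho A.
Hypothesis cr : compact_resolvent rho A.
Variables (lam : nat -> R) (m : nat -> nat).
Hypothesis eig : eigenvalue_enumeration rho A lam m.

Lemma unit_eigen_index l phi : in_eigenspace A l phi -> n2 rho phi = 1 ->
  exists i, l = lam i.
Proof.
move=> phiE phi1; case: eig => _ _ h _; apply/h; exists phi => // phi0.
move: phi1; rewrite (n2_ae (eigen_L2 sa phiE) (L2_0 rho) phi0) [n2 _ _]rip0l => /esym/eqP.
by rewrite oner_eq0.
Qed.

(** Each value is some [lam (i n)]. Either one index recurs forever, or every index is visited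
    finitely often and the values leave each bounded range, which meets only finitely many
    [lam j]. *)
Lemma eigen_dichotomy (l : nat -> R) (phi : nat -> T -> R[i]) :
  (forall n, in_eigenspace A (l n) (phi n)) -> (forall n, n2 rho (phi n) = 1) ->
  l @ \oo --> +oo \/
  exists (s : nat -> nat) l0, {homo s : m n / (m < n)%N} /\ forall n, l (s n) = l0.
Proof.
move=> phiE phi1.
have /choice[i li] := fun n => unit_eigen_index (phiE n) (phi1 n).
have [[j jP]|jP] := pselect (exists j, forall N, exists n, (N <= n)%N /\ i n = j).
  right; have /choice[t tP] := jP.
  (* [t N] is an occurrence of the recurring index not before [N]; asking for one after [s k] makes
     [s] strictly increasing. *)
  pose s := fix s k := if k is k'.+1 then t (s k').+1 else t 0%N.
  exists s, (lam j); split.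
    apply: homo_ltn; first exact: ltn_trans.
    by move=> k /=; have [] := tP (s k).+1.
  by move=> [|k] /=; rewrite li; congr lam; [have [] := tP 0%N|have [] := tP (s k).+1].
left; case: eig => _ lamoo _ _; apply/cvgryPge => B.
have [J _ hJ] := cvgry_ge lamoo B.
have /choice[t tP] : forall j, exists N, forall n, (N <= n)%N -> i n <> j.
  move=> j; apply: contrapT => h; apply: jP; exists j => N.
  apply: contrapT => hN; apply: h; exists N => n Nn inj.
  by apply: hN; exists n.
exists (\max_(j < J) t j)%N => // n /= hn; rewrite li; apply: hJ => /=.
rewrite leqNgt; apply/negP => ij; apply: (tP (i n) n) => //.
by apply: leq_trans hn; exact: (@leq_bigmax _ (fun j : 'I_J => t j) (Ordinal ij)).
Qed.

Lemma eigen_normalize l phi : in_eigenspace A l phi -> 0 < n2 rho phi ->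
  exists psi, [/\ in_eigenspace A l psi, n2 rho psi = 1 &
    forall (h : T -> R) (M : R), measurable_fun setT h -> (forall x, `|h x| <= M) ->
      wmass rho h phi = n2 rho phi * wmass rho h psi].
Proof.
move=> phiE n0; have phiL := eigen_L2 sa phiE.
set r := (Num.sqrt (n2 rho phi))^-1.
have rr : cmod r%:C%C ^+ 2 = (n2 rho phi)^-1.
  by rewrite cmod_sqr /= expr0n addr0 exprVn sqr_sqrtr// ltW.
exists (fun x => r%:C%C * phi x); split; first exact: (eigenZ sa).
  by rewrite n2Z// rr mulVf// gt_eqF.
by move=> h M mh hM; rewrite (wmassZ _ mh hM)// rr mulrA divff ?mul1r// gt_eqF.
Qed.

Lemma unit_eigen_ex i : exists phi, in_eigenspace A (lam i) phi /\ n2 rho phi = 1.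
Proof.
case: eig => _ _ h _; have /h[phi phiE phi0] : exists j, lam i = lam j by exists i.
have [|psi [psiE psi1 _]] := eigen_normalize phiE; last by exists psi.
rewrite lt0r n2_ge0 andbT; apply/eqP => n0; apply: phi0.
exact: (n2_eq0 (eigen_L2 sa phiE)).
Qed.

Lemma full_support_integral_gt0 (q : probability T R) (f : T -> R) x0 :
  full_support q -> continuous f -> (forall x, 0 <= f x <= 1) -> 0 < f x0 ->
  0 < \int[q]_x f x.
Proof.
move=> fq cf f01 fx0; have mf := borel_continuous bT cf.
have f0 x : 0 <= f x by have /andP[] := f01 x.
have if_ : q.-integrable setT (EFin \o f).
  have i1 : q.-integrable setT (EFin \o cst 1%R) by exact: finite_measure_integrable_cst.
  have fn x : `|f x| <= 1 by rewrite ger0_norm//; have /andP[] := f01 x.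
  have := integrable_bdd_mul mf fn i1.
  by under eq_fun do rewrite mulr1.
rewrite lt0r Rintegral_ge0 ?andbT//; apply/eqP => /(ge0_Rintegral_eq0 f0 if_) h.
pose U := f @^-1` [set t | 0 < t].
have oU : open U by apply: open_comp => [x _|]; [exact: cf|exact: open_gt].
have mU := borel_open bT oU.
have /(_ oU) := fq U; move/(_ (ex_intro _ x0 fx0)).
have : q.-negligible U.
  by apply: negligibleS h => x /= Ux fx; move: Ux; rewrite /U /= fx ltxx.
by move/(negligibleP _ mU) => ->; rewrite ltxx.
Qed.

Lemma eigen_lower_bound (f : T -> R) x0 :
  unique_continuation rho A ->
  (forall q : probability T R, local_QL rho A q -> full_support q) ->
  continuous f -> (forall x, 0 <= f x <= 1) -> 0 < f x0 ->
  exists2 c, 0 < c & forall l phi, in_eigenspace A l phi ->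
    c * n2 rho phi <= wmass rho f phi.
Proof.
move=> uc fs cf f01 fx0; have mf := borel_continuous bT cf.
have f0 x : 0 <= f x by have /andP[] := f01 x.
have fn x : `|f x| <= 1 by rewrite ger0_norm//; have /andP[] := f01 x.
pose U := f @^-1` [set t : R | 0 < t].
(* Unique continuation will need positive measure, which is not assumed of open sets. If [rho U]
   were zero, no eigenfunction would charge [U], so [f] would have integral zero against a local
   quantum limit, contrary to full support. *)
have rhoU : (0 < rho U)%E.
  have oU : open U by apply: open_comp => [x _|]; [exact: cf|exact: open_gt].
  have mU := borel_open bT oU.
  rewrite lt0e measure_ge0 andbT; apply/eqP => U0.
  have /choice[phi phiP] := unit_eigen_ex.
  case: (eig) => _ lamoo _ _.
  have [q [F [qQL pF _ qF]]] := eigen_weak_limit bT hT cT sa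
    (fun n => proj1 (phiP n)) (fun n => proj2 (phiP n)) lamoo.
  have := full_support_integral_gt0 (fs q qQL) cf f01 fx0.
  suff -> : \int[q]_x f x = 0 by rewrite ltxx.
  apply: (cvg_unique (@norm_hausdorff _ _) (qF f cf)).
  rewrite (_ : (fun n => _) = cst 0); first exact: cvg_cst.
  apply/funext => n; rewrite /wmass /Rintegral.
  rewrite (ae_eq_integral (cst 0%E)) ?integral0//.
    exact: measurable_int (integrable_wmass mf fn (eigen_L2 sa (proj1 (phiP n)))).
  have /(negligibleP rho mU) := U0.
  apply: negligibleS => x /= h; rewrite /U /= lt0r f0 andbT; apply/eqP => fx; apply: h => _.
  by rewrite fx mul0r.
(* Otherwise each constant [1 / (n + 1)] fails on some eigenfunction, which homogeneity allows to
   normalize. *)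
apply: contrapT => hc.
have /choice[lp lpP] : forall n, exists lp : R * (T -> R[i]),
    [/\ in_eigenspace A lp.1 lp.2, n2 rho lp.2 = 1 & wmass rho f lp.2 < n.+1%:R^-1].
  move=> n; apply: contrapT => hn; apply: hc; exists n.+1%:R^-1; first by rewrite invr_gt0.
  move=> l phi phiE; rewrite leNgt; apply/negP => h.
  have n0 : 0 < n2 rho phi.
    rewrite lt0r n2_ge0 andbT; apply/eqP => n0; move: h; rewrite n0 mulr0 ltNge.
    by rewrite wmass_ge0.
  have [psi [psiE psi1 hw]] := eigen_normalize phiE n0.
  apply: hn; exists (l, psi); split=> //=.
  by move: h; rewrite (hw _ _ mf fn) mulrC ltr_pM2r.
have phiE n : in_eigenspace A (lp n).1 (lp n).2 by case: (lpP n).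
have phi1 n : n2 rho (lp n).2 = 1 by case: (lpP n).
have w0 : (fun n => wmass rho f (lp n).2) @ \oo --> 0.
  apply: (@squeeze_cvgr _ _ _ _ (cst 0) (fun n => n.+1%:R^-1)).
  - by apply: nearW => n; rewrite wmass_ge0//= ltW//; case: (lpP n).
  - exact: cvg_cst.
  - exact: cvg_harmonic.
have [loo|[s [l0 [sh sl]]]] := eigen_dichotomy phiE phi1.
  have [q [F [qQL pF ooF qF]]] := eigen_weak_limit bT hT cT sa phiE phi1 loo.
  have := full_support_integral_gt0 (fs q qQL) cf f01 fx0.
  suff -> : \int[q]_x f x = 0 by rewrite ltxx.
  apply: (cvg_unique (@norm_hausdorff _ _) (qF f cf)).
  by apply: cvg_trans w0; exact: cvg_app ooF.
have [||t [v [th vE v1 tv]]] := @eigen_compact _ _ _ rho A sa cr l0 (fun n => (lp (s n)).2).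
- by move=> n; rewrite -(sl n).
- by move=> n.
have vL := eigen_L2 sa vE.
have wv : wmass rho f v = 0.
  have h := wmass_cvg mf f01 (fun n => eigen_L2 sa (phiE (s (t n)))) vL tv.
  apply: (cvg_unique (@norm_hausdorff _ _) h).
  have := cvg_comp (fun n => s (t n)) (fun n => wmass rho f (lp n).2) _ w0; apply.
  have st : {homo (s \o t) : m n / (m < n)%N} by move=> a b ab; apply/sh/th.
  have ge_id k : (k <= s (t k))%N.
    by elim: k => // k /leq_ltn_trans; apply; exact: st.
  by move=> P [N _ hP]; exists N => // n /= Nn; apply: hP => /=; exact: leq_trans (ge_id n).
have wv0 := ge0_Rintegral_eq0 (fun x => mulr_ge0 (f0 x) (cmod_sqr_ge0 (v x)))
  (integrable_wmass mf fn vL) wv.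
have v0 : ae_eqc rho v (fun=> 0).
  apply: (uc l0 v vE _ _ rhoU).
    apply: borel_open => //.
    by apply: open_comp => [x _|]; [exact: cf|exact: open_gt].
  apply: filterS wv0 => x /eqP; rewrite mulf_eq0 => /orP[/eqP fx|/eqP/cmod_sqr_eq0//].
  by rewrite /U /= fx ltxx.
by move: v1; rewrite (n2_ae vL (L2_0 rho) v0) [n2 _ _]rip0l => /esym/eqP; rewrite oner_eq0.
Qed.

End one_factor.

Section one_factor_upper.
Context d (T : measTopType d) (R : realType).
Hypothesis bT : is_borel T.
Hypothesis hT : hausdorff_space T.
Hypothesis cT : compact [set: T].
Hypothesis sT : @second_countable T.
Variable rho : probability T R.
Variable A : (T -> R[i]) -> (T -> R[i]) -> Prop.
Hypothesis sa : self_adjoint rho A.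
Hypothesis cr : compact_resolvent rho A.
Variables (lam : nat -> R) (m : nat -> nat).
Hypothesis eig : eigenvalue_enumeration rho A lam m.

Lemma indic_norm_le1 (B : set T) x : `|\1_B x| <= 1 :> R.
Proof. by rewrite ger0_norm// indicE lern1 leq_b1. Qed.

Lemma eigen_upper_bound (K : set T) (e : R) :
  (forall q : probability T R, local_QL rho A q -> q `<< rho) ->
  closed K -> rho K = 0%E -> 0 < e ->
  exists O : set T, [/\ open O, K `<=` O & forall l phi, in_eigenspace A l phi ->
    wmass rho \1_O phi <= e * n2 rho phi].
Proof.
move=> ac cK K0 e0; have mK := borel_closed bT cK.
have [f [cf f01 fK1 fK0]] := @urysohn_seq _ R hT cT sT K cK.
have mf n := borel_continuous bT (cf n).
have f0 n x : 0 <= f n x by have /andP[] := f01 n x.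
have fn n x : `|f n x| <= 1 by rewrite ger0_norm//; have /andP[] := f01 n x.
(* At level [1/2] the indicator is at most [2 * f n]. Intersecting the first sets makes the bound
   hold with every [f j] for [j <= n]. *)
pose O' n := f n @^-1` [set t : R | 2^-1 < t].
have oO n : open (bigcapn O' n).
  by apply: open_bigcapn => k; apply: open_comp => [x _|]; [exact: cf|exact: open_gt].
have mO n := borel_open bT (oO n).
have mI n : measurable_fun setT (\1_(bigcapn O' n) : T -> R).
  exact: measurable_indic.
have KO n : K `<=` bigcapn O' n.
  move=> x Kx; apply/bigcapnP => k _; rewrite /O' /= fK1//.
  by rewrite invf_lt1// ltr1n.
have Of j n x : (j <= n)%N -> \1_(bigcapn O' n) x <= 2 * f j x.
  move=> jn; rewrite indicE; have [/set_mem/bigcapnP/(_ _ jn)|_] := boolP (x \in _).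
    by rewrite /O' /=; lra.
  by rewrite mulr_ge0.
apply: contrapT => hO.
have /choice[lp lpP] : forall n, exists lp : R * (T -> R[i]),
    [/\ in_eigenspace A lp.1 lp.2, n2 rho lp.2 = 1 &
        e < wmass rho \1_(bigcapn O' n) lp.2].
  move=> n; apply: contrapT => hn; apply: hO; exists (bigcapn O' n); split=> //.
  move=> l phi phiE; rewrite leNgt; apply/negP => h.
  have phiL := eigen_L2 sa phiE.
  have n0 : 0 < n2 rho phi.
    rewrite lt0r n2_ge0 andbT; apply/eqP => n0; move: h; rewrite n0 mulr0 ltNge => /negP; apply.
    rewrite -n0 n2E; apply: le_Rintegral => //.
    + exact: (integrable_wmass (mI n) (@indic_norm_le1 _) phiL).
    + by have /L2P[] := phiL.
    + by move=> x _; rewrite ler_piMl ?cmod_sqr_ge0// indicE lern1 leq_b1.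
  have [psi [psiE psi1 hw]] := eigen_normalize sa phiE n0.
  apply: hn; exists (l, psi); split=> //=.
  by move: h; rewrite (hw _ _ (mI n) (@indic_norm_le1 _)) mulrC ltr_pM2l.
have phiE n : in_eigenspace A (lp n).1 (lp n).2 by case: (lpP n).
have phi1 n : n2 rho (lp n).2 = 1 by case: (lpP n).
have phiL n := eigen_L2 sa (phiE n).
(* The index [j] stays fixed while [n] goes to infinity, so the continuous [f j] passes to the
   limit. Only then does [j] go to infinity, and the null set [K] gives [e / 2 <= 0]. *)
have low j n : (j <= n)%N -> e / 2 <= wmass rho (f j) (lp n).2.
  move=> jn; rewrite ler_pdivrMr// mulrC.
  have [_ _ /ltW h] := lpP n; apply: (le_trans h).
  rewrite -RintegralZl//; last exact: integrable_wmass (mf j) (fn j) (phiL n).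
  apply: le_Rintegral => //.
  - exact: (integrable_wmass (mI n) (@indic_norm_le1 _) (phiL n)).
  - exact/integrable_EFinZ/(integrable_wmass (mf j) (fn j) (phiL n)).
  - by move=> x _; rewrite mulrA ler_wpM2r ?cmod_sqr_ge0//; exact: Of.
have e20 : 0 < e / 2 by rewrite divr_gt0.
have [loo|[s [l0 [sh sl]]]] := eigen_dichotomy sa eig phiE phi1.
  have [q [F [qQL pF ooF qF]]] := eigen_weak_limit bT hT cT sa phiE phi1 loo.
  have qK : q K = 0%E by have /null_content_dominatesP/(_ _ mK) := ac q qQL; exact.
  have i1 : q.-integrable setT (EFin \o cst 1%R) by exact: finite_measure_integrable_cst.
  have h := wmass_cvg0 mK qK mf f01 fK0 i1.
  have : e / 2 <= 0.
    apply: (cvgr_to_ge h); apply: nearW => j.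
    rewrite (_ : \int[q]_x _ = \int[q]_x f j x); last first.
      by apply: eq_Rintegral => x _; rewrite mulr1.
    apply: (cvgr_to_ge (qF _ (cf j))); apply: ooF.
    by exists j => // n /=; exact: low.
  by rewrite leNgt e20.
have [||t [v [th vE v1 tv]]] := @eigen_compact _ _ _ rho A sa cr l0 (fun n => (lp (s n)).2).
- by move=> n; rewrite -(sl n).
- by move=> n.
have vL := eigen_L2 sa vE; have /L2P[_ iv] := vL.
have h := wmass_cvg0 mK K0 mf f01 fK0 iv.
have : e / 2 <= 0.
  apply: (cvgr_to_ge h); apply: nearW => j.
  have hj := wmass_cvg (mf j) (f01 j) (fun n => phiL (s (t n))) vL tv.
  apply: (cvgr_to_ge hj); exists j => // n /= jn; apply: low; apply: (leq_trans jn).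
  have st : {homo (s \o t) : m n / (m < n)%N} by move=> a b ab; apply/sh/th.
  by elim: n {jn} => // k /leq_ltn_trans; apply; exact: st.
by rewrite leNgt e20.
Qed.

End one_factor_upper.

(** * Tensor sums *)

Section tensor_product.
Context d1 d2 (T1 : measurableType d1) (T2 : measurableType d2) (R : realType).
Variables (mu1 : probability T1 R) (mu2 : probability T2 R).
Local Notation P := (mu1 \x mu2)%E.
Implicit Types (e u : T1 -> R[i]) (v w : T2 -> R[i]) (f g : T1 * T2 -> R[i]).

Definition tens e v (p : T1 * T2) : R[i] := e p.1 * v p.2.

Lemma cmeas_fst e : cmeas e -> cmeas (fun p : T1 * T2 => e p.1).
Proof.
move=> [m1 m2]; split.
- exact: (measurableT_comp m1 measurable_fst).
- exact: (measurableT_comp m2 measurable_fst).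
Qed.

Lemma cmeas_snd v : cmeas v -> cmeas (fun p : T1 * T2 => v p.2).
Proof.
move=> [m1 m2]; split.
- exact: (measurableT_comp m1 measurable_snd).
- exact: (measurableT_comp m2 measurable_snd).
Qed.

Lemma cmeas_slice1 f y : cmeas f -> cmeas (fun x => f (x, y)).
Proof.
move=> [m1 m2]; split.
- exact: (measurableT_comp m1 (@pair2_measurable _ _ T1 T2 y)).
- exact: (measurableT_comp m2 (@pair2_measurable _ _ T1 T2 y)).
Qed.

Lemma measurable_cmod_sqrE d (T : measurableType d) (f : T -> R[i]) : cmeas f ->
  measurable_fun setT (fun p => (cmod (f p) ^+ 2)%:E).
Proof. by move=> mf; exact/measurable_EFinP/cmeas_cmod_sqr. Qed.

Lemma l2sq_slices f : cmeas f ->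
  l2sq P f = (\int[mu2]_y l2sq mu1 (fun x => f (x, y)))%E.
Proof.
move=> mf; rewrite /l2sq fubini_tonelli2//; first exact: measurable_cmod_sqrE.
by move=> p; rewrite lee_fin cmod_sqr_ge0.
Qed.

Lemma measurable_l2sq_slices f : cmeas f ->
  measurable_fun setT (fun y => l2sq mu1 (fun x => f (x, y))).
Proof.
move=> mf; apply: (measurable_fun_fubini_tonelli_G (fun p => (cmod (f p) ^+ 2)%:E)).
  exact: measurable_cmod_sqrE.
by move=> p; rewrite lee_fin cmod_sqr_ge0.
Qed.

Lemma l2sq_ge0 d (T : measurableType d) (mu : {measure set T -> \bar R}) (f : T -> R[i]) :
  (0 <= l2sq mu f)%E.
Proof. by apply: integral_ge0 => x _; rewrite lee_fin cmod_sqr_ge0. Qed.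

Lemma L2_tens e v : L2 mu1 e -> L2 mu2 v -> L2 P (tens e v).
Proof.
move=> eL vL; have me := L2_cmeas eL; have mv := L2_cmeas vL.
have mev : cmeas (tens e v) by apply: cmeasM; [exact: cmeas_fst|exact: cmeas_snd].
case: (mev) => m1 m2; split=> //; rewrite l2sq_slices//.
rewrite (_ : (fun y => _) = fun y => ((n2 mu1 e)%:E * (cmod (v y) ^+ 2)%:E)%E).
  rewrite ge0_integralZl//.
  - by rewrite -[X in (_ * X)%E]/(l2sq mu2 v) l2sqE// -EFinM ltry.
  - exact: measurable_cmod_sqrE.
  - by move=> y _; rewrite lee_fin cmod_sqr_ge0.
  - by rewrite lee_fin n2_ge0.
apply/funext => y; rewrite -EFinM -[RHS]/((_ * _)%:E) mulrC -n2Z// -l2sqE; last exact: L2Z.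
by apply: eq_integral => x _; rewrite /tens /= mulrC.
Qed.

Lemma ae_L2_slices f : L2 P f -> {ae mu2, forall y, L2 mu1 (fun x => f (x, y))}.
Proof.
move=> fL; have mf := L2_cmeas fL; case: fL => _ _; rewrite l2sq_slices// => foo.
have : mu2.-integrable setT (fun y => l2sq mu1 (fun x => f (x, y))).
  apply/integrableP; split; first exact: measurable_l2sq_slices.
  by under eq_integral do rewrite gee0_abs ?l2sq_ge0//.
move=> /(integrable_ae measurableT); apply: filterS => y /(_ I).
rewrite ge0_fin_numE ?l2sq_ge0// => lt.
by have [m1 m2] := cmeas_slice1 y mf; split.
Qed.

Lemma ae_slices (Q : T1 * T2 -> Prop) : {ae P, forall p, Q p} ->
  {ae mu2, forall y, {ae mu1, forall x, Q (x, y)}}.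
Proof.
move=> [N [mN N0 QN]].
have m1N : measurable_fun setT (fun p => (\1_N p)%:E : \bar R).
  exact/measurable_EFinP/measurable_indic.
have N0' p : (0 <= (\1_N p)%:E :> \bar R)%E by rewrite lee_fin.
have : (\int[P]_p (\1_N p)%:E = 0)%E by rewrite integral_indic// setIT.
rewrite fubini_tonelli2// => h.
have mG := measurable_fun_fubini_tonelli_G (m1 := mu1) _ m1N N0'.
have G0 y : (0 <= fubini_G mu1 (fun p => (\1_N p)%:E) y)%E by apply: integral_ge0.
have : (\int[mu2]_y `|fubini_G mu1 (fun p => (\1_N p)%:E) y| = 0)%E.
  by under eq_integral do rewrite gee0_abs//.
move/(ae_eq_integral_abs mu2 measurableT mG); apply: filterS => y /(_ I) /= Gy.
have mN1 : measurable_fun setT (fun x => (\1_N (x, y))%:E : \bar R).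
  exact: (measurableT_comp m1N (@pair2_measurable _ _ T1 T2 y)).
have : (\int[mu1]_x `|(\1_N (x, y))%:E| = 0)%E.
  by rewrite -[RHS]Gy; apply: eq_integral => x _; rewrite gee0_abs.
move/(ae_eq_integral_abs mu1 measurableT mN1); apply: filterS => x /(_ I) /= [].
rewrite indicE => xN; apply: contrapT => nQ; have := QN _ nQ.
by move/mem_set => h'; move: xN; rewrite h' => /eqP; rewrite oner_eq0.
Qed.

Lemma ae_slices_eq0 f : L2 P f ->
  {ae mu2, forall y, ae_eqc mu1 (fun x => f (x, y)) (fun=> 0)} ->
  ae_eqc P f (fun=> 0).
Proof.
move=> fL h; apply: n2_eq0 => //; apply: EFin_inj; rewrite -l2sqE//.
have mf := L2_cmeas fL; rewrite l2sq_slices//.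
rewrite (ae_eq_integral (cst 0%E)) ?integral0//; first exact: measurable_l2sq_slices.
have L2s := ae_L2_slices fL.
apply: filterS2 L2s h => y yL y0 _.
by rewrite l2sqE// (n2_ae yL (L2_0 mu1) y0) [n2 _ _]rip0l.
Qed.

Definition slice_inner e f y : R[i] := inner mu1 (fun x => f (x, y)) e.

Lemma slice_innerE e f y : slice_inner e f y =
  (rip mu1 (fun x => f (x, y)) e +i* rip mu1 (fun x => f (x, y)) (fun x => 'i%C * e x))%C.
Proof. exact: inner_rip. Qed.

Lemma measurable_slice_rip e f : L2 mu1 e -> L2 P f ->
  measurable_fun setT (fun y => rip mu1 (fun x => f (x, y)) e).
Proof.
(* The partial scalar product is the inner Fubini integral of the pairing of [f] with [e] extended
   by [1], which is square-integrable because [mu2] is finite. *)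
move=> eL fL; have e1L : L2 P (tens e (fun=> 1)).
  apply: L2_tens => //; split; [exact: measurable_cst|exact: measurable_cst|].
  rewrite /l2sq; under eq_integral do rewrite cmod_sqr /= expr1n expr0n addr0.
  by rewrite integral_cst// mul1e (le_lt_trans (probability_le1 _ _))// ltry.
have := measurable_fubini_G (integrable_rip fL e1L).
move/(measurableT_comp (fine_measurable measurableT)); congr measurable_fun.
apply/funext => y; congr fine; apply: eq_integral => x _ /=.
by rewrite /rip_fun /tens /= mulr1.
Qed.

Lemma L2_slice_inner e f : L2 mu1 e -> L2 P f -> L2 mu2 (slice_inner e f).
Proof.
move=> eL fL; have mf := L2_cmeas fL; have ieL := L2Z 'i%C eL.
have ms1 := measurable_slice_rip eL fL.
have ms2 := measurable_slice_rip ieL fL.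
have ms : cmeas (slice_inner e f) by split; under eq_fun do rewrite slice_innerE.
case: (ms) => m1 m2; split=> //.
(* Cauchy-Schwarz is applied separately to the real and imaginary parts, hence the factor [2]. *)
apply: (@le_lt_trans _ _ (\int[mu2]_y ((2 * n2 mu1 e)%:E * l2sq mu1 (fun x => f (x, y))))%E).
  apply: ae_ge0_le_integral => //.
  - by move=> y _; rewrite lee_fin cmod_sqr_ge0.
  - exact: measurable_cmod_sqrE.
  - by move=> y _; rewrite mule_ge0 ?l2sq_ge0// lee_fin mulr_ge0// n2_ge0.
  - by apply: emeasurable_funM; [exact: measurable_cst|exact: measurable_l2sq_slices].
  - have L2s := ae_L2_slices fL; apply: filterS L2s => y yL _.
    rewrite l2sqE// -EFinM lee_fin slice_innerE cmod_sqr /=.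
    have := cauchy_schwarz yL eL; have := cauchy_schwarz yL ieL.
    by rewrite n2Z// cmod_sqr /= expr0n expr1n add0r mul1r; lra.
rewrite ge0_integralZl//.
- by rewrite -l2sq_slices// l2sqE// -EFinM ltry.
- exact: measurable_l2sq_slices.
- by move=> y _; exact: l2sq_ge0.
- by rewrite lee_fin mulr_ge0// n2_ge0.
Qed.

(** By Fubini, [slice_inner e] is the adjoint of [w |-> tens e w]. Pairings on the product thereby
    become statements about a single function on the second factor. *)
Lemma rip_tens e w f : L2 mu1 e -> L2 mu2 w -> L2 P f ->
  rip P (tens e w) f = rip mu2 w (slice_inner e f).
Proof.
move=> eL wL fL; have ewL := L2_tens eL wL.
have i1 := integrable_rip ewL fL.
have ieL := L2Z 'i%C eL.
have psiL := L2_slice_inner eL fL.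
rewrite /rip /Rintegral; congr fine; rewrite -[LHS]integral21_prod_meas1//.
apply: ae_eq_integral => //.
- exact: measurable_fubini_G i1.
- exact/measurable_EFinP/(cmeas_rip_fun (L2_cmeas wL) (L2_cmeas psiL)).
have L2s := ae_L2_slices fL; apply: filterS L2s => y yL _.
have j1 := integrable_rip yL eL; have j2 := integrable_rip yL ieL.
rewrite /rip_fun slice_innerE /=.
rewrite -!RintegralZl// -RintegralD//; try exact: integrable_EFinZ.
rewrite /Rintegral fineK.
  apply: eq_integral => x _ /=; congr EFin; rewrite /rip_fun /tens /=.
  by case: (e x) (w y) (f (x, y)) => [a b] [a1 b1] [a2 b2] /=; ring.
apply: integrable_fin_num => //.
by apply: integrable_EFinD; exact: integrable_EFinZ.
Qed.

Lemma innerZl (c : R[i]) u e : L2 mu1 u -> L2 mu1 e ->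
  inner mu1 (fun x => c * u x) e = c * inner mu1 u e.
Proof.
move=> uL eL; have ieL := L2Z 'i%C eL.
rewrite !inner_rip (ripZl c uL eL) (ripZl c uL ieL) (rip_il uL eL).
rewrite (rip_conj _ 'i%C u (fun x => 'i%C * e x)).
have -> : (fun x => conjc 'i%C * ('i%C * e x)) = e.
  apply/funext => x; rewrite mulrA; case: (e x) => a b /=.
  by apply/eqP; rewrite eq_complex /=; apply/andP; split; apply/eqP; ring.
case: c => a b /=; apply/eqP; rewrite eq_complex /=; apply/andP.
by split; apply/eqP; ring.
Qed.

Lemma slice_inner_tens e u v : L2 mu1 u -> L2 mu1 e ->
  slice_inner e (tens u v) = (fun y => inner mu1 u e * v y).
Proof.
move=> uL eL; apply/funext => y; rewrite mulrC -innerZl//.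
by congr (inner _ _ _); apply/funext => x; rewrite /tens /= mulrC.
Qed.
End tensor_product.

Section rip_extra.
Context d (T : measurableType d) (R : realType).
Variable mu : {measure set T -> \bar R}.

Lemma ripZr_real (r : R) (f g : T -> R[i]) : L2 mu f -> L2 mu g ->
  rip mu f (fun x => r%:C%C * g x) = r * rip mu f g.
Proof. by move=> fL gL; rewrite ripC (ripZl r%:C%C gL fL) /= mul0r addr0 ripC. Qed.

Lemma rip_sumr n (f : T -> R[i]) (g : 'I_n -> T -> R[i]) : L2 mu f ->
  (forall k, L2 mu (g k)) ->
  rip mu f (fun x => \sum_(k < n) g k x) = \sum_(k < n) rip mu f (g k).
Proof.
move=> fL; elim: n g => [|n IH] g gL.
  under [X in rip _ _ X]eq_fun do rewrite big_ord0.
  by rewrite rip0r big_ord0.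
under [X in rip _ _ X]eq_fun do rewrite big_ord_recl.
rewrite ripC (ripDl (gL _) (L2_sum _ (fun i => gL (lift ord0 i))) fL).
by rewrite ripC [X in _ + X]ripC IH// big_ord_recl.
Qed.

End rip_extra.

(** * The tensor sum tested against products *)

Section tensor_operator.
Context d1 d2 (T1 : measurableType d1) (T2 : measurableType d2) (R : realType).
Variables (mu1 : probability T1 R) (mu2 : probability T2 R).
Local Notation P := (mu1 \x mu2)%E.
Variable A1 : (T1 -> R[i]) -> (T1 -> R[i]) -> Prop.
Variable A2 : (T2 -> R[i]) -> (T2 -> R[i]) -> Prop.
Hypothesis sa1 : self_adjoint mu1 A1.
Hypothesis sa2 : self_adjoint mu2 A2.

Lemma inner_eigen l e u w : in_eigenspace A1 l e -> A1 u w ->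
  inner mu1 w e = l%:C%C * inner mu1 u e.
Proof.
move=> eE uw; have eL := eigen_L2 sa1 eE; have uL := dom_L2 sa1 uw.
have ieL := L2Z 'i%C eL.
rewrite !inner_rip (op_sym sa1 uw eE) (ripZr_real l uL eL).
rewrite (op_sym sa1 uw (eigenZ sa1 'i%C eE)) (ripZr_real l uL ieL).
by apply/eqP; rewrite eq_complex /=; apply/andP; split; apply/eqP; ring.
Qed.

(** Symmetry moves both operators onto the test function [tens e x]: the first becomes the scalar
    [l], the second turns [x] into [y]. Only scalar products with [f] and [g] remain, so the
    identity is stable under L2 limits. *)
Lemma alg_tensor_sum_weak l e x y f g : in_eigenspace A1 l e -> A2 x y ->
  alg_tensor_sum A1 A2 f g ->
  [/\ L2 P f, L2 P g &
    rip P (tens e y) f + l * rip P (tens e x) f = rip P (tens e x) g].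
Proof.
move=> eE xy [n [u [w [v [z [uw vz /funext fE /funext gE]]]]]].
have eL := eigen_L2 sa1 eE; have xL := dom_L2 sa2 xy; have yL := im_L2 sa2 xy.
have uL k := dom_L2 sa1 (uw k); have wL k := im_L2 sa1 (uw k).
have vL k := dom_L2 sa2 (vz k); have zL k := im_L2 sa2 (vz k).
have fL k := L2_tens (uL k) (vL k).
have gL k : L2 P (fun p => tens (w k) (v k) p + tens (u k) (z k) p).
  by apply: L2D; exact: L2_tens.
have exL := L2_tens eL xL; have eyL := L2_tens eL yL.
have -> : f = fun p => \sum_(k < n) tens (u k) (v k) p by [].
have -> : g = fun p => \sum_(k < n) (tens (w k) (v k) p + tens (u k) (z k) p) by [].
split; [exact: L2_sum|exact: L2_sum|].
rewrite (rip_sumr eyL fL) (rip_sumr exL fL) (rip_sumr exL gL) mulr_sumr -big_split /=.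
apply: eq_bigr => k _.
have kvL := L2Z (inner mu1 (u k) e) (vL k).
rewrite ripC [in RHS]ripC (ripDl (L2_tens (wL k) (vL k)) (L2_tens (uL k) (zL k)) exL).
rewrite ripC ![in RHS](ripC _ _ (tens e x)).
rewrite (rip_tens eL yL (fL k)) (rip_tens eL xL (fL k)).
rewrite (rip_tens eL xL (L2_tens (wL k) (vL k))) (rip_tens eL xL (L2_tens (uL k) (zL k))).
rewrite !slice_inner_tens// (inner_eigen eE (uw k)).
have -> : (fun y0 => l%:C%C * inner mu1 (u k) e * v k y0) =
    (fun y0 => l%:C%C * (inner mu1 (u k) e * v k y0)).
  by apply/funext => t; rewrite mulrA.
rewrite (ripZr_real l xL kvL) addrC; congr (_ + _).
exact: (op_sym sa2 xy (opZ sa2 _ (vz k))).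
Qed.

(** In the limit, the weak identity says that the partial inner product satisfies the eigenvalue
    equation against every domain vector of [A2]; self-adjointness of [A2], through [op_closed],
    places it in the domain. *)
Lemma tensor_sum_slice l mu e phi :
  in_eigenspace (tensor_sum mu1 mu2 A1 A2) l phi -> in_eigenspace A1 mu e ->
  in_eigenspace A2 (l - mu) (slice_inner mu1 e phi).
Proof.
move=> [phiL lphiL happ] eE; have eL := eigen_L2 sa1 eE.
have psiL := L2_slice_inner eL phiL.
apply: (op_closed sa2) => //; first exact: L2Z.
move=> x y xy; have xL := dom_L2 sa2 xy; have yL := im_L2 sa2 xy.
rewrite (ripZr_real _ xL psiL) -(rip_tens eL yL phiL) -(rip_tens eL xL phiL).
have /choice[fg fgP] : forall n, exists fg : (T1 * T2 -> R[i]) * (T1 * T2 -> R[i]),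
    [/\ alg_tensor_sum A1 A2 fg.1 fg.2,
      (l2sq P (fun p => (phi p - fg.1 p)%R) < (n.+1%:R^-1)%:E)%E &
      (l2sq P (fun p => (l%:C%C * phi p - fg.2 p)%R) < (n.+1%:R^-1)%:E)%E].
  move=> n; have n0 : 0 < n.+1%:R^-1 :> R by rewrite invr_gt0.
  by have [f' [g' [? ? ?]]] := happ _ n0; exists (f', g').
have fgw n := alg_tensor_sum_weak eE xy (let: And3 h _ _ := fgP n in h).
have fL n : L2 P (fg n).1 by case: (fgw n).
have gL n : L2 P (fg n).2 by case: (fgw n).
have fcv : L2_cvg P (fun n => (fg n).1) phi.
  apply: (@squeeze_cvgr _ _ _ _ (cst 0) (fun n => n.+1%:R^-1)); last 2 first.
  - exact: cvg_cst.
  - exact: cvg_harmonic.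
  apply: nearW => n; rewrite n2_ge0/= n2BC -lee_fin -l2sqE; last exact: L2B.
  by case: (fgP n) => _ /ltW.
have gcv : L2_cvg P (fun n => (fg n).2) (fun p => l%:C%C * phi p).
  apply: (@squeeze_cvgr _ _ _ _ (cst 0) (fun n => n.+1%:R^-1)); last 2 first.
  - exact: cvg_cst.
  - exact: cvg_harmonic.
  apply: nearW => n; rewrite n2_ge0/= n2BC -lee_fin -l2sqE; last exact: L2B.
  by case: (fgP n) => _ _ /ltW.
have exL := L2_tens eL xL; have eyL := L2_tens eL yL.
have c1 := L2_cvg_rip fL phiL eyL fcv.
have c2 := L2_cvg_rip fL phiL exL fcv.
have c3 := L2_cvg_rip gL lphiL exL gcv.
have c4 := cvgM (cvg_cst (mu : R) (F := \oo)) c2.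
have c5 := cvgD c1 (c4 _ _).
have : rip P phi (tens e y) + mu * rip P phi (tens e x) =
    rip P (fun p => l%:C%C * phi p) (tens e x).
  have c6 : (fun n => rip P (fg n).1 (tens e y) + mu * rip P (fg n).1 (tens e x)) @ \oo -->
    rip P phi (tens e y) + mu * rip P phi (tens e x) by exact: c5.
  apply: (cvg_unique (@norm_hausdorff _ _) c6).
  rewrite (_ : (fun n => _) = (fun n => rip P (fg n).2 (tens e x)))//.
  apply/funext => n; have [_ _ h] := fgw n.
  by rewrite [RHS]ripC -h ripC (ripC _ (tens e x)).
rewrite [RHS]ripC (ripZr_real l exL phiL) (ripC _ phi) (ripC _ phi) => h.
by rewrite mulrBl; lra.
Qed.

End tensor_operator.

Section eigen_basis.
Context d (T : measurableType d) (R : realType).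
Variable mu : {measure set T -> \bar R}.
Variable A : (T -> R[i]) -> (T -> R[i]) -> Prop.

(** The point is countability: orthogonality to all eigenvectors becomes countably many conditions,
    which can hold together almost everywhere. *)
Lemma eigen_orth_basis (lam : nat -> R) (m : nat -> nat) : self_adjoint mu A ->
  eigenvalue_enumeration mu A lam m ->
  exists e : nat -> nat -> T -> R[i], (forall i k, in_eigenspace A (lam i) (e i k)) /\
    forall f, L2 mu f -> (forall i k, inner mu f (e i k) = 0) -> eigen_orth mu A f.
Proof.
move=> sa [_ _ lamE mE].
have /choice[e eP] : forall i, exists e : nat -> T -> R[i],
    (forall k, in_eigenspace A (lam i) (e k)) /\
    forall phi, in_eigenspace A (lam i) phi -> exists c : nat -> R[i],
      ae_eqc mu phi (fun x => \sum_(k < m i) c k * e k x).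
  move=> i; have [_ [e [eE _ eS]]] := mE i.
  (* Indices from [m i] on are padded with the zero function. *)
  exists (fun k => if insub k is Some k' then e k' else fun=> 0); split.
    by move=> k; case: insubP => [? _ _|_]; [exact: eE|exact: (eigen0 sa)].
  move=> phi /eS[c phic]; exists (fun k => if insub k is Some k' then c k' else 0).
  by apply: filterS phic => x ->; apply: eq_bigr => k _; rewrite valK.
exists e; split=> [i k|f fL fe]; first by have [] := eP i.
split=> // l phi phiE; have phiL := eigen_L2 sa phiE.
have [phi0|phi0] := pselect (ae_eqc mu phi (fun=> 0)).
  by rewrite ripC (rip_ae phiL (L2_0 mu) fL phi0) rip0l.
have /lamE[i li] : Defs.eigenvalue mu A l by exists phi.
rewrite li in phiE; have [eE /(_ _ phiE)[c phic]] := eP i.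
have eL k := eigen_L2 sa (eE k).
have cL (k : 'I_(m i)) : L2 mu (fun x => c k * e i k x) by exact: L2Z.
rewrite ripC (rip_ae phiL (L2_sum _ cL) fL phic) ripC (rip_sumr fL cL) big1// => k _.
rewrite ripC (ripZl _ (eL k) fL); have := fe i k; rewrite inner_rip => -[h1 h2].
by rewrite (ripC _ (e i k)) h1 (ripC _ (fun x => 'i%C * e i k x)) h2 !mulr0 addr0.
Qed.
End eigen_basis.

(** A free family of [N] vectors in dimension [N] is a basis. It is indexed by any finite type so
    that pairs of indices can be used directly. *)
Lemma free_spanning (F : fieldType) (I : finType) (N : nat) (C : I -> 'I_N -> F) :
  #|I| = N ->
  (forall a : I -> F, (forall j, \sum_i a i * C i j = 0) -> forall i, a i = 0) ->
  forall dd : 'I_N -> F, exists a : I -> F, forall j, dd j = \sum_i a i * C i j.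
Proof.
move=> IN; subst N => free dd.
pose M := \matrix_(q < #|I|, j < #|I|) C (enum_val q) j.
have sumE (a : 'rV[F]_#|I|) j : (a *m M) 0 j = \sum_i a 0 (enum_rank i) * C i j.
  rewrite mxE [RHS](reindex (@enum_val I predT)) /=; last first.
    by apply: onW_bij; exact: enum_val_bij.
  by apply: eq_bigr => q _; rewrite mxE enum_valK.
have uM : M \in unitmx.
  rewrite -row_free_unit; apply: inj_row_free => w wM.
  apply/rowP => q; rewrite mxE -(enum_valK q).
  apply: (free (fun i => w 0 (enum_rank i))) => j.
  by rewrite -sumE wM mxE.
exists (fun i => ((\row_j dd j) *m invmx M) 0 (enum_rank i)) => j.
by rewrite -sumE mulmxKV// mxE.
Qed.

Section tensor_spectrum.
Context d1 d2 (T1 : measurableType d1) (T2 : measurableType d2) (R : realType).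
Variables (mu1 : probability T1 R) (mu2 : probability T2 R).
Local Notation P := (mu1 \x mu2)%E.
Variable A1 : (T1 -> R[i]) -> (T1 -> R[i]) -> Prop.
Variable A2 : (T2 -> R[i]) -> (T2 -> R[i]) -> Prop.
Hypothesis sa1 : self_adjoint mu1 A1.
Hypothesis sa2 : self_adjoint mu2 A2.
Hypothesis cr1 : compact_resolvent mu1 A1.
Variables (lam1 lam2 : nat -> R) (m1 m2 : nat -> nat).
Hypothesis eig1 : eigenvalue_enumeration mu1 A1 lam1 m1.
Hypothesis eig2 : eigenvalue_enumeration mu2 A2 lam2 m2.

Lemma tensor_sum_eigenvalue l phi :
  in_eigenspace (tensor_sum mu1 mu2 A1 A2) l phi -> ~ ae_eqc P phi (fun=> 0) ->
  exists i j, l = lam1 i + lam2 j.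
Proof.
move=> phiE phi0; apply: contrapT => hl; apply: phi0.
have [phiL _ _] := phiE.
have [e [eE eO]] := eigen_orth_basis sa1 eig1.
have psi0 i k : ae_eqc mu2 (slice_inner mu1 (e i k) phi) (fun=> 0).
  apply: contrapT => h; apply: hl.
  have psiE := tensor_sum_slice sa1 sa2 phiE (eE i k).
  have [_ _ lamE _] := eig2.
  have /lamE[j lj] : Defs.eigenvalue mu2 A2 (l - lam1 i) by eexists; [exact: psiE|].
  by exists i, j; rewrite -lj addrC subrK.
apply: ae_slices_eq0 => //.
have L2s := ae_L2_slices phiL.
(* A single null set of [y] serves for the whole countable family. *)
have all0 : {ae mu2, forall y, forall i k, slice_inner mu1 (e i k) phi y = 0}.
  by apply: ae_foralln => i; apply: ae_foralln => k; exact: psi0.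
case: cr1 => z resz cptz.
by apply: filterS2 L2s all0 => y yL h; apply: (eigen_complete sa1 resz cptz); exact: eO.
Qed.

Lemma tens_eigen l1 l2 e v : in_eigenspace A1 l1 e -> in_eigenspace A2 l2 v ->
  in_eigenspace (tensor_sum mu1 mu2 A1 A2) (l1 + l2) (tens e v).
Proof.
move=> eE vE; have evL := L2_tens (eigen_L2 sa1 eE) (eigen_L2 sa2 vE).
split=> //; first exact: L2Z.
move=> eps eps0; exists (tens e v), (fun p => (l1 + l2)%:C%C * tens e v p); split.
- exists 1%N, (fun _ => e), (fun _ x => l1%:C%C * e x), (fun _ => v),
    (fun _ y => l2%:C%C * v y); split=> // p; rewrite big_ord1//.
  by rewrite /tens rmorphD; ring.
- have -> : (fun p : T1 * T2 => tens e v p - tens e v p) = fun=> 0.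
    by apply/funext => p; rewrite subrr.
  by rewrite l2sqE ?[n2 _ _]rip0l ?lte_fin//; exact: L2_0.
- have -> : (fun p : T1 * T2 => (l1 + l2)%:C%C * tens e v p -
      (l1 + l2)%:C%C * tens e v p) = fun=> 0.
    by apply/funext => p; rewrite subrr.
  by rewrite l2sqE ?[n2 _ _]rip0l ?lte_fin//; exact: L2_0.
Qed.

(** For almost every [y] the relation is one between the [e k], with coefficients depending on [y];
    their vanishing is in turn a relation between the [v l]. *)
Lemma tens_free n1 n2 (e : 'I_n1 -> T1 -> R[i]) (v : 'I_n2 -> T2 -> R[i])
    (c : 'I_n1 -> 'I_n2 -> R[i]) :
  (forall a : 'I_n1 -> R[i], ae_eqc mu1 (fun x => \sum_k a k * e k x) (fun=> 0) ->
     forall k, a k = 0) ->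
  (forall a : 'I_n2 -> R[i], ae_eqc mu2 (fun x => \sum_k a k * v k x) (fun=> 0) ->
     forall k, a k = 0) ->
  ae_eqc P (fun p => \sum_k \sum_l c k l * tens (e k) (v l) p) (fun=> 0) ->
  forall k l, c k l = 0.
Proof.
move=> eF vF /ae_slices h k; apply: vF.
apply: filterS h => y h; apply: (eF (fun k => \sum_l c k l * v l y)).
apply: filterS h => x hx; apply: etrans hx; apply: eq_bigr => k' _; rewrite mulr_suml.
by apply: eq_bigr => l _; rewrite /tens /=; ring.
Qed.

Lemma tensor_eigenspace l1 l2 n1 n2 phi :
  multiplicity mu1 A1 l1 n1 -> multiplicity mu2 A2 l2 n2 ->
  multiplicity P (tensor_sum mu1 mu2 A1 A2) (l1 + l2) (n1 * n2)%N ->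
  in_eigenspace (tensor_sum mu1 mu2 A1 A2) (l1 + l2) phi ->
  exists (e : 'I_n1 -> T1 -> R[i]) (v : 'I_n2 -> T2 -> R[i]) (c : 'I_n1 -> 'I_n2 -> R[i]),
    [/\ forall k, in_eigenspace A1 l1 (e k), forall k, in_eigenspace A2 l2 (v k) &
      ae_eqc P phi (fun p => \sum_k \sum_l c k l * tens (e k) (v l) p)].
Proof.
move=> [e [eE eF _]] [v [vE vF _]] [b [_ _ bS]] phiE.
have /choice[C CP] : forall q : 'I_n1 * 'I_n2, exists a : 'I_(n1 * n2) -> R[i],
    ae_eqc P (tens (e q.1) (v q.2)) (fun p => \sum_j a j * b j p).
  by move=> q; apply: bS; exact: tens_eigen.
have CP' : {ae P, forall p, forall q, tens (e q.1) (v q.2) p = \sum_j C q j * b j p}.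
  exact: filter_forall.
have [dd phid] := bS _ phiE.
(* The rows of [C] are coordinates of the products in the family [b], whose size is the number of
   products. A relation between rows would be one between products, which [tens_free] excludes. *)
have [||a aP] := @free_spanning _ _ _ C _ _ dd.
- by rewrite card_prod !card_ord.
- move=> a a0 [k l]; apply: (tens_free (c := fun k l => a (k, l)) eF vF).
  apply: filterS CP' => p hp.
  rewrite pair_bigA /= (eq_bigr (fun q => \sum_j a q * C q j * b j p)); last first.
    move=> [k' l'] _ /=; rewrite (hp (k', l')) mulr_sumr.
    by apply: eq_bigr => j _; rewrite mulrA.
  rewrite exchange_big big1//= => j _.
  by rewrite -mulr_suml a0 mul0r.
exists e, v, (fun k l => a (k, l)); split=> //.
apply: filterS2 phid CP' => p -> hp.
rewrite pair_bigA /= [RHS](eq_bigr (fun q => \sum_j a q * C q j * b j p)); last first.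
  move=> [k' l'] _ /=; rewrite (hp (k', l')) mulr_sumr.
  by apply: eq_bigr => j _; rewrite mulrA.
by rewrite exchange_big /=; apply: eq_bigr => j _; rewrite aP mulr_suml.
Qed.

End tensor_spectrum.

(** * Product spaces *)

Section product_topology.
Context (T1 T2 : topologicalType).

Lemma nbhs_setX (x : T1) (y : T2) (A : set T1) (B : set T2) :
  nbhs x A -> nbhs y B -> nbhs (x, y) (A `*` B).
Proof. by exists (A, B). Qed.

Lemma hausdorff_prod : hausdorff_space T1 -> hausdorff_space T2 ->
  hausdorff_space (T1 * T2)%type.
Proof.
move=> h1 h2 [x y] [x' y'] cl; congr (_, _).
  apply: h1 => A B Ax Bx'.
  have [[a b] [/= [? _] [? _]]] :=
    cl _ _ (nbhs_setX Ax (@filterT _ (nbhs y) _)) (nbhs_setX Bx' (@filterT _ (nbhs y') _)).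
  by exists a.
apply: h2 => A B Ay By'.
have [[a b] [/= [_ ?] [_ ?]]] :=
  cl _ _ (nbhs_setX (@filterT _ (nbhs x) _) Ay) (nbhs_setX (@filterT _ (nbhs x') _) By').
by exists b.
Qed.

Lemma compact_prod : compact [set: T1] -> compact [set: T2] ->
  compact [set: T1 * T2].
Proof. by move=> c1 c2; rewrite -setXTT; exact: compact_setX. Qed.

Lemma open_setX (U : set T1) (V : set T2) : open U -> open V -> open (U `*` V).
Proof.
move=> oU oV; rewrite openE => -[x y] [Ux Vy].
by apply: nbhs_setX; exact: open_nbhs_nbhs.
Qed.

Lemma second_countable_prod : @second_countable T1 -> @second_countable T2 ->
  @second_countable (T1 * T2)%type.
Proof.
move=> [B1 c1 [ho1 b1]] [B2 c2 [ho2 b2]].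
exists ((fun UV : set T1 * set T2 => UV.1 `*` UV.2) @` (B1 `*` B2)).
  by apply: card_le_trans (card_image_le _ _) _; exact: countableX.
split.
  by move=> _ [[U V] [BU BV] <-]; apply: open_setX; [exact: ho1|exact: ho2].
move=> [x y] N [[N1 N2] [Nx Ny] NN].
have [U [BU Ux] UN] := b1 x _ Nx; have [V [BV Vy] VN] := b2 y _ Ny.
exists (U `*` V); first by split=> //; exists (U, V).
by move=> [a b] [Ua Vb]; apply: NN; split; [exact: UN|exact: VN].
Qed.

End product_topology.

Lemma borel_preimage d (X : measTopType d) (Y : topologicalType) (f : Y -> X) :
  is_borel X -> continuous f -> forall A, measurable A ->
  <<s [set U : set Y | open U] >> (f @^-1` A).
Proof.
move=> bX cf A mA.
pose C := [set B | <<s [set U : set Y | open U] >> (f @^-1` B)].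
suff : C A by [].
move/bX : mA; apply; split.
  split.
  - by rewrite /C /= preimage_set0; exact: sigma_algebra0.
  - move=> B mB; rewrite /C /= setTD preimage_setC -setTD; exact: sigma_algebraCD.
  - move=> F mF; rewrite /C /= preimage_bigcup; exact: sigma_algebra_bigcup.
by move=> U oU; apply: sub_sigma_algebra; apply: open_comp => // x _; exact: cf.
Qed.

Lemma bigcup_measurable_countable d (T : measurableType d) (U : Type) (I : set U)
    (F : U -> set T) : countable I -> (forall i, I i -> measurable (F i)) ->
  measurable (\bigcup_(i in I) F i).
Proof.
move=> /countable_injP[code codeI] mF.
have -> : \bigcup_(i in I) F i =
    \bigcup_n \bigcup_(i in [set i | I i /\ code i = n]) F i.
  apply/seteqP; split=> [x [i Ii Fx]|x [n _ [i [Ii _] Fx]]].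
    by exists (code i) => //; exists i.
  by exists i.
apply: bigcup_measurable => n _.
have [[i [Ii ci]]|h] := pselect (exists i, I i /\ code i = n).
  rewrite (_ : \bigcup_(_ in _) _ = F i); first exact: mF.
  apply/seteqP; split=> [x [j [Ij cj] Fx]|x Fx]; last by exists i.
  by have <- : j = i by apply: codeI; rewrite ?inE// cj ci.
rewrite (_ : \bigcup_(_ in _) _ = set0); first exact: measurable0.
by rewrite -subset0 => x [j [Ij cj] _]; apply: h; exists j.
Qed.

Lemma borel_prod d1 d2 (T1 : measTopType d1) (T2 : measTopType d2) :
  is_borel T1 -> is_borel T2 -> @second_countable T1 -> @second_countable T2 ->
  is_borel (T1 * T2)%type.
Proof.
move=> bT1 bT2 [B1 c1 [ho1 b1]] [B2 c2 [ho2 b2]] A; split.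
  rewrite measurable_prod_measurableType; apply: smallest_sub.
    exact: smallest_sigma_algebra.
  move=> _ [U mU [V mV <-]].
  have -> : U `*` V = (fst @^-1` U) `&` (snd @^-1` V) by [].
  rewrite -[X in <<s _ >> X]setCK setCI.
  have mC (B : set (T1 * T2)) : <<s [set U : set (T1 * T2) | open U] >> B ->
      <<s [set U : set (T1 * T2) | open U] >> (~` B).
    by move=> mB; rewrite -setTD; exact: sigma_algebraCD.
  suff h : <<s [set U : set (T1 * T2) | open U] >> (~` (fst @^-1` U) `|` ~` (snd @^-1` V)).
    exact: mC h.
  rewrite -bigcup2E; apply: sigma_algebra_bigcup => -[|[|n]] /=.
  - by apply: (mC (fst @^-1` U)); apply: (borel_preimage bT1 _ mU) => x; exact: cvg_fst.
  - by apply: (mC (snd @^-1` V)); apply: (borel_preimage bT2 _ mV) => x; exact: cvg_snd.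
  - exact: sigma_algebra0.
apply: smallest_sub; first exact: sigma_algebra_measurable.
move=> W oW.
(* Second countability writes an open set as a countable union of basic rectangles, each measurable
   for the product sigma-algebra. *)
pose I := [set UV : set T1 * set T2 | [/\ B1 UV.1, B2 UV.2 & UV.1 `*` UV.2 `<=` W]].
have cI : countable I.
  apply: (@sub_countable _ _ _ (B1 `*` B2)); last exact: countableX.
  by apply: subset_card_le => -[U V] [].
have -> : W = \bigcup_(UV in I) (UV.1 `*` UV.2).
  apply/seteqP; split=> [[x y] Wxy|p [UV [_ _ h] /h]//].
  move: oW; rewrite openE => /(_ _ Wxy) [[N1 N2] [Nx Ny] NN].
  have [U [BU Ux] UN] := b1 x _ Nx; have [V [BV Vy] VN] := b2 y _ Ny.
  exists (U, V) => //; split=> //= -[a b] [Ua Vb].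
  by apply: NN; split; [exact: UN|exact: VN].
apply: bigcup_measurable_countable => // -[U V] [BU BV _] /=.
by apply: measurableX; apply: borel_open => //; [exact: ho1|exact: ho2].
Qed.

Lemma ereal_cvg_lt (R : realType) (u : nat -> \bar R) (l y : \bar R) :
  (u @ \oo --> l -> l < y -> exists n, u n < y)%E.
Proof.
move=> ul ly.
have /ul[N _ hN] : nbhs l [set z | (z < y)%E].
  by apply: open_nbhs_nbhs; split=> //; exact: open_ereal_lt_ereal.
by exists N; apply: (hN N) => /=.
Qed.

(** * Inner regularity of Borel probabilities *)

Section regularity.
Context d (T : measTopType d) (R : realType).
Hypothesis bT : is_borel T.
Hypothesis hT : hausdorff_space T.
Hypothesis cT : compact [set: T].
Hypothesis sT : @second_countable T.
Variable q : probability T R.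
Local Open Scope ereal_scope.

(** The two-sided form is stable under complement, unlike inner regularity alone, and so defines a
    sigma-algebra. *)
Let regular (A : set T) := forall e : R, (0 < e)%R -> exists K U : set T,
  [/\ closed K, open U, K `<=` A, A `<=` U & q (U `\` K) <= e%:E].

Let regular_closed (A : set T) : closed A -> regular A.
Proof.
move=> cA e e0; have [V [oV AV Vx]] := closed_Gdelta hT cT sT cA.
have mA := borel_closed bT cA.
pose W n := bigcapn V n `\` A.
have oVn n : open (bigcapn V n) by exact: open_bigcapn.
have mW n : measurable (W n) by apply: measurableD => //; exact: borel_open.
have cW : q (W n) @[n --> \oo] --> q (\bigcap_n W n).
  apply: nonincreasing_cvg_mu => //.
  - by rewrite (le_lt_trans (probability_le1 _ _))// ltry.
  - exact: bigcap_measurable.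
  - move=> m n mn; apply/subsetPset => x [/bigcapnP h nAx]; split=> //.
    by apply/bigcapnP => k km; apply: h; exact: leq_trans mn.
have W0 : \bigcap_n W n = set0.
  rewrite -subset0 => x Wx; have [_ nAx] := Wx 0%N I.
  have [N hN] := Vx _ nAx; have [/bigcapnP h _] := Wx N I.
  by apply: (hN N) => //; exact: h.
rewrite W0 measure0 in cW.
have [n qn] : exists n, q (W n) <= e%:E.
  have [|n /ltW ?] := ereal_cvg_lt cW (y := e%:E); last by exists n.
  by rewrite lte_fin.
exists A, (bigcapn V n); split=> //.
by move=> x Ax; apply/bigcapnP => k _; exact: AV.
Qed.

Let regular_setC (A : set T) : regular A -> regular (~` A).
Proof.
move=> rA e /rA[K [U [cK oU KA AU qUK]]]; exists (~` U), (~` K); split.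
- exact: open_closedC.
- exact: closed_openC.
- exact: subsetC.
- exact: subsetC.
- by rewrite setDE setCK setIC -setDE.
Qed.

Let regular_bigcup (F : nat -> set T) : (forall n, regular (F n)) ->
  regular (\bigcup_n F n).
Proof.
move=> rF e e0; have e20 : (0 < e / 2)%R by rewrite divr_gt0.
have /choice[KU KUP] : forall n, exists KU : set T * set T,
    [/\ closed KU.1, open KU.2, KU.1 `<=` F n, F n `<=` KU.2 &
      q (KU.2 `\` KU.1) <= (e / 2 / (2 ^ n.+1)%:R)%:E].
  move=> n; have [|K [U h]] := rF n (e / 2 / (2 ^ n.+1)%:R)%R; last by exists (K, U).
  by rewrite divr_gt0// ltr0n expn_gt0.
pose K n := (KU n).1; pose U n := (KU n).2.
have cK n : closed (K n) by case: (KUP n).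
have oU n : open (U n) by case: (KUP n).
have KF n : K n `<=` F n by case: (KUP n).
have FU n : F n `<=` U n by case: (KUP n).
have mK n := borel_closed bT (cK n).
have mU n := borel_open bT (oU n).
(* A countable union of closed sets need not be closed, so it is truncated. The sets [U n] minus
   [K n] use up [e / 2] in total, which leaves room for the truncation. *)
pose L n := \bigcup_(k in `I_n) K k.
have cL n : closed (L n) by apply: closed_bigcup => //; exact: finite_II.
have mL n := borel_closed bT (cL n).
pose UU := \bigcup_n U n.
have oUU : open UU by exact: bigcup_open.
have mUU := borel_open bT oUU.
have cUL : q (UU `\` L n) @[n --> \oo] --> q (\bigcap_n (UU `\` L n)).
  apply: nonincreasing_cvg_mu => //.
  - exact: (le_lt_trans (probability_le1 q (measurableD mUU (mL 0%N))) (ltry _)).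
  - by move=> n; exact: measurableD.
  - by apply: bigcap_measurable => // n _; exact: measurableD.
  - move=> m n mn; apply/subsetPset => x [Ux nL]; split=> // -[k km Kx].
    by apply: nL; exists k => //=; exact: leq_trans mn.
have qlim : q (\bigcap_n (UU `\` L n)) <= (e / 2)%:E.
  apply: (@le_trans _ _ (\sum_(n <oo) q (U n `\` K n))).
    apply: (@le_trans _ _ (q (\bigcup_n (U n `\` K n)))).
      apply: le_measure; rewrite ?inE.
      + by apply: bigcap_measurable => // n _; exact: measurableD.
      + by apply: bigcup_measurable => n _; exact: measurableD.
      + move=> x Lx; have [[n _ Unx] _] := Lx 0%N I; exists n => //; split=> // Knx.
        by have [_] := Lx n.+1 I; apply; exists n => /=.
    apply: measure_sigma_subadditive => //.
    - by move=> n; exact: measurableD.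
    - by apply: bigcup_measurable => n _; exact: measurableD.
  apply: (@le_trans _ _ (\sum_(n <oo) (e / 2 / (2 ^ n.+1)%:R)%:E)).
    by apply: lee_nneseries => // n _; case: (KUP n).
  by have := @epsilon_trick0 R (e / 2) xpredT (ltW e20).
have [n qn] : exists n, q (UU `\` L n) <= e%:E.
  have [|n /ltW ?] := ereal_cvg_lt cUL (y := e%:E); last by exists n.
  by apply: (le_lt_trans qlim); rewrite lte_fin ltr_pdivrMr// ltr_pMr// ltr1n.
exists (L n), UU; split=> //.
- by move=> x [k _ Kx]; exists k => //; exact: KF.
- by move=> x [k _ Fx]; exists k => //; exact: FU.
Qed.

Lemma inner_regular (A : set T) (e : R) : measurable A -> (0 < e)%R ->
  exists K, [/\ closed K, K `<=` A & q (A `\` K) <= e%:E].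
Proof.
move=> mA e0.
have rA : regular A.
  move/bT : (mA); apply; split.
    split.
    - by apply: regular_closed; exact: closed0.
    - by move=> B rB; rewrite setTD; exact: regular_setC.
    - exact: regular_bigcup.
  move=> U oU /=; rewrite -[X in regular X]setCK; apply: regular_setC.
  by apply: regular_closed; exact: open_closedC.
have [K [U [cK oU KA AU qUK]]] := rA e e0; exists K; split=> //.
apply: le_trans qUK; apply: le_measure; rewrite ?inE.
- by apply: measurableD => //; exact: borel_closed.
- by apply: measurableD; [exact: borel_open|exact: borel_closed].
- exact: setSD.
Qed.

End regularity.

(** * Local quantum limits of the product *)

Section product_mass.
Context d1 d2 (T1 : measurableType d1) (T2 : measurableType d2) (R : realType).
Variables (mu1 : probability T1 R) (mu2 : probability T2 R).
Local Notation P := (mu1 \x mu2)%E.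
Implicit Types (f : T1 * T2 -> R[i]) (w : T1 * T2 -> R).

Lemma wmassE d (T : measurableType d) (mu : {measure set T -> \bar R})
    (w : T -> R) (f : T -> R[i]) : measurable_fun setT w ->
  (forall x, 0 <= w x <= 1) -> L2 mu f ->
  (wmass mu w f)%:E = (\int[mu]_x (w x * cmod (f x) ^+ 2)%:E)%E.
Proof.
move=> mw w01 fL; rewrite /wmass /Rintegral fineK//; apply: integrable_fin_num => //.
apply: (integrable_wmass mw (M := 1)) fL => x.
by have /andP[h0 h1] := w01 x; rewrite ger0_norm.
Qed.

Lemma measurable_wmass_fun d (T : measurableType d) (w : T -> R) (f : T -> R[i]) :
  measurable_fun setT w -> cmeas f ->
  measurable_fun setT (fun x => (w x * cmod (f x) ^+ 2)%:E).
Proof.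
move=> mw mf; apply/measurable_EFinP; apply: measurable_funM => //.
exact: cmeas_cmod_sqr.
Qed.

Lemma wmass_prod_le2 f w w' (a b : R) : L2 P f ->
  (forall y, L2 mu1 (fun x => f (x, y))) ->
  measurable_fun setT w -> measurable_fun setT w' ->
  (forall p, 0 <= w p <= 1) -> (forall p, 0 <= w' p <= 1) -> 0 <= a -> 0 <= b ->
  (forall y, a * wmass mu1 (fun x => w (x, y)) (fun x => f (x, y)) <=
             b * wmass mu1 (fun x => w' (x, y)) (fun x => f (x, y))) ->
  a * wmass P w f <= b * wmass P w' f.
Proof.
move=> fL sL mw mw' w01 w'01 a0 b0 h; have mf := L2_cmeas fL.
have slice (v : T1 * T2 -> R) : measurable_fun setT v -> (forall p, 0 <= v p <= 1) ->
    [/\ forall p, (0 <= (v p * cmod (f p) ^+ 2)%:E)%E,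
      forall y, fubini_G mu1 (fun p => (v p * cmod (f p) ^+ 2)%:E) y =
        (wmass mu1 (fun x => v (x, y)) (fun x => f (x, y)))%:E,
      measurable_fun setT (fubini_G mu1 (fun p => (v p * cmod (f p) ^+ 2)%:E)) &
      (wmass P v f)%:E = (\int[mu2]_y fubini_G mu1 (fun p => (v p * cmod (f p) ^+ 2)%:E) y)%E].
  move=> mv v01.
  have v0 p : (0 <= (v p * cmod (f p) ^+ 2)%:E)%E.
    by rewrite lee_fin mulr_ge0 ?cmod_sqr_ge0//; have /andP[] := v01 p.
  have mvf := measurable_wmass_fun mv mf.
  split=> //.
  - move=> y; rewrite wmassE//.
    exact: (measurableT_comp mv (@pair2_measurable _ _ T1 T2 y)).
  - exact: measurable_fun_fubini_tonelli_G.
  - by rewrite wmassE// fubini_tonelli2.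
have [v0 vs mv ve] := slice w mw w01; have [v0' vs' mv' ve'] := slice w' mw' w'01.
rewrite -lee_fin !EFinM ve ve'.
rewrite -!ge0_integralZl ?lee_fin//; try by move=> y _; exact: integral_ge0.
apply: ge0_le_integral => //.
- by move=> y _; rewrite mule_ge0 ?lee_fin//; exact: integral_ge0.
- by apply: emeasurable_funM => //; exact: measurable_cst.
- by apply: emeasurable_funM => //; exact: measurable_cst.
- by move=> y _; rewrite vs vs' -!EFinM lee_fin.
Qed.

Lemma wmass_prod_le1 f w w' (a b : R) : L2 P f ->
  (forall x, L2 mu2 (fun y => f (x, y))) ->
  measurable_fun setT w -> measurable_fun setT w' ->
  (forall p, 0 <= w p <= 1) -> (forall p, 0 <= w' p <= 1) -> 0 <= a -> 0 <= b ->
  (forall x, a * wmass mu2 (fun y => w (x, y)) (fun y => f (x, y)) <=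
             b * wmass mu2 (fun y => w' (x, y)) (fun y => f (x, y))) ->
  a * wmass P w f <= b * wmass P w' f.
Proof.
move=> fL sL mw mw' w01 w'01 a0 b0 h; have mf := L2_cmeas fL.
have slice (v : T1 * T2 -> R) : measurable_fun setT v -> (forall p, 0 <= v p <= 1) ->
    [/\ forall p, (0 <= (v p * cmod (f p) ^+ 2)%:E)%E,
      forall x, fubini_F mu2 (fun p => (v p * cmod (f p) ^+ 2)%:E) x =
        (wmass mu2 (fun y => v (x, y)) (fun y => f (x, y)))%:E,
      measurable_fun setT (fubini_F mu2 (fun p => (v p * cmod (f p) ^+ 2)%:E)) &
      (wmass P v f)%:E = (\int[mu1]_x fubini_F mu2 (fun p => (v p * cmod (f p) ^+ 2)%:E) x)%E].
  move=> mv v01.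
  have v0 p : (0 <= (v p * cmod (f p) ^+ 2)%:E)%E.
    by rewrite lee_fin mulr_ge0 ?cmod_sqr_ge0//; have /andP[] := v01 p.
  have mvf := measurable_wmass_fun mv mf.
  split=> //.
  - move=> x; rewrite wmassE//.
    exact: (measurableT_comp mv (@pair1_measurable _ _ T1 T2 x)).
  - exact: measurable_fun_fubini_tonelli_F.
  - by rewrite wmassE// fubini_tonelli1.
have [v0 vs mv ve] := slice w mw w01; have [v0' vs' mv' ve'] := slice w' mw' w'01.
rewrite -lee_fin !EFinM ve ve'.
rewrite -!ge0_integralZl ?lee_fin//; try by move=> x _; exact: integral_ge0.
apply: ge0_le_integral => //.
- by move=> x _; rewrite mule_ge0 ?lee_fin//; exact: integral_ge0.
- by apply: emeasurable_funM => //; exact: measurable_cst.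
- by apply: emeasurable_funM => //; exact: measurable_cst.
- by move=> x _; rewrite vs vs' -!EFinM lee_fin.
Qed.

Lemma wmass1 d (T : measurableType d) (mu : {measure set T -> \bar R}) (f : T -> R[i]) :
  wmass mu (fun=> 1) f = n2 mu f.
Proof. by rewrite n2E; apply: eq_Rintegral => x _; rewrite mul1r. Qed.

Lemma wmass_cst d (T : measurableType d) (mu : {measure set T -> \bar R}) (c : R)
    (f : T -> R[i]) : L2 mu f -> wmass mu (fun=> c) f = c * n2 mu f.
Proof. by move=> /L2P[_ if_]; rewrite n2E -RintegralZl. Qed.

Lemma wmass_ae d (T : measurableType d) (mu : {measure set T -> \bar R})
    (w : T -> R) (f g : T -> R[i]) : measurable_fun setT w -> cmeas f -> cmeas g ->
  ae_eqc mu f g -> wmass mu w f = wmass mu w g.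
Proof.
move=> mw mf mg fg; congr fine; apply: ae_eq_integral => //.
- exact: measurable_wmass_fun.
- exact: measurable_wmass_fun.
- by apply: filterS fg => x -> _.
Qed.

Lemma le_wmass d (T : measurableType d) (mu : {measure set T -> \bar R})
    (w w' : T -> R) (f : T -> R[i]) : measurable_fun setT w -> measurable_fun setT w' ->
  (forall x, 0 <= w x <= 1) -> (forall x, 0 <= w' x <= 1) ->
  (forall x, w x <= w' x) -> L2 mu f -> wmass mu w f <= wmass mu w' f.
Proof.
move=> mw mw' w01 w'01 ww' fL.
have bnd (v : T -> R) : (forall x, 0 <= v x <= 1) -> forall x, `|v x| <= 1.
  by move=> v01 x; have /andP[h0 h1] := v01 x; rewrite ger0_norm.
apply: le_Rintegral => //.
- exact: integrable_wmass mw (bnd w w01) fL.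
- exact: integrable_wmass mw' (bnd w' w'01) fL.
- by move=> x _; rewrite ler_wpM2r ?cmod_sqr_ge0.
Qed.

End product_mass.

Section tensor_sum_product.
Context d1 d2 (T1 : measTopType d1) (T2 : measTopType d2) (R : realType).
Hypothesis bT1 : is_borel T1.
Hypothesis hT1 : hausdorff_space T1.
Hypothesis cT1 : compact [set: T1].
Hypothesis sT1 : @second_countable T1.
Hypothesis bT2 : is_borel T2.
Hypothesis hT2 : hausdorff_space T2.
Hypothesis cT2 : compact [set: T2].
Hypothesis sT2 : @second_countable T2.
Variables (mu1 : probability T1 R) (mu2 : probability T2 R).
Local Notation P := (mu1 \x mu2)%E.
Variable A1 : (T1 -> R[i]) -> (T1 -> R[i]) -> Prop.
Variable A2 : (T2 -> R[i]) -> (T2 -> R[i]) -> Prop.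
Hypothesis sa1 : self_adjoint mu1 A1.
Hypothesis sa2 : self_adjoint mu2 A2.
Hypothesis cr1 : compact_resolvent mu1 A1.
Hypothesis cr2 : compact_resolvent mu2 A2.
Variables (lam1 lam2 : nat -> R) (m1 m2 : nat -> nat) (m : nat -> nat -> nat).
Hypothesis eig1 : eigenvalue_enumeration mu1 A1 lam1 m1.
Hypothesis eig2 : eigenvalue_enumeration mu2 A2 lam2 m2.
Hypothesis mult : forall i j, multiplicity P
            (tensor_sum mu1 mu2 A1 A2) (lam1 i + lam2 j) (m i j).
Hypothesis mm : forall i j, m i j = (m1 i * m2 j)%N.

(* Counting dimensions with the multiplicity hypothesis, an eigenfunction of the
   tensor sum is a finite sum of products, so each of its slices is an
   eigenfunction of a factor. *)
Lemma tensor_sum_unit_eigen l phi :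
  in_eigenspace (tensor_sum mu1 mu2 A1 A2) l phi -> l2sq P phi = 1%E ->
  exists f l1 l2, [/\ L2 P f, n2 P f = 1, ae_eqc P phi f,
    forall y, in_eigenspace A1 l1 (fun x => f (x, y)) &
    forall x, in_eigenspace A2 l2 (fun y => f (x, y))].
Proof.
move=> phiE phi1; have [phiL _ _] := phiE.
have n1 : n2 P phi = 1 by apply: EFin_inj; rewrite -l2sqE.
have phi0 : ~ ae_eqc P phi (fun=> 0).
  move=> h; move: n1; rewrite (n2_ae phiL (L2_0 P) h) [n2 _ _]rip0l => /esym/eqP.
  by rewrite oner_eq0.
have [i [j lij]] := tensor_sum_eigenvalue sa1 sa2 cr1 eig1 eig2 phiE phi0.
rewrite lij in phiE.
have [_ _ _ /(_ i)[_ mi]] := eig1; have [_ _ _ /(_ j)[_ mj]] := eig2.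
have := mult i j; rewrite mm => mij.
have [e [v [c [eE vE phic]]]] := tensor_eigenspace sa1 sa2 mi mj mij phiE.
pose f p := \sum_k \sum_l0 c k l0 * tens (e k) (v l0) p.
have fL : L2 P f.
  apply: L2_sum => k; apply: L2_sum => l0; apply: L2Z.
  by apply: L2_tens; [exact: (eigen_L2 sa1)|exact: (eigen_L2 sa2)].
exists f, (lam1 i), (lam2 j); split=> //.
- by rewrite -(n2_ae phiL fL phic).
- move=> y.
  have := eigen_sum sa1 (index_enum _) (fun k => \sum_l0 c k l0 * v l0 y) eE.
  congr in_eigenspace; apply/funext => x; apply: eq_bigr => k _.
  by rewrite mulr_suml; apply: eq_bigr => l0 _; rewrite /tens /=; ring.
- move=> x.
  have := eigen_sum sa2 (index_enum _) (fun l0 => \sum_k c k l0 * e k x) vE.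
  congr in_eigenspace; apply/funext => y; rewrite /f exchange_big /=.
  apply: eq_bigr => l0 _.
  by rewrite mulr_suml; apply: eq_bigr => k _; rewrite /tens /=; ring.
Qed.

Let bT : is_borel (T1 * T2)%type. Proof. exact: borel_prod. Qed.
Let hT : hausdorff_space (T1 * T2)%type. Proof. exact: hausdorff_prod. Qed.
Let cT : compact [set: T1 * T2]. Proof. exact: compact_prod. Qed.
Let sT : @second_countable (T1 * T2)%type. Proof. exact: second_countable_prod. Qed.

Lemma tensor_sum_QL (q : probability (T1 * T2)%type R) (f : T1 * T2 -> R) (e : R) :
  local_QL P (tensor_sum mu1 mu2 A1 A2) q -> continuous f -> 0 < e ->
  exists g l1 l2, [/\ L2 P g, n2 P g = 1,
    `|wmass P f g - \int[q]_x f x| < e,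
    forall y, in_eigenspace A1 l1 (fun x => g (x, y)) &
    forall x, in_eigenspace A2 l2 (fun y => g (x, y))].
Proof.
move=> qQL cf e0.
(* Any threshold will do, here [0], since the bounds on slices hold at every eigenvalue. *)
have [l [phi [_ phiE phi1 h]]] := qQL 1%N (fun _ => f) e 0 (fun _ => cf) e0.
have [g [l1 [l2 [gL g1 phig s1 s2]]]] := tensor_sum_unit_eigen phiE phi1.
exists g, l1, l2; split=> //.
rewrite -(wmass_ae (borel_continuous bT cf) _ (L2_cmeas gL) phig); first exact: (h ord0).
by have [/L2_cmeas] := phiE.
Qed.

Lemma tensor_sum_full_support (q : probability (T1 * T2)%type R) :
  unique_continuation mu1 A1 -> unique_continuation mu2 A2 ->
  (forall q : probability T1 R, local_QL mu1 A1 q -> full_support q) ->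
  (forall q : probability T2 R, local_QL mu2 A2 q -> full_support q) ->
  local_QL P (tensor_sum mu1 mu2 A1 A2) q -> full_support q.
Proof.
move=> uc1 uc2 fs1 fs2 qQL U oU [[x0 y0] Uxy].
have mU := borel_open bT oU.
move: (oU); rewrite openE => /(_ _ Uxy)[[N1 N2] [/= Nx Ny] NN].
have [f1 [cf1 f101 f1x f10]] := urysohn_point R hT1 cT1 Nx.
have [f2 [cf2 f201 f2y f20]] := urysohn_point R hT2 cT2 Ny.
have [|c1 c10 h1] := eigen_lower_bound bT1 hT1 cT1 sa1 cr1 eig1 uc1 fs1 cf1 f101 (x0 := x0).
  by rewrite f1x.
have [|c2 c20 h2] := eigen_lower_bound bT2 hT2 cT2 sa2 cr2 eig2 uc2 fs2 cf2 f201 (x0 := y0).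
  by rewrite f2y.
pose f (p : T1 * T2) := f1 p.1 * f2 p.2.
have cf : continuous f.
  move=> p; apply: cvgM; apply: continuous_comp; by
    [exact: cvg_fst|exact: cvg_snd|exact: cf1|exact: cf2].
have f01 p : 0 <= f p <= 1.
  have /andP[a0 a1] := f101 p.1; have /andP[b0 b1] := f201 p.2.
  by rewrite /f mulr_ge0//= mulr_ile1.
have mf2 : measurable_fun setT (fun p : T1 * T2 => f2 p.2).
  by apply: measurableT_comp => //; exact: borel_continuous.
have mf := borel_continuous bT cf.
have mf1 := borel_continuous bT1 cf1.
have f1n x : `|f1 x| <= 1 by have /andP[a0 a1] := f101 x; rewrite ger0_norm.
(* The mass of [f] under [g] will be at least [c1 * c2], so an error below [c1 * c2] keeps the
   integral against [q] positive. *)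
have [g [l1 [l2 [gL g1 gq s1 s2]]]] := tensor_sum_QL qQL cf (mulr_gt0 c10 c20).
(* For fixed [y] the factor [f2 y] is constant and comes out, leaving the bound for [f1] on a slice;
   [low2] then treats [f2] on the slices in the other direction. *)
have low1 : c1 * wmass P (fun p => f2 p.2) g <= 1 * wmass P f g.
  apply: wmass_prod_le2 => //; try exact: ltW.
    by move=> y; exact: (eigen_L2 sa1 (s1 y)).
  move=> y; have sL := eigen_L2 sa1 (s1 y).
  have f2y0 : 0 <= f2 y by have /andP[] := f201 y.
  rewrite [X in _ * X <= _](_ : _ = f2 y * n2 mu1 (fun x => g (x, y))); last first.
    exact (wmass_cst (f2 y) sL).
  rewrite mul1r mulrCA.
  have -> : wmass mu1 (fun x => f (x, y)) (fun x => g (x, y)) =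
      f2 y * wmass mu1 f1 (fun x => g (x, y)).
    rewrite /wmass -RintegralZl//; last exact: integrable_wmass mf1 f1n sL.
    by apply: eq_Rintegral => x _; rewrite /f /=; ring.
  by rewrite ler_wpM2l// (h1 _ _ (s1 y)).
have low2 : c2 * wmass P (fun=> 1) g <= 1 * wmass P (fun p => f2 p.2) g.
  apply: wmass_prod_le1 => //; try exact: ltW.
  - by move=> x; exact: (eigen_L2 sa2 (s2 x)).
  - by move=> p; rewrite ler01 lexx.
  - by move=> x; rewrite mul1r wmass1; exact: (h2 _ _ (s2 x)).
rewrite mul1r in low1; rewrite mul1r wmass1 g1 mulr1 in low2.
have qf : 0 < \int[q]_x f x.
  move: gq; rewrite ltr_norml => /andP[_]; rewrite ltrBlDl => gq.
  have : c1 * c2 <= wmass P f g.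
    by apply: le_trans low1; rewrite ler_wpM2l// ltW.
  by lra.
rewrite lt0e measure_ge0 andbT; apply/eqP => qU0.
move: qf; suff -> : \int[q]_x f x = 0 by rewrite ltxx.
rewrite /Rintegral (ae_eq_integral (cst 0%E)) ?integral0//; first exact/measurable_EFinP.
have /(negligibleP _ mU) := qU0; apply: negligibleS => p /= h; apply: contrapT => nUp.
apply: h => _; congr EFin; rewrite /f.
have [N1p|/f10 ->] := pselect (N1 p.1); last by rewrite mul0r.
have [N2p|/f20 ->] := pselect (N2 p.2); last by rewrite mulr0.
by case: nUp; apply: NN.
Qed.

(* The slice of K over almost every y lies in an open set O y of small mass, and by
   compactness this persists for y' in a closed neighbourhood C y. The exceptional
   y form a closed null set, covered by an open V2 of small mass; finitely many
   C s cover the rest. Since the C s may overlap, the union of the O s * C s could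
   have a large mass: U instead asks x to lie in O s for all s such that y is in
   C s, which is open and has a slice contained in a single O s. *)
Lemma tensor_sum_closed_null (e : R) (K : set (T1 * T2)) :
  (forall q : probability T1 R, local_QL mu1 A1 q -> q `<< mu1) ->
  (forall q : probability T2 R, local_QL mu2 A2 q -> q `<< mu2) ->
  closed K -> P K = 0%E -> 0 < e ->
  exists U, [/\ open U, K `<=` U & forall g l1 l2, L2 P g ->
    (forall y, in_eigenspace A1 l1 (fun x => g (x, y))) ->
    (forall x, in_eigenspace A2 l2 (fun y => g (x, y))) ->
    wmass P \1_U g <= 2 * e * n2 P g].
Proof.
move=> ac1 ac2 cK K0 e0; have mK := borel_closed bT cK.
pose good (y : T2) (OC : set T1 * set T2) := [/\ open OC.1, closed OC.2, nbhs y OC.2,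
  forall x y', OC.2 y' -> K (x, y') -> OC.1 x &
  forall l phi, in_eigenspace A1 l phi -> wmass mu1 \1_(OC.1) phi <= e * n2 mu1 phi].
have good_ex y : mu1 [set x | K (x, y)] = 0%E -> exists OC, good y OC.
  move=> Ky0.
  have cKy : closed [set x | K (x, y)].
    apply: (@closed_comp _ _ (fun x => (x, y)) K) => // x _.
    by apply: cvg_pair; [exact: cvg_id|exact: cvg_cst].
  have [V [oV KV hV]] := eigen_upper_bound bT1 hT1 cT1 sT1 sa1 cr1 eig1 ac1 cKy Ky0 e0.
  (* These are the [y'] at which the slice of [K] leaves [V]. The set is closed, as a projection of
     a compact set, and misses [y], so regularity provides the closed neighbourhood. *)
  pose B := snd @` (K `&` (fst @^-1` (~` V))).
  have cB : closed B.
    apply: compact_closed => //; apply: continuous_compact.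
      by apply: continuous_subspaceT => p; exact: cvg_snd.
    apply: (subclosed_compact _ cT) => //; apply: closedI => //.
    by apply: closed_comp; [move=> p _; exact: cvg_fst|exact: open_closedC].
  have [W yW WB] : filter_from (nbhs y) closure (~` B).
    apply: (@compact_regular _ y setT hT2 cT2); first exact: filterT.
    apply: open_nbhs_nbhs; split; first exact: closed_openC.
    by move=> [[x y'] [/= Kxy nOx] yy]; apply: nOx; apply: KV; rewrite /= -yy.
  exists (V, closure W); split=> //=.
  - exact: closed_closure.
  - by apply: filterS yW; exact: subset_closure.
  - move=> x y' Wy' Kxy; apply: contrapT => nOx.
    by apply: (WB _ Wy'); exists (x, y').
pose G := [set y | exists OC, good y OC].
have oG : open G.
  rewrite openE => y [OC [h1 h2 h3 h4 h5]].
  have : nbhs y OC.2° by apply: open_nbhs_nbhs; split => //; exact: open_interior.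
  apply: filterS => y' Cy'; exists OC; split=> //.
have mG := borel_closed bT2 (open_closedC oG).
have G0 : mu2 (~` G) = 0%E.
  apply/(negligibleP _ mG).
  have aeK : {ae P, forall p, ~ K p}.
    by have /(negligibleP _ mK) := K0; apply: negligibleS => p /= /contrapT.
  have := ae_slices aeK; apply: negligibleS => y /= nGy h; apply: nGy.
  apply: good_ex; apply/(negligibleP mu1).
    rewrite (_ : [set x | _] = ysection K y); first exact: measurable_ysection.
    by apply/seteqP; split=> x /ysectionP.
  by apply: negligibleS h => x /= Kxy; apply.
have [V2 [oO2 GO2 hO2]] :=
  eigen_upper_bound bT2 hT2 cT2 sT2 sa2 cr2 eig2 ac2 (open_closedC oG) G0 e0.
have V2G y : ~ V2 y -> G y by move=> nO2; apply: contrapT => nG; exact/nO2/GO2.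
have /choice[OC OCP] : forall y, exists OC, ~ V2 y -> good y OC.
  move=> y; have [V2y|/V2G[OC h]] := pselect (V2 y); last by exists OC.
  by exists (set0, set0).
have cO2 : compact (~` V2).
  by apply: (subclosed_compact _ cT2) => //; exact: open_closedC.
move: cO2; rewrite compact_cover => /(_ T2 (~` V2) (fun y => (OC y).2°))[].
- by move=> y _; exact: open_interior.
- by move=> y nO2y; exists y => //; have [] := OCP y nO2y.
move=> D DO2 Dcov.
have [S [fS SV Scov]] : exists S : set T2, [/\ finite_set S, S `<=` ~` V2 &
    ~` V2 `<=` cover S (fun y => (OC y).2°)].
  eexists; split; [exact: (finite_fset D)| |exact: Dcov].
  by move=> s sD; have := DO2 s sD; rewrite inE.
pose U := [set p : T1 * T2 | forall s, S s -> (OC s).2 p.2 -> (OC s).1 p.1].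
have goodD s : S s -> good s (OC s).
  by move=> sS; apply: OCP; exact: SV.
have oU : open U.
  have -> : U = ~` (\bigcup_(s in S)
      (snd @^-1` (OC s).2 `&` fst @^-1` (~` (OC s).1))).
    apply/seteqP; split=> [p Up [s sD [/= Cp nOp]]|p nUp s sD Cp].
      by apply: nOp; exact: Up.
    by apply: contrapT => nOp; apply: nUp; exists s.
  apply: closed_openC; apply: closed_bigcup => //.
  move=> s sD; have [oOs cCs _ _ _] := goodD s sD; apply: closedI.
    by apply: closed_comp => // p _; exact: cvg_snd.
  by apply: closed_comp; [move=> p _; exact: cvg_fst|exact: open_closedC].
exists U; split=> //.
  move=> [x y] Kxy s sD /= Csy; have [_ _ _ h _] := goodD s sD.
  exact: h Csy Kxy.
move=> g l1 l2 gL s1 s2.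
have mU := borel_open bT oU.
have mV2 : measurable (snd @^-1` V2 : set (T1 * T2)).
  by apply: (borel_open bT); apply: open_comp => // p _; exact: cvg_snd.
have mUV : measurable (U `\` snd @^-1` V2) by exact: measurableD.
have s1L y := eigen_L2 sa1 (s1 y); have s2L x := eigen_L2 sa2 (s2 x).
have I01 d (T : measurableType d) (B : set T) x : 0 <= (\1_B x : R) <= 1.
  by rewrite ler0n/= indicE lern1 leq_b1.
have I1 d (T : measurableType d) (B : set T) x : `|\1_B x| <= 1 :> R.
  by rewrite ger0_norm//; have /andP[] := I01 d T B x.
have mI d (T : measurableType d) (B : set T) : measurable B ->
  measurable_fun setT (\1_B : T -> R) by move=> mB; exact: measurable_indic.
(* [U] is split according to whether [y] lies in [V2]; each part contributes at most the fraction
   [e], hence [2 * e]. *)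
have mass1 : 1 * wmass P \1_(snd @^-1` V2) g <= e * wmass P (fun=> 1) g.
  apply: wmass_prod_le1 => //; [by move=> p; rewrite ler01 lexx|exact: ltW|].
  by move=> x; rewrite mul1r wmass1; exact: (hO2 _ _ (s2 x)).
have mass2 : 1 * wmass P \1_(U `\` snd @^-1` V2) g <= e * wmass P (fun=> 1) g.
  apply: wmass_prod_le2 => //; [by move=> p; rewrite ler01 lexx|exact: ltW|].
  move=> y; rewrite mul1r wmass1.
  have [V2y|nV2y] := pselect (V2 y).
    rewrite /wmass (@eq_Rintegral _ _ _ _ _ (cst 0)).
      by rewrite Rintegral_cst// mul0r mulr_ge0 ?n2_ge0// ltW.
    move=> x _; rewrite indicE memNset ?mul0r// => -[_]; exact.
  have [s sS Csy] := Scov y nV2y.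
  have [oOs _ _ _ hs] := goodD s sS.
  apply: le_trans (hs _ _ (s1 y)).
  apply: le_wmass => //.
  - apply: (measurableT_comp (mI _ _ _ mUV)); exact: (@pair2_measurable _ _ T1 T2 y).
  - by apply: mI; exact: (borel_open bT1).
  - move=> x; rewrite !indicE ler_nat; have [/set_mem [Uxy _]|//] := boolP ((x, y) \in _).
    rewrite (_ : (x \in _) = true)//; apply/mem_set.
    by apply: (Uxy s sS); exact: interior_subset.
have iI (B : set (T1 * T2)) : measurable B ->
    P.-integrable setT (EFin \o (fun p => \1_B p * cmod (g p) ^+ 2)).
  by move=> mB; exact: (integrable_wmass (mI _ _ _ mB) (@I1 _ _ B) gL).
rewrite mul1r wmass1 in mass1; rewrite mul1r wmass1 in mass2.
apply: (@le_trans _ _ (wmass P \1_(snd @^-1` V2) g + wmass P \1_(U `\` snd @^-1` V2) g)).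
  rewrite -RintegralD//; [|exact: iI|exact: iI].
  apply: le_Rintegral => //; [exact: iI|by apply: integrable_EFinD; exact: iI|].
  move=> p _; rewrite -mulrDl ler_wpM2r ?cmod_sqr_ge0// !indicE in_setD -natrD ler_nat.
  by case: (p \in U); case: (p \in _).
by rewrite -mulrA mulr_natl mulr2n lerD.
Qed.

Lemma tensor_sum_dominates (q : probability (T1 * T2)%type R) :
  (forall q : probability T1 R, local_QL mu1 A1 q -> q `<< mu1) ->
  (forall q : probability T2 R, local_QL mu2 A2 q -> q `<< mu2) ->
  local_QL P (tensor_sum mu1 mu2 A1 A2) q -> q `<< P.
Proof.
move=> ac1 ac2 qQL; apply/null_content_dominatesP => A mA A0.
have qK K : closed K -> P K = 0%E -> q K = 0%E.
  move=> cK K0; have mK := borel_closed bT cK.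
  apply/eqP; rewrite eq_le measure_ge0 andbT; apply/lee_addgt0Pr => e e0; rewrite add0e.
  (* Two thirds are spent on the mass of [U] under an eigenfunction and one third on its distance to
     [q]. *)
  have e3 : 0 < e / 3 by rewrite divr_gt0.
  have [U [oU KU hU]] := tensor_sum_closed_null ac1 ac2 cK K0 e3.
  have [f [cf f01 f1 f0]] := urysohn_closed_open R hT cT cK oU KU.
  have mf := borel_continuous bT cf.
  have [g [l1 [l2 [gL g1 gq s1 s2]]]] := tensor_sum_QL qQL cf e3.
  have iqf : q.-integrable setT (EFin \o f).
    have i1 : q.-integrable setT (EFin \o cst 1%R) by exact: finite_measure_integrable_cst.
    have fn x : `|f x| <= 1 by have /andP[? ?] := f01 x; rewrite ger0_norm.
    have := integrable_bdd_mul mf fn i1.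
    by under eq_fun do rewrite mulr1.
  apply: (@le_trans _ _ (\int[q]_x f x)%:E).
    have -> : q K = (\int[q]_p (\1_K p)%:E)%E by rewrite integral_indic// setIT.
    rewrite /Rintegral fineK; last exact: integrable_fin_num.
    apply: ge0_le_integral => //.
    - exact/measurable_EFinP/measurable_indic.
    - exact/measurable_EFinP.
    - move=> p _; rewrite lee_fin indicE.
      have [/set_mem/f1 ->//|_] := boolP (p \in K).
      by have /andP[] := f01 p.
  rewrite lee_fin.
  have fU : wmass P f g <= wmass P \1_U g.
    apply: le_wmass => //.
    - by apply: measurable_indic; exact: (borel_open bT).
    - by move=> p; rewrite ler0n/= indicE lern1 leq_b1.
    - move=> p; rewrite indicE; have [_|/negP nU] := boolP (p \in U).
        by have /andP[] := f01 p.
      by rewrite f0// => Up; apply: nU; exact/mem_set.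
  have := hU g l1 l2 gL s1 s2; rewrite g1.
  move: gq; rewrite ltr_norml => /andP[h1 h2] h3; lra.
apply/eqP; rewrite eq_le measure_ge0 andbT; apply/lee_addgt0Pr => e e0; rewrite add0e.
have [K [cK KA qAK]] := inner_regular bT hT cT sT q mA e0.
have mK := borel_closed bT cK.
have K0 : P K = 0%E.
  by apply/eqP; rewrite eq_le measure_ge0 andbT -A0; apply: le_measure; rewrite ?inE.
rewrite -(setDKU KA) (le_trans (measureU2 _ _ _))//; first exact: measurableD.
by rewrite [X in (_ + X)%E]qK// adde0.
Qed.

End tensor_sum_product.

Theorem theorem1 (R : realType)
  (d1 d2 : measure_display) (M1 : measTopType d1) (M2 : measTopType d2)
  (man1 : smooth_compact_manifold R M1) (man2 : smooth_compact_manifold R M2)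
  (borel1 : is_borel M1) (borel2 : is_borel M2)
  (rho1 : probability M1 R) (rho2 : probability M2 R)
  (D1 : (M1 -> R[i]) -> (M1 -> R[i]) -> Prop)
  (D2 : (M2 -> R[i]) -> (M2 -> R[i]) -> Prop)
  (sa1 : self_adjoint rho1 D1) (sa2 : self_adjoint rho2 D2)
  (bb1 : bounded_below rho1 D1) (bb2 : bounded_below rho2 D2)
  (cr1 : compact_resolvent rho1 D1) (cr2 : compact_resolvent rho2 D2)
  (lam1 lam2 : nat -> R) (m1 m2 : nat -> nat) (m : nat -> nat -> nat)
  (eig1 : eigenvalue_enumeration rho1 D1 lam1 m1)
  (eig2 : eigenvalue_enumeration rho2 D2 lam2 m2)
  (mult : forall i j, multiplicity (rho1 \x rho2)%E
            (tensor_sum rho1 rho2 D1 D2) (lam1 i + lam2 j) (m i j)) :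
  (unique_continuation rho1 D1 -> unique_continuation rho2 D2 ->
   (forall i j, m i j = (m1 i * m2 j)%N) ->
   (forall q : probability M1 R, local_QL rho1 D1 q -> full_support q) ->
   (forall q : probability M2 R, local_QL rho2 D2 q -> full_support q) ->
   forall q : probability (M1 * M2)%type R,
     local_QL (rho1 \x rho2)%E (tensor_sum rho1 rho2 D1 D2) q ->
     full_support q)
  /\
  (bounded_eigenfunctions rho1 D1 -> bounded_eigenfunctions rho2 D2 ->
   (forall i j, m i j = (m1 i * m2 j)%N) ->
   (forall q : probability M1 R, local_QL rho1 D1 q -> q `<< rho1) ->
   (forall q : probability M2 R, local_QL rho2 D2 q -> q `<< rho2) ->
   forall q : probability (M1 * M2)%type R,
     local_QL (rho1 \x rho2)%E (tensor_sum rho1 rho2 D1 D2) q ->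
     q `<< (rho1 \x rho2)%E).
Proof.
have hT1 := manifold_hausdorff man1; have hT2 := manifold_hausdorff man2.
have cT1 := manifold_compact man1; have cT2 := manifold_compact man2.
have sT1 := manifold_second_countable man1.
have sT2 := manifold_second_countable man2.
split=> [uc1 uc2 mm fs1 fs2 q|_ _ mm ac1 ac2 q].
- exact: (tensor_sum_full_support borel1 hT1 cT1 sT1 borel2 hT2 cT2 sT2
    sa1 sa2 cr1 cr2 eig1 eig2 mult mm uc1 uc2 fs1 fs2).
- exact: (tensor_sum_dominates borel1 hT1 cT1 sT1 borel2 hT2 cT2 sT2
    sa1 sa2 cr1 cr2 eig1 eig2 mult mm ac1 ac2).
Qed.
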